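(* Let $N\in\mathbb{N}$ and $x\in\mathbb{C}\setminus(-\infty,0]$. For $k\in\mathbb{N}$ define $$\mathscr{B}(k,N,x):=\begin{cases}(-1)^{k+N+1}x^{1/N}\zeta\left(1+\frac{k}{N}\right) & \text{if } k=N,\\ 0 & \text{if } k\neq N.\end{cases}$$ (a) If $k\in\mathbb{N}$ satisfies $1<k\le N$, then $$x^{\frac{1-k}{N}}\mathscr{F}_{k,N}(x)-\frac{(-1)^k}{N}\sum_{j=-(N-1)}^{(N-1)}{}''\, e^{i\pi j(k-1)/N}\mathscr{F}_{\frac{N+k-1}{N},\frac{1}{N}}\left(\frac{e^{-i\pi j/N}}{x^{1/N}}\right)$$ $$=\frac{\pi}{N}\frac{\zeta\left(1+\frac{k-1}{N}\right)}{\sin\left(\frac{\pi}{N}(k-1)\right)}+x^{\frac{1-k}{N}}\Big(-(\gamma+\log x)\zeta(k)+N\zeta'(k)\Big)-\frac{\zeta(k+N)}{x^{\frac{N+k-1}{N}}}+\mathscr{B}(k,N,x).$$ (b) Moreover, $$\mathscr{F}_{1,N}(x)+\frac{1}{N}\sum_{j=-(N-1)}^{(N-1)}{}''\,\mathscr{F}_{1,\frac{1}{N}}\left(\frac{e^{-i\pi j/N}}{x^{1/N}}\right)=\frac{1}{N}\left\{\frac{\pi^2}{6}-(N-1)\gamma\log x+\frac12(\log x)^2-N\gamma^2-(N^2+1)\gamma_1\right\}-\frac{\zeta(N+1)}{x}+\mathscr{B}(1,N,x).$$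
   Context: For positive real numbers $k,N$ with $k+N>1$ and $x\in\mathbb{C}\setminus(-\infty,0]$, the extended higher Herglotz function is $\mathscr{F}_{k,N}(x):=\sum_{n=1}^{\infty}\frac{\psi(n^Nx)-\log(n^Nx)}{n^k}$, where $\psi=\Gamma'/\Gamma$ is the digamma function and $\log$ is the principal branch. All non-integer powers are principal branches. The notation $\sum_{j=-(N-1)}^{(N-1)}{}''$ denotes a sum over $j=-(N-1),-(N-3),\dots,N-3,N-1$ (step $2$). $\zeta$ is the Riemann zeta function, $\gamma$ is Euler's constant and $\gamma_1$ is the first Stieltjes constant. *)

(* Defs.v *)
From Stdlib Require Import Reals ZArith Arith.
From Coquelicot Require Export Coquelicot.

Open Scope R_scope.

Definition CLim_seq (u : nat -> C) : C :=
  (real (Lim_seq (fun n => Re (u n))), real (Lim_seq (fun n => Im (u n)))).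

Definition CSeries (a : nat -> C) : C :=
  (Series (fun n => Re (a n)), Series (fun n => Im (a n))).

Definition Cexp (z : C) : C :=
  (exp (Re z) * cos (Im z), exp (Re z) * sin (Im z)).

(* Principal argument, with values in (-PI, PI] for z <> 0. *)
Definition Carg (z : C) : R :=
  if Rle_dec 0 (Im z) then acos (Re z / Cmod z) else - acos (Re z / Cmod z).

Definition Clog (z : C) : C := (ln (Cmod z), Carg z).

Definition Cpower (z a : C) : C := Cexp (a * Clog z).

(* The complement of (-infinity, 0]. *)
Definition slit_plane (z : C) : Prop := ~ (Im z = 0 /\ Re z <= 0).

(* z (z + 1) ... (z + n) *)
Fixpoint Crising (z : C) (n : nat) : C :=
  match n with
  | O => z
  | S m => Crising z m * (z + INR n)
  end%C.

(* Euler-Gauss product formula, valid on C minus the non-positive integers. *)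
Definition CGamma (z : C) : C :=
  CLim_seq (fun n => Cpower (INR n) z * INR (fact n) / Crising z n)%C.

(* [C_derive] takes the limit of the difference quotient along the real direction;
   it is the complex derivative wherever the latter exists ([is_C_derive_unique]). *)
Definition Cdigamma (z : C) : C := (C_derive CGamma z / CGamma z)%C.

(* Riemann zeta function on Re s > 1. *)
Definition Czeta (s : C) : C :=
  CSeries (fun n => Cpower (INR (S n)) (- s)).

Definition euler_gamma : R :=
  real (Lim_seq (fun n =>
    sum_n_m (fun m => / INR m) 1 n - ln (INR n))).

Definition stieltjes_gamma1 : R :=
  real (Lim_seq (fun n =>
    sum_n_m (fun m => ln (INR m) / INR m) 1 n - (ln (INR n)) ^ 2 / 2)).

(* The summand of index n is the term n + 1 of the series, which starts at 1. *)
Definition Herglotz (k N : R) (x : C) : C :=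
  CSeries (fun n =>
    let y := (Rpower (INR (S n)) N * x)%C in
    ((Cdigamma y - Clog y) / Rpower (INR (S n)) k)%C).

(* Sum of f j over j = -(N-1), -(N-3), ..., N-3, N-1 (N terms), for N >= 1. *)
Definition sum_step2 (N : nat) (f : Z -> C) : C :=
  sum_n (fun l => f (2 * Z.of_nat l - (Z.of_nat N - 1))%Z) (N - 1).

Definition Bterm (k N : nat) (x : C) : C :=
  if Nat.eq_dec k N then
    ((-1) ^ (k + N + 1) * Cpower x (1 / INR N)%R * Czeta (1 + INR k / INR N)%R)%C
  else 0.

(* Main.v *)
(** Everything rests on the limit
    [psi (y + 1) - log y = lim_M (log M - log y - sum_(m <= M) 1 / (m + y))] and on the partial
    fraction expansion of [t^(N-k) / (t^N + m/x)], whose poles are the points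
    [- exp (- i pi j / N) (m/x)^(1/N)].  Inserting them, the two Herglotz sums become the two
    iterated sums of the kernel [b (m, n) = n^(N-k) / (m (n^N + m/x))], because
    [n^(-k) / (m + n^N x) + b (m, n) = n^(-k) / m].  For [k > 1] the kernel is absolutely summable
    and the identity is Fubini's theorem.  For [k = 1] one truncates at [n <= P] and [m <= P^N];
    what remains besides harmonic sums is
    [sum_(n <= P) log (1 + x (n/P)^N) / n + 1/N sum_(m <= P^N) log (1 + m / (P^N x)) / m], whose
    derivative along [s -> exp (s log x)] tends to [s (log x)^2 / N]; its limit at [x = 1] is found
    from the values at [x = i] and [x = - i], which relate the exponents [N] and [2 N]. *)

Require Import Defs.
From Stdlib Require Import Reals ZArith Arith Lra Lia.
From Coquelicot Require Import Coquelicot.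

Open Scope R_scope.

Lemma C_eq_Re_Im (z w : C) : Re z = Re w -> Im z = Im w -> z = w.
Proof. apply injective_projections. Qed.

Lemma re_minus (z w : C) : Re (z - w) = Re z - Re w.
Proof. reflexivity. Qed.

Lemma im_minus (z w : C) : Im (z - w) = Im z - Im w.
Proof. reflexivity. Qed.

Lemma im_le_Cmod (z : C) : Rabs (Im z) <= Cmod z.
Proof. eapply Rle_trans; [apply Rmax_r | apply Rmax_Cmod]. Qed.

Lemma Cmod_le_re_im (z : C) : Cmod z <= Rabs (Re z) + Rabs (Im z).
Proof.
  assert (Cmod_sqr := Cmod2_alt z). rewrite <- (pow2_abs (Re z)), <- (pow2_abs (Im z)) in Cmod_sqr.
  generalize (Cmod_ge_0 z) (Rabs_pos (Re z)) (Rabs_pos (Im z)). nra.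
Qed.

Lemma Cmod_minus_sym (z w : C) : Cmod (z - w) = Cmod (w - z).
Proof. rewrite <- Cmod_opp, Copp_minus_distr. reflexivity. Qed.

Lemma RtoC_neq_0 (r : R) : r <> 0 -> RtoC r <> 0%C.
Proof. intros r_neq_0 E. apply r_neq_0, RtoC_inj, E. Qed.

(** * Partial sums and limits *)

(* Unlike [sum_n a n], which ends at [a n], the sum [psum a n] has [n] terms. *)
Fixpoint psum {G : AbelianMonoid} (a : nat -> G) (n : nat) : G :=
  match n with
  | O => zero
  | S m => plus (psum a m) (a m)
  end.

Lemma psum_ext {G : AbelianMonoid} (a b : nat -> G) (n : nat) :
  (forall i, (i < n)%nat -> a i = b i) -> psum a n = psum b n.
Proof.
  induction n as [|n IHn]; intros a_eq_b; [reflexivity|].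
  cbn [psum]. rewrite IHn, a_eq_b; auto.
Qed.

Lemma psum_sum_n {G : AbelianMonoid} (a : nat -> G) (n : nat) : psum a (S n) = sum_n a n.
Proof.
  induction n as [|n IHn].
  - rewrite sum_O. apply plus_zero_l.
  - rewrite sum_Sn, <- IHn. reflexivity.
Qed.

Lemma psum_sum_n_m {G : AbelianMonoid} (a : nat -> G) (n : nat) :
  psum (fun i => a (S i)) n = sum_n_m a 1 n.
Proof.
  destruct n as [|n]; [rewrite sum_n_m_zero; auto|].
  rewrite psum_sum_n. unfold sum_n. apply sum_n_m_S.
Qed.

Lemma psum_switch {G : AbelianMonoid} (a : nat -> nat -> G) (m n : nat) :
  psum (fun i => psum (a i) n) m = psum (fun j => psum (fun i => a i j) m) n.
Proof.
  destruct m as [|m], n as [|n]; cbn [psum]; auto.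
  - rewrite <- plus_zero_l at 1. f_equal. induction n as [|n IHn]; cbn [psum]; auto.
    rewrite <- IHn. symmetry; apply plus_zero_l.
  - rewrite plus_zero_r. induction m as [|m IHm]; cbn [psum]; auto.
    rewrite IHm. apply plus_zero_l.
  - change (psum (fun i => psum (a i) (S n)) (S m) =
      psum (fun j => psum (fun i => a i j) (S m)) (S n)).
    rewrite !psum_sum_n.
    rewrite (sum_n_ext _ (fun i => sum_n (a i) n)) by (intros; apply psum_sum_n).
    rewrite (sum_n_ext (fun j => psum _ _) (fun j => sum_n (fun i => a i j) m))
      by (intros; apply psum_sum_n).
    apply sum_n_switch.
Qed.

Lemma psum_telescoping {G : AbelianGroup} (u : nat -> G) (n : nat) :
  psum (fun i => minus (u (S i)) (u i)) n = minus (u n) (u O).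
Proof.
  induction n as [|n IHn]; cbn [psum].
  - symmetry. apply plus_opp_r.
  - rewrite IHn, plus_comm. symmetry. apply minus_trans.
Qed.

Lemma psum_S_C (a : nat -> C) (n : nat) : psum a (S n) = (psum a n + a n)%C :> C.
Proof. reflexivity. Qed.

Lemma psum_Cext (a b : nat -> C) (n : nat) :
  (forall i, (i < n)%nat -> a i = b i) -> psum a n = psum b n :> C.
Proof. apply psum_ext. Qed.

Lemma psum_Cplus (a b : nat -> C) (n : nat) :
  psum (fun i => a i + b i)%C n = (psum a n + psum b n)%C :> C.
Proof.
  induction n as [|n IHn]; [symmetry; apply Cplus_0_l|]. rewrite !psum_S_C, IHn. ring.
Qed.

Lemma psum_Cscal (c : C) (a : nat -> C) (n : nat) :
  psum (fun i => c * a i)%C n = (c * psum a n)%C :> C.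
Proof.
  induction n as [|n IHn]; [symmetry; apply Cmult_0_r|]. rewrite !psum_S_C, IHn. ring.
Qed.

Lemma psum_Cminus (a b : nat -> C) (n : nat) :
  psum (fun i => a i - b i)%C n = (psum a n - psum b n)%C :> C.
Proof.
  induction n as [|n IHn]; [symmetry; apply Cplus_opp_r|]. rewrite !psum_S_C, IHn. ring.
Qed.

Lemma psum_Cconst (c : C) (n : nat) : psum (fun _ => c) n = (INR n * c)%C :> C.
Proof.
  induction n as [|n IHn]; [symmetry; apply Cmult_0_l|].
  rewrite psum_S_C, IHn, S_INR, RtoC_plus. ring.
Qed.

Lemma psum_RtoC (a : nat -> R) (n : nat) : psum (fun i => RtoC (a i)) n = RtoC (psum a n) :> C.
Proof.
  induction n as [|n IHn]; [reflexivity|]. rewrite psum_S_C, IHn, <- RtoC_plus. reflexivity.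
Qed.

Lemma Re_psum (a : nat -> C) (n : nat) : Re (psum a n) = psum (fun i => Re (a i)) n.
Proof. induction n as [|n IHn]; cbn [psum]; [reflexivity|]. rewrite <- IHn. reflexivity. Qed.

Lemma Im_psum (a : nat -> C) (n : nat) : Im (psum a n) = psum (fun i => Im (a i)) n.
Proof. induction n as [|n IHn]; cbn [psum]; [reflexivity|]. rewrite <- IHn. reflexivity. Qed.

Lemma psum_S_R (a : nat -> R) (n : nat) : psum a (S n) = psum a n + a n :> R.
Proof. reflexivity. Qed.

Lemma psum_Rscal (c : R) (a : nat -> R) (n : nat) :
  psum (fun i => c * a i) n = c * psum a n :> R.
Proof.
  induction n as [|n IHn]; [symmetry; apply Rmult_0_r|]. rewrite !psum_S_R, IHn. ring.
Qed.

Lemma psum_Rconst (c : R) (n : nat) : psum (fun _ => c) n = INR n * c :> R.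
Proof.
  induction n as [|n IHn]; [symmetry; apply Rmult_0_l|]. rewrite psum_S_R, IHn, S_INR. ring.
Qed.

Lemma psum_le (a b : nat -> R) (n : nat) :
  (forall i, (i < n)%nat -> a i <= b i) -> psum a n <= psum b n.
Proof.
  induction n as [|n IHn]; intros a_le_b; [apply Rle_refl|].
  apply Rplus_le_compat; auto.
Qed.

Lemma psum_nonneg (a : nat -> R) (n : nat) :
  (forall i, (i < n)%nat -> 0 <= a i) -> 0 <= psum a n.
Proof.
  intros a_nonneg. rewrite <- (Rmult_0_r (INR n)), <- psum_Rconst. apply psum_le; auto.
Qed.

Lemma Cmod_psum_le (a : nat -> C) (b : nat -> R) (n : nat) :
  (forall i, (i < n)%nat -> Cmod (a i) <= b i) -> Cmod (psum a n) <= psum b n.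
Proof.
  induction n as [|n IHn]; intros a_le_b.
  - change (Cmod 0 <= 0). rewrite Cmod_0. apply Rle_refl.
  - rewrite psum_S_C. eapply Rle_trans; [apply Cmod_triangle|].
    apply Rplus_le_compat; auto.
Qed.

Lemma is_series_psum {K : AbsRing} {V : NormedModule K} (a : nat -> V) (l : V) :
  is_series a l <-> filterlim (psum a) eventually (locally l).
Proof.
  split; intros lim_a P l_in_P.
  - destruct (lim_a P l_in_P) as [n0 in_P]. exists (S n0). intros [|n] le_n; [lia|].
    rewrite psum_sum_n. apply in_P. lia.
  - destruct (lim_a P l_in_P) as [n0 in_P]. exists n0. intros n le_n.
    rewrite <- psum_sum_n. apply in_P. lia.
Qed.

Lemma is_series_psum_R (a : nat -> R) (l : R) : is_series a l <-> is_lim_seq (psum a) l.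
Proof. apply (is_series_psum (V := R_NormedModule)). Qed.

Lemma ex_series_Rscal (c : R) (a : nat -> R) : ex_series a -> ex_series (fun n => c * a n).
Proof. intros ex_a. apply (ex_series_scal_l c a ex_a). Qed.

Lemma psum_le_Series (a : nat -> R) (n : nat) :
  (forall i, 0 <= a i) -> ex_series a -> psum a n <= Series a.
Proof.
  intros a_nonneg ex_a. apply (is_lim_seq_incr_compare (psum a)).
  - apply is_series_psum_R, Series_correct, ex_a.
  - intros m. rewrite psum_S_R. generalize (a_nonneg m). lra.
Qed.

Lemma ex_lim_of_summable_increments {K : AbsRing} {V : NormedModule K} (u : nat -> V) :
  ex_series (fun n => minus (u (S n)) (u n)) ->
  exists l : V, filterlim u eventually (locally l).
Proof.
  intros [s sum_increments]. apply is_series_psum in sum_increments.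
  exists (plus s (u O)).
  apply filterlim_ext with (fun n => plus (psum (fun i => minus (u (S i)) (u i)) n) (u O)).
  - intros n. rewrite psum_telescoping. unfold minus.
    rewrite <- plus_assoc, plus_opp_l. apply plus_zero_r.
  - apply (filterlim_comp_2 (F := eventually) _ (fun _ => u O) _ sum_increments
      (filterlim_const _) (filterlim_plus s (u O))).
Qed.

Lemma ex_series_telescoping_le (a d : nat -> R) :
  (forall n, 0 <= d n) -> (forall n, 0 <= a n <= d n - d (S n)) -> ex_series a.
Proof.
  intros d_nonneg a_bounds.
  destruct (ex_finite_lim_seq_decr d 0) as [l lim_d]; auto.
  { intros n. generalize (a_bounds n). lra. }
  apply (ex_series_le (K := R_AbsRing) (V := R_CompleteNormedModule) a
    (fun n => d n - d (S n))).
  - intros n. change (Rabs (a n) <= d n - d (S n)).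
    rewrite Rabs_pos_eq; apply a_bounds.
  - exists (d O - l). apply is_series_psum_R.
    apply is_lim_seq_ext with (fun n => d O - d n).
    + intros n. induction n as [|n IHn]; [apply Rminus_diag|]. rewrite psum_S_R, <- IHn. ring.
    + apply is_lim_seq_minus'; auto. apply is_lim_seq_const.
Qed.

Local Notation is_Clim_seq u l := (filterlim u eventually (locally (l : C))).

Lemma is_series_psum_C (a : nat -> C) (l : C) : is_series a l <-> is_Clim_seq (psum a) l.
Proof. apply (is_series_psum (V := C_NormedModule)). Qed.

Lemma is_lim_seq_squeeze_0 (u v : nat -> R) :
  (forall n, 0 <= u n <= v n) -> is_lim_seq v 0 -> is_lim_seq u 0.
Proof.
  intros u_bounds lim_v. apply is_lim_seq_le_le with (fun _ => 0) v; auto.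
  apply is_lim_seq_const.
Qed.

Lemma is_lim_seq_scal_0 (c : R) (u : nat -> R) :
  is_lim_seq u 0 -> is_lim_seq (fun n => c * u n) 0.
Proof.
  intros lim_u. rewrite <- (Rmult_0_r c). apply is_lim_seq_mult'; auto.
  apply is_lim_seq_const.
Qed.

Lemma is_lim_seq_plus_0 (u v : nat -> R) :
  is_lim_seq u 0 -> is_lim_seq v 0 -> is_lim_seq (fun n => u n + v n) 0.
Proof. intros. rewrite <- (Rplus_0_r 0). apply is_lim_seq_plus'; auto. Qed.

Lemma is_Clim_seq_Cmod (u : nat -> C) (l : C) :
  is_Clim_seq u l <-> is_lim_seq (fun n => Cmod (u n - l)) 0.
Proof.
  rewrite (filterlim_locally_ball_norm (U := C_NormedModule) u l). rewrite <- is_lim_seq_spec.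
  split; intros lim_u eps; destruct (lim_u eps) as [n0 near_l]; exists n0; intros n le_n.
  - rewrite Rminus_0_r, Rabs_pos_eq by apply Cmod_ge_0. apply (near_l n le_n).
  - specialize (near_l n le_n). rewrite Rminus_0_r, Rabs_pos_eq in near_l by apply Cmod_ge_0.
    exact near_l.
Qed.

Lemma is_Clim_seq_bound (u : nat -> C) (l : C) (d : nat -> R) :
  (forall n, Cmod (u n - l) <= d n) -> is_lim_seq d 0 -> is_Clim_seq u l.
Proof.
  intros u_near_l lim_d. apply is_Clim_seq_Cmod, is_lim_seq_squeeze_0 with d; auto.
  intros n. split; auto using Cmod_ge_0.
Qed.

Lemma is_Clim_seq_plus (u v : nat -> C) (a b : C) :
  is_Clim_seq u a -> is_Clim_seq v b -> is_Clim_seq (fun n => u n + v n)%C (a + b)%C.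
Proof.
  intros lim_u lim_v.
  exact (filterlim_comp_2 u v plus lim_u lim_v (filterlim_plus (V := C_NormedModule) a b)).
Qed.

Lemma is_Clim_seq_scal (c : C) (u : nat -> C) (a : C) :
  is_Clim_seq u a -> is_Clim_seq (fun n => c * u n)%C (c * a)%C.
Proof.
  intros lim_u.
  exact (filterlim_comp _ _ _ u _ _ _ _ lim_u (filterlim_scal_r (V := C_NormedModule) c a)).
Qed.

Lemma is_Clim_seq_minus (u v : nat -> C) (a b : C) :
  is_Clim_seq u a -> is_Clim_seq v b -> is_Clim_seq (fun n => u n - v n)%C (a - b)%C.
Proof.
  intros lim_u lim_v. apply is_Clim_seq_plus; auto.
  exact (filterlim_comp _ _ _ v _ _ _ _ lim_v (filterlim_opp (V := C_NormedModule) b)).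
Qed.

Lemma is_Clim_seq_psum (u : nat -> nat -> C) (l : nat -> C) (N : nat) :
  (forall i, (i < N)%nat -> is_Clim_seq (u i) (l i)) ->
  is_Clim_seq (fun n => psum (fun i => u i n) N) (psum l N).
Proof.
  induction N as [|N IHN]; intros lim_u.
  - exact (filterlim_const (RtoC 0)).
  - apply is_Clim_seq_plus; auto.
Qed.

Lemma is_Clim_seq_incr_n (u : nat -> C) (k : nat) (l : C) :
  is_Clim_seq u l <-> is_Clim_seq (fun n => u (n + k)%nat) l.
Proof.
  rewrite !is_Clim_seq_Cmod. apply (is_lim_seq_incr_n (fun n => Cmod (u n - l))).
Qed.

Lemma is_Clim_seq_incr_1 (u : nat -> C) (l : C) :
  is_Clim_seq u l <-> is_Clim_seq (fun n => u (S n)) l.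
Proof.
  rewrite !is_Clim_seq_Cmod. apply (is_lim_seq_incr_1 (fun n => Cmod (u n - l))).
Qed.

Lemma is_Clim_seq_unique (u : nat -> C) (a b : C) :
  is_Clim_seq u a -> is_Clim_seq u b -> a = b.
Proof. apply (filterlim_locally_unique (V := C_NormedModule)). Qed.

Lemma is_Clim_seq_Re_Im (u : nat -> C) (l : C) :
  is_Clim_seq u l <->
  is_lim_seq (fun n => Re (u n)) (Re l) /\ is_lim_seq (fun n => Im (u n)) (Im l).
Proof.
  split.
  - rewrite is_Clim_seq_Cmod. intros lim_u.
    split; apply is_lim_seq_spec; intros eps; apply is_lim_seq_spec in lim_u;
      destruct (lim_u eps) as [n0 near_l]; exists n0; intros n le_n; specialize (near_l n le_n);
      rewrite Rminus_0_r, Rabs_pos_eq in near_l by apply Cmod_ge_0;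
      (eapply Rle_lt_trans; [|exact near_l]).
    + rewrite <- re_minus. apply re_le_Cmod.
    + rewrite <- im_minus. apply im_le_Cmod.
  - intros [lim_re lim_im].
    assert (dist_lim_0 : forall (v : nat -> R) (m : R), is_lim_seq v m ->
      is_lim_seq (fun n => Rabs (v n - m)) 0).
    { intros v m lim_v. apply (is_lim_seq_abs_0 (fun n => v n - m)).
      rewrite <- (Rminus_diag m). apply is_lim_seq_minus'; auto. apply is_lim_seq_const. }
    apply is_Clim_seq_bound
      with (fun n => Rabs (Re (u n) - Re l) + Rabs (Im (u n) - Im l)).
    + intros n. apply Cmod_le_re_im.
    + apply is_lim_seq_plus_0; auto.
Qed.

Lemma is_Clim_seq_RtoC (u : nat -> R) (l : R) :
  is_lim_seq u l -> is_Clim_seq (fun n => RtoC (u n)) l.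
Proof. intros lim_u. apply is_Clim_seq_Re_Im. split; [exact lim_u | apply is_lim_seq_const]. Qed.

Lemma CLim_seq_unique (u : nat -> C) (l : C) : is_Clim_seq u l -> CLim_seq u = l.
Proof.
  rewrite is_Clim_seq_Re_Im. intros [lim_re lim_im]. apply C_eq_Re_Im; simpl.
  - rewrite (is_lim_seq_unique _ _ lim_re). reflexivity.
  - rewrite (is_lim_seq_unique _ _ lim_im). reflexivity.
Qed.

Lemma Cmod_Clim_minus_le (u : nat -> C) (l a : C) (M : R) :
  is_Clim_seq u l -> (forall n, Cmod (u n - a) <= M) -> Cmod (l - a) <= M.
Proof.
  rewrite is_Clim_seq_Cmod. intros lim_u u_near_a.
  assert (gap_le : forall n, Cmod (l - a) - M <= Cmod (u n - l)).
  { intros n. assert (triangle := Cmod_triangle (l - u n) (u n - a)).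
    replace (l - u n + (u n - a))%C with (l - a)%C in triangle by ring.
    rewrite (Cmod_minus_sym l (u n)) in triangle. generalize (u_near_a n). lra. }
  generalize (is_lim_seq_le _ _ _ _ gap_le (is_lim_seq_const _) lim_u). simpl. lra.
Qed.

Lemma CSeries_unique (a : nat -> C) (l : C) : is_series a l -> CSeries a = l.
Proof.
  rewrite is_series_psum_C. intros lim_a. apply is_Clim_seq_Re_Im in lim_a.
  destruct lim_a as [lim_re lim_im].
  apply C_eq_Re_Im; apply is_series_unique, is_series_psum_R.
  - eapply filterlim_ext; [intros n; apply Re_psum | exact lim_re].
  - eapply filterlim_ext; [intros n; apply Im_psum | exact lim_im].
Qed.

Lemma is_series_RtoC (a : nat -> R) (l : R) :
  is_series a l -> is_series (fun n => RtoC (a n)) (RtoC l).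
Proof.
  rewrite is_series_psum_R, is_series_psum_C. intros lim_a.
  eapply filterlim_ext; [intros n; symmetry; apply psum_RtoC|]. apply is_Clim_seq_RtoC, lim_a.
Qed.

Lemma is_series_Cext (a b : nat -> C) (l : C) :
  (forall n, a n = b n) -> is_series a l -> is_series b l.
Proof. apply is_series_ext. Qed.

Lemma is_series_Cscal (c : C) (a : nat -> C) (l : C) :
  is_series a l -> is_series (fun n => c * a n)%C (c * l)%C.
Proof. apply (is_series_scal (V := C_NormedModule)). Qed.

Lemma is_series_Cplus (a b : nat -> C) (la lb : C) :
  is_series a la -> is_series b lb -> is_series (fun n => a n + b n)%C (la + lb)%C.
Proof. apply (is_series_plus (V := C_NormedModule)). Qed.

Lemma is_series_Cminus (a b : nat -> C) (la lb : C) :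
  is_series a la -> is_series b lb -> is_series (fun n => a n - b n)%C (la - lb)%C.
Proof. apply (is_series_minus (V := C_NormedModule)). Qed.

Lemma is_series_Cunique (a : nat -> C) (l m : C) : is_series a l -> is_series a m -> l = m.
Proof. rewrite !is_series_psum_C. apply is_Clim_seq_unique. Qed.

Lemma ex_series_Cmod_le (a : nat -> C) (b : nat -> R) :
  (forall n, Cmod (a n) <= b n) -> ex_series b -> exists l : C, is_series a l.
Proof. apply (ex_series_le (V := C_CompleteNormedModule)). Qed.

Lemma ex_Clim_of_telescoping_bound (u : nat -> C) (d : nat -> R) :
  (forall n, 0 <= d n) -> (forall n, Cmod (u (S n) - u n) <= d n - d (S n)) ->
  exists l, is_Clim_seq u l /\ forall n, Cmod (l - u n) <= d n.
Proof.
  intros d_nonneg step_le.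
  destruct (ex_lim_of_summable_increments (V := C_NormedModule) u) as [l lim_u].
  { apply (ex_series_Cmod_le _ (fun n => Cmod (u (S n) - u n))).
    - intros n. apply Rle_refl.
    - apply ex_series_telescoping_le with d; auto using Cmod_ge_0. }
  exists l. split; [exact lim_u|]. intros n.
  apply Cmod_Clim_minus_le with (fun k => u (k + n)%nat).
  - apply is_Clim_seq_incr_n, lim_u.
  - intros k. apply Rle_trans with (d n - d (k + n)%nat); [|generalize (d_nonneg (k + n)%nat); lra].
    induction k as [|k IHk]; cbn [Nat.add].
    + unfold Cminus. rewrite Cplus_opp_r, Cmod_0. lra.
    + replace (u (S (k + n)) - u n)%C with
        ((u (S (k + n)) - u (k + n)%nat) + (u (k + n)%nat - u n))%C by ring.
      eapply Rle_trans; [apply Cmod_triangle|]. generalize (step_le (k + n)%nat). lra.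
Qed.

Lemma Cmod_series_tail_le (a : nat -> C) (b : nat -> R) (l : C) (P : nat) :
  is_series a l -> (forall n, Cmod (a n) <= b n) -> ex_series b ->
  Cmod (l - psum a P) <= Series b - psum b P.
Proof.
  intros sum_a a_le_b ex_b. apply is_series_psum_C in sum_a.
  assert (b_nonneg : forall n, 0 <= b n)
    by (intros n; eapply Rle_trans; [apply Cmod_ge_0 | apply a_le_b]).
  apply Cmod_Clim_minus_le with (fun k => psum a (k + P)); [apply is_Clim_seq_incr_n, sum_a|].
  intros k. apply Rle_trans with (psum b (k + P) - psum b P).
  - induction k as [|k IHk]; cbn [Nat.add].
    + unfold Cminus. rewrite Cplus_opp_r, Cmod_0, Rminus_diag. apply Rle_refl.
    + rewrite psum_S_C, psum_S_R.
      replace (psum a (k + P) + a (k + P)%nat - psum a P)%C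
        with (psum a (k + P) - psum a P + a (k + P)%nat)%C by ring.
      eapply Rle_trans; [apply Cmod_triangle|]. generalize (a_le_b (k + P)%nat). lra.
  - generalize (psum_le_Series b (k + P) b_nonneg ex_b). lra.
Qed.

Lemma Cmod_series_le (a : nat -> C) (b : nat -> R) (l : C) :
  is_series a l -> (forall n, Cmod (a n) <= b n) -> ex_series b -> Cmod l <= Series b.
Proof.
  intros sum_a a_le_b ex_b. assert (tail_le := Cmod_series_tail_le a b l 0 sum_a a_le_b ex_b).
  change (Cmod (l - 0) <= Series b - 0) in tail_le.
  unfold Cminus in tail_le. rewrite Copp_0, Cplus_0_r, Rminus_0_r in tail_le. exact tail_le.
Qed.

(** * Complex-valued functions of a real variable *)

Lemma is_derive_Re_Im (f : R -> C) (t : R) (a : C) :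
  is_derive f t a <->
  is_derive (fun s => Re (f s)) t (Re a) /\ is_derive (fun s => Im (f s)) t (Im a).
Proof.
  split.
  - intros der_f. split.
    + apply (filterdiff_comp' f (fun z : R * R => fst z) t _ (fun z => fst z) der_f).
      apply filterdiff_linear, is_linear_fst.
    + apply (filterdiff_comp' f (fun z : R * R => snd z) t _ (fun z => snd z) der_f).
      apply filterdiff_linear, is_linear_snd.
  - intros [der_re der_im].
    apply (is_derive_ext (fun s => (Re (f s), Im (f s)))).
    { intros s. symmetry. apply surjective_pairing. }
    apply (filterdiff_comp'_2 (fun s => Re (f s)) (fun s => Im (f s)) (fun x y => (x, y))
      t (fun y => scal y (Re a)) (fun y => scal y (Im a)) (fun x y => (x, y)) der_re der_im).
    apply (filterdiff_ext (fun p => p)); [intros []; reflexivity|].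
    apply filterdiff_ext_lin with (fun p => p); [apply filterdiff_id | intros []; reflexivity].
Qed.

Lemma is_derive_Rmult (f g : R -> R) (t a b : R) :
  is_derive f t a -> is_derive g t b ->
  is_derive (fun s => f s * g s) t (a * g t + f t * b).
Proof. intros. apply (is_derive_mult f g); auto. intros; apply Rmult_comm. Qed.

Lemma is_derive_Cmult (f g : R -> C) (t : R) (a b : C) :
  is_derive f t a -> is_derive g t b ->
  is_derive (fun s => f s * g s)%C t (a * g t + f t * b)%C.
Proof.
  rewrite !is_derive_Re_Im. intros [der_re_f der_im_f] [der_re_g der_im_g]. split.
  - evar_last.
    + apply (is_derive_minus (fun s => Re (f s) * Re (g s)) (fun s => Im (f s) * Im (g s)));
        apply is_derive_Rmult; eassumption.
    + rewrite re_plus, !re_mult. unfold minus, plus, opp; simpl. ring.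
  - evar_last.
    + apply (is_derive_plus (fun s => Re (f s) * Im (g s)) (fun s => Im (f s) * Re (g s)));
        apply is_derive_Rmult; eassumption.
    + rewrite im_plus, !im_mult. unfold plus; simpl. ring.
Qed.

Lemma is_derive_Cconst (c : C) (t : R) : is_derive (fun _ : R => c) t (RtoC 0).
Proof. apply @is_derive_const. Qed.

Lemma is_derive_Cplus (f g : R -> C) (t : R) (a b : C) :
  is_derive f t a -> is_derive g t b -> is_derive (fun s => f s + g s)%C t (a + b)%C.
Proof. apply @is_derive_plus. Qed.

Lemma is_derive_Cminus (f g : R -> C) (t : R) (a b : C) :
  is_derive f t a -> is_derive g t b -> is_derive (fun s => f s - g s)%C t (a - b)%C.
Proof. apply @is_derive_minus. Qed.

Lemma is_derive_Cscal (c : C) (f : R -> C) (t : R) (a : C) :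
  is_derive f t a -> is_derive (fun s => c * f s)%C t (c * a)%C.
Proof.
  intros der_f. evar_last; [exact (is_derive_Cmult _ _ _ _ _ (is_derive_Cconst c t) der_f)|].
  simpl. ring.
Qed.

Lemma is_derive_RtoC (f : R -> R) (t a : R) :
  is_derive f t a -> is_derive (fun s => RtoC (f s)) t (RtoC a).
Proof. intros der_f. apply is_derive_Re_Im. split; [exact der_f | exact (is_derive_const 0 t)]. Qed.

Lemma is_derive_Cline (w v : C) (t : R) : is_derive (fun s : R => w + s * v)%C t v.
Proof.
  evar_last.
  - apply is_derive_Cplus; [apply is_derive_Cconst|].
    apply is_derive_Cmult; [|apply is_derive_Cconst].
    apply (is_derive_RtoC (fun s => s)), @is_derive_id.
  - unfold one; simpl. ring.
Qed.

Lemma is_derive_psum (f : nat -> R -> C) (df : nat -> C) (t : R) (n : nat) :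
  (forall i, (i < n)%nat -> is_derive (f i) t (df i)) ->
  is_derive (fun s => psum (fun i => f i s) n : C) t (psum df n).
Proof.
  induction n as [|n IHn]; intros der_f.
  - exact (is_derive_Cconst 0 t).
  - apply (is_derive_Cplus (fun s => psum (fun i => f i s) n) (f n)); auto.
Qed.

(* Projecting [f] on the direction of [f b - f a] reduces to the real mean value theorem. *)
Lemma Cmod_mean_value (f df : R -> C) (a b M : R) : a <= b ->
  (forall t, a <= t <= b -> is_derive f t (df t)) ->
  (forall t, a <= t <= b -> Cmod (df t) <= M) ->
  Cmod (f b - f a) <= M * (b - a).
Proof.
  intros a_le_b der_f df_le.
  set (u := (f b - f a)%C).
  assert (der_projection : forall t, a <= t <= b ->
    is_derive (fun s => Re (Cconj u * f s)) t (Re (Cconj u * df t))).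
  { intros t t_in. assert (der_uf := is_derive_Cscal (Cconj u) f t (df t) (der_f t t_in)).
    apply is_derive_Re_Im in der_uf. apply der_uf. }
  destruct (MVT_gen (fun t => Re (Cconj u * f t)) a b (fun t => Re (Cconj u * df t)))
    as [c [c_in increment]].
  - intros t. rewrite Rmin_left, Rmax_right by lra. intros t_in. apply der_projection. lra.
  - intros t. rewrite Rmin_left, Rmax_right by lra. intros t_in.
    apply continuity_pt_filterlim, (ex_derive_continuous (V := R_NormedModule)).
    exists (Re (Cconj u * df t)). apply der_projection, t_in.
  - rewrite Rmin_left, Rmax_right in c_in by lra.
    assert (increment_sqr : Re (Cconj u * f b) - Re (Cconj u * f a) = Cmod u * Cmod u).
    { rewrite <- re_minus.
      replace (Cconj u * f b - Cconj u * f a)%C with (Cconj u * u)%C by (unfold u; ring).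
      transitivity (Cmod u ^ 2); [rewrite Cmod2_alt, re_mult, re_conj, im_conj|]; ring. }
    assert (projection_le : Re (Cconj u * df c) <= Cmod u * M).
    { eapply Rle_trans; [apply Rle_abs|]. eapply Rle_trans; [apply re_le_Cmod|].
      rewrite Cmod_mult, Cmod_conj. apply Rmult_le_compat_l; auto using Cmod_ge_0. }
    assert (M_nonneg : 0 <= M) by (eapply Rle_trans; [apply Cmod_ge_0 | apply (df_le c c_in)]).
    rewrite increment in increment_sqr.
    apply (Rmult_le_compat_r (b - a)) in projection_le; [|lra].
    destruct (Rle_lt_or_eq_dec 0 _ (Cmod_ge_0 u)) as [u_pos | <-]; [|nra].
    apply Rmult_le_reg_l with (Cmod u); nra.
Qed.

Lemma is_derive_0_const (f : R -> C) (a b : R) : a <= b ->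
  (forall t, a <= t <= b -> is_derive f t (RtoC 0)) -> f b = f a.
Proof.
  intros a_le_b der_f. apply Ceq_minus, Cmod_eq_0, Rle_antisym; [|apply Cmod_ge_0].
  rewrite <- (Rmult_0_l (b - a)).
  apply Cmod_mean_value with (fun _ => RtoC 0); auto.
  intros; rewrite Cmod_0; lra.
Qed.

Lemma is_derive_quadratic_remainder (f : R -> R) (t l d K : R) : 0 < d ->
  (forall h, Rabs h <= d -> Rabs (f (t + h) - f t - h * l) <= K * h ^ 2) -> is_derive f t l.
Proof.
  intros d_pos remainder_le.
  assert (K_nonneg : 0 <= K).
  { specialize (remainder_le d). rewrite (Rabs_pos_eq d) in remainder_le by lra.
    assert (bound_nonneg : 0 <= K * d ^ 2)
      by (eapply Rle_trans; [apply Rabs_pos | apply remainder_le, Rle_refl]).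
    apply Rmult_le_reg_r with (d ^ 2); [apply pow_lt, d_pos | lra]. }
  apply is_derive_Reals. intros eps eps_pos.
  assert (delta_pos : 0 < Rmin d (eps / (K + 1))).
  { apply Rmin_pos; auto. apply Rdiv_lt_0_compat; lra. }
  exists (mkposreal _ delta_pos). simpl. intros h h_neq_0 h_lt.
  assert (h_le_d := Rlt_le_trans _ _ _ h_lt (Rmin_l _ _)).
  assert (h_lt_eps := Rlt_le_trans _ _ _ h_lt (Rmin_r _ _)).
  apply Rlt_div_r in h_lt_eps; [|lra].
  replace ((f (t + h) - f t) / h - l) with ((f (t + h) - f t - h * l) / h) by (field; auto).
  unfold Rdiv. rewrite Rabs_mult, Rabs_inv. apply Rlt_div_l; [apply Rabs_pos_lt; auto|].
  eapply Rle_lt_trans; [apply remainder_le; lra|]. rewrite <- pow2_abs.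
  generalize (Rabs_pos_lt h h_neq_0). nra.
Qed.

Lemma is_derive_Cquadratic_remainder (f : R -> C) (t : R) (l : C) (d K : R) : 0 < d ->
  (forall h, Rabs h <= d -> Cmod (f (t + h) - f t - h * l) <= K * h ^ 2) -> is_derive f t l.
Proof.
  intros d_pos remainder_le. apply is_derive_Re_Im.
  split; apply is_derive_quadratic_remainder with d K; auto; intros h h_le;
    (eapply Rle_trans; [|apply (remainder_le h h_le)]).
  - rewrite <- re_scal_l, <- !re_minus. apply re_le_Cmod.
  - rewrite <- im_scal_l, <- !im_minus. apply im_le_Cmod.
Qed.

(** * Exponential and principal logarithm *)

Lemma exp_le (a b : R) : a <= b -> exp a <= exp b.
Proof. intros [a_lt_b | ->]; [apply Rlt_le, exp_increasing, a_lt_b | apply Rle_refl]. Qed.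

Lemma Cexp_plus (z w : C) : Cexp (z + w) = (Cexp z * Cexp w)%C.
Proof.
  apply C_eq_Re_Im; unfold Cexp; rewrite ?re_mult, ?im_mult, re_plus, im_plus, exp_plus; simpl.
  - rewrite cos_plus. ring.
  - rewrite sin_plus. ring.
Qed.

Lemma Cexp_RtoC (r : R) : Cexp r = RtoC (exp r).
Proof. apply C_eq_Re_Im; unfold Cexp; simpl; rewrite ?cos_0, ?sin_0; ring. Qed.

Lemma Cexp_0 : Cexp 0 = RtoC 1.
Proof. rewrite Cexp_RtoC, exp_0. reflexivity. Qed.

Lemma Cmod_Cexp (z : C) : Cmod (Cexp z) = exp (Re z).
Proof.
  assert (Cmod_sqr := Cmod2_alt (Cexp z)). unfold Cexp in Cmod_sqr at 2 3; simpl Re in Cmod_sqr;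
    simpl Im in Cmod_sqr.
  rewrite !Rpow_mult_distr, <- Rmult_plus_distr_l, <- !Rsqr_pow2, (Rplus_comm (Rsqr (cos _))),
    sin2_cos2, Rmult_1_r in Cmod_sqr.
  apply Rsqr_inj; auto using Cmod_ge_0. apply Rlt_le, exp_pos.
Qed.

Lemma Cexp_neq_0 (z : C) : Cexp z <> RtoC 0.
Proof. apply Cmod_gt_0. rewrite Cmod_Cexp. apply exp_pos. Qed.

Lemma Cexp_opp (z : C) : Cexp (- z) = (/ Cexp z)%C.
Proof.
  assert (mul_inv : (Cexp (- z) * Cexp z)%C = RtoC 1).
  { rewrite <- Cexp_plus. replace (- z + z)%C with (RtoC 0) by ring. apply Cexp_0. }
  assert (exp_nz := Cexp_neq_0 z).
  replace (Cexp (- z)) with (Cexp (- z) * Cexp z / Cexp z)%C by (field; auto).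
  rewrite mul_inv. field; auto.
Qed.

Lemma Cexp_INR_mult (n : nat) (z : C) : Cexp (INR n * z) = (Cexp z ^ n)%C.
Proof.
  induction n as [|n IHn].
  - simpl. rewrite Cmult_0_l. apply Cexp_0.
  - rewrite S_INR, RtoC_plus, Cpow_S, <- IHn, <- Cexp_plus. f_equal. ring.
Qed.

Lemma is_derive_Cexp (f : R -> C) (t : R) (a : C) :
  is_derive f t a -> is_derive (fun s => Cexp (f s)) t (a * Cexp (f t))%C.
Proof.
  rewrite !is_derive_Re_Im. intros [der_re der_im].
  assert (der_exp := is_derive_comp exp (fun s => Re (f s)) t _ _ (is_derive_exp _) der_re).
  assert (der_cos := is_derive_comp cos (fun s => Im (f s)) t _ _ (is_derive_cos _) der_im).
  assert (der_sin := is_derive_comp sin (fun s => Im (f s)) t _ _ (is_derive_sin _) der_im).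
  split; (evar_last; [apply is_derive_Rmult; eassumption|]);
    unfold scal; simpl; unfold mult; simpl; unfold Re, Im; ring.
Qed.

Lemma is_Clim_seq_Cexp (u : nat -> C) (l : C) :
  is_Clim_seq u l -> is_Clim_seq (fun n => Cexp (u n)) (Cexp l).
Proof.
  rewrite !is_Clim_seq_Re_Im. intros [lim_re lim_im].
  assert (lim_exp : is_lim_seq (fun n => exp (Re (u n))) (exp (Re l))).
  { apply is_lim_seq_continuous; [|exact lim_re]. apply derivable_continuous_pt, derivable_pt_exp. }
  split; apply is_lim_seq_mult'; auto; apply is_lim_seq_continuous; auto.
  - apply continuity_cos.
  - apply continuity_sin.
Qed.

Lemma slit_plane_neq_0 (z : C) : slit_plane z -> z <> RtoC 0.
Proof. intros slit_z E. apply slit_z. rewrite E; simpl; split; lra. Qed.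

Lemma slit_plane_Cmod_pos (z : C) : slit_plane z -> 0 < Cmod z.
Proof. intros slit_z. apply Cmod_gt_0, slit_plane_neq_0, slit_z. Qed.

Lemma slit_plane_Cmod_plus_Re_pos (z : C) : slit_plane z -> 0 < Cmod z + Re z.
Proof.
  intros slit_z. assert (Cmod_sqr := Cmod2_alt z). assert (Cmod_nonneg := Cmod_ge_0 z).
  destruct (Req_dec (Im z) 0) as [im_0 | im_nz].
  - assert (0 < Re z) by (apply Rnot_le_lt; intros re_le; apply slit_z; auto). lra.
  - assert (0 < Im z ^ 2) by (apply pow2_gt_0; auto). nra.
Qed.

Lemma slit_plane_RtoC (r : R) : 0 < r -> slit_plane r.
Proof. intros r_pos [_ re_le]. simpl in re_le. lra. Qed.

Lemma slit_plane_scal (r : R) (z : C) : 0 < r -> slit_plane z -> slit_plane (r * z)%C.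
Proof.
  intros r_pos slit_z [im_0 re_le]. apply slit_z.
  rewrite im_scal_l in im_0. rewrite re_scal_l in re_le. split; nra.
Qed.

Lemma slit_plane_plus (z : C) (t : R) : 0 <= t -> slit_plane z -> slit_plane (z + t)%C.
Proof.
  intros t_nonneg slit_z [im_0 re_le]. apply slit_z.
  rewrite im_plus in im_0. rewrite re_plus in re_le. simpl in *. split; lra.
Qed.

Lemma slit_plane_affine (z : C) (s t : R) :
  0 <= s -> 0 <= t -> 0 < s + t -> slit_plane z -> slit_plane (t + s * z)%C.
Proof.
  intros s_nonneg t_nonneg sum_pos slit_z.
  destruct (Rle_lt_or_eq_dec 0 s s_nonneg) as [s_pos | <-].
  - rewrite Cplus_comm. apply slit_plane_plus; auto. apply slit_plane_scal; auto.
  - rewrite Cmult_0_l, Cplus_0_r. apply slit_plane_RtoC. lra.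
Qed.

Lemma slit_plane_Cconj (z : C) : slit_plane z -> slit_plane (Cconj z).
Proof.
  intros slit_z [im_0 re_le]. apply slit_z. rewrite im_conj in im_0. rewrite re_conj in re_le.
  split; lra.
Qed.

Lemma slit_plane_shift_left (z : C) : slit_plane z -> exists d, 0 < d /\ slit_plane (z - d)%C.
Proof.
  intros slit_z. destruct (Rle_lt_dec (Re z) 0) as [re_le | re_pos].
  - exists 1. split; [lra|]. intros [im_0 _]. apply slit_z. rewrite im_minus in im_0.
    simpl in im_0. split; lra.
  - exists (Re z / 2). split; [lra|]. intros [_ re_le']. rewrite re_minus in re_le'.
    simpl in re_le'. lra.
Qed.

Lemma slit_plane_Cexp (w : C) : Rabs (Im w) < PI -> slit_plane (Cexp w).
Proof.
  intros im_lt [im_0 re_le]. apply Rabs_def2 in im_lt. unfold Cexp in *; simpl in *.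
  assert (exp_re_pos := exp_pos (Re w)).
  assert (sin_0' : sin (Im w) = 0) by nra.
  assert (cos_le : cos (Im w) <= 0) by nra.
  destruct (Rtotal_order (Im w) 0) as [im_neg | [im_eq | im_pos]].
  - assert (sin_pos : 0 < sin (- Im w)) by (apply sin_gt_0; lra).
    rewrite sin_neg in sin_pos. lra.
  - rewrite im_eq, cos_0 in cos_le. lra.
  - assert (0 < sin (Im w)) by (apply sin_gt_0; lra). lra.
Qed.

Lemma Clog_Cexp (w : C) : Rabs (Im w) < PI -> Clog (Cexp w) = w.
Proof.
  intros im_lt. apply Rabs_def2 in im_lt. destruct im_lt as [im_lt im_gt].
  apply C_eq_Re_Im; unfold Clog; simpl.
  - rewrite Cmod_Cexp. apply ln_exp.
  - unfold Carg. rewrite Cmod_Cexp. unfold Cexp; simpl.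
    assert (exp_re_pos := exp_pos (Re w)).
    replace (exp (Re w) * cos (Im w) / exp (Re w)) with (cos (Im w)) by (field; lra).
    destruct (Rle_dec 0 (exp (Re w) * sin (Im w))) as [sin_ge | sin_lt];
      destruct (Rle_dec 0 (Im w)) as [im_ge | im_neg].
    + apply acos_cos; lra.
    + assert (sin_pos : 0 < sin (- Im w)) by (apply sin_gt_0; lra).
      rewrite sin_neg in sin_pos. nra.
    + assert (0 <= sin (Im w)) by (apply sin_ge_0; lra). nra.
    + rewrite <- (cos_neg (Im w)), acos_cos; lra.
Qed.

Lemma cos_2_atan (u : R) : cos (2 * atan u) = (1 - u ^ 2) / (1 + u ^ 2).
Proof.
  assert (den_pos : 0 < 1 + u ^ 2) by nra.
  assert (sqrt_sqr := pow2_sqrt _ (Rlt_le _ _ den_pos)).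
  rewrite cos_2a_cos, cos_atan, Rsqr_pow2.
  replace (2 * (1 / sqrt (1 + u ^ 2)) * (1 / sqrt (1 + u ^ 2)) - 1)
    with (2 / sqrt (1 + u ^ 2) ^ 2 - 1)
    by (field; apply Rgt_not_eq, sqrt_lt_R0, den_pos).
  rewrite sqrt_sqr. field. lra.
Qed.

Lemma sin_2_atan (u : R) : sin (2 * atan u) = 2 * u / (1 + u ^ 2).
Proof.
  assert (den_pos : 0 < 1 + u ^ 2) by nra.
  assert (sqrt_sqr := pow2_sqrt _ (Rlt_le _ _ den_pos)).
  rewrite sin_2a, cos_atan, sin_atan, Rsqr_pow2.
  replace (2 * (u / sqrt (1 + u ^ 2)) * (1 / sqrt (1 + u ^ 2)))
    with (2 * u / sqrt (1 + u ^ 2) ^ 2)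
    by (field; apply Rgt_not_eq, sqrt_lt_R0, den_pos).
  rewrite sqrt_sqr. reflexivity.
Qed.

(* Unlike the arc cosine, the half-angle formula is differentiable on the whole slit plane. *)
Definition half_angle_arg (z : C) : R := 2 * atan (Im z / (Cmod z + Re z)).

Lemma half_angle_sec_sqr (z : C) : slit_plane z ->
  1 + (Im z / (Cmod z + Re z)) ^ 2 = 2 * Cmod z / (Cmod z + Re z).
Proof.
  intros slit_z. assert (den_pos := slit_plane_Cmod_plus_Re_pos z slit_z).
  assert (Cmod_sqr := Cmod2_alt z).
  replace (1 + (Im z / (Cmod z + Re z)) ^ 2)
    with (((Cmod z + Re z) ^ 2 + Im z ^ 2) / (Cmod z + Re z) ^ 2) by (field; lra).
  replace (Im z ^ 2) with (Cmod z ^ 2 - Re z ^ 2) by lra. field. lra.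
Qed.

Lemma Cexp_half_angle_arg (z : C) : slit_plane z -> Cexp (ln (Cmod z), half_angle_arg z) = z.
Proof.
  intros slit_z. assert (Cmod_pos := slit_plane_Cmod_pos z slit_z).
  assert (den_pos := slit_plane_Cmod_plus_Re_pos z slit_z).
  assert (sec_sqr := half_angle_sec_sqr z slit_z).
  apply C_eq_Re_Im; unfold Cexp, half_angle_arg; simpl; rewrite exp_ln by auto.
  - rewrite cos_2_atan, sec_sqr.
    replace (1 - (Im z / (Cmod z + Re z)) ^ 2) with (2 - 2 * Cmod z / (Cmod z + Re z)) by lra.
    field; lra.
  - rewrite sin_2_atan, sec_sqr. field; lra.
Qed.

Lemma Rabs_half_angle_arg_lt (z : C) : Rabs (half_angle_arg z) < PI.
Proof.
  unfold half_angle_arg. generalize (atan_bound (Im z / (Cmod z + Re z))). intros.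
  apply Rabs_def1; lra.
Qed.

Lemma Clog_half_angle_arg (z : C) : slit_plane z -> Clog z = (ln (Cmod z), half_angle_arg z).
Proof.
  intros slit_z. rewrite <- (Cexp_half_angle_arg z slit_z) at 1.
  apply Clog_Cexp, Rabs_half_angle_arg_lt.
Qed.

Lemma Cexp_Clog (z : C) : slit_plane z -> Cexp (Clog z) = z.
Proof. intros. rewrite Clog_half_angle_arg; auto using Cexp_half_angle_arg. Qed.

Lemma Im_Clog_lt (z : C) : slit_plane z -> Rabs (Im (Clog z)) < PI.
Proof. intros. rewrite Clog_half_angle_arg; auto. apply Rabs_half_angle_arg_lt. Qed.

Lemma Clog_RtoC (r : R) : 0 < r -> Clog r = RtoC (ln r).
Proof.
  intros r_pos. rewrite <- (exp_ln r r_pos) at 1. rewrite <- Cexp_RtoC, Clog_Cexp; auto.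
  simpl. rewrite Rabs_R0. apply PI_RGT_0.
Qed.

Lemma Clog_scal (r : R) (z : C) : 0 < r -> slit_plane z -> Clog (r * z) = (ln r + Clog z)%C.
Proof.
  intros r_pos slit_z. rewrite <- (Cexp_Clog z slit_z) at 1. rewrite <- (exp_ln r r_pos) at 1.
  rewrite <- Cexp_RtoC, <- Cexp_plus, Clog_Cexp; auto.
  rewrite im_plus. simpl Im at 1. rewrite Rplus_0_l. apply Im_Clog_lt; auto.
Qed.

Lemma Cinv_Cexp_Clog (z : C) : slit_plane z -> (/ z)%C = Cexp (- Clog z).
Proof. intros. rewrite Cexp_opp, Cexp_Clog; auto. Qed.

Lemma slit_plane_inv (z : C) : slit_plane z -> slit_plane (/ z)%C.
Proof.
  intros slit_z. rewrite Cinv_Cexp_Clog by auto. apply slit_plane_Cexp.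
  rewrite im_opp, Rabs_Ropp. apply (Im_Clog_lt z slit_z).
Qed.

Lemma Clog_inv (z : C) : slit_plane z -> Clog (/ z) = (- Clog z)%C.
Proof.
  intros slit_z. rewrite Cinv_Cexp_Clog by auto. apply Clog_Cexp.
  rewrite im_opp, Rabs_Ropp. apply (Im_Clog_lt z slit_z).
Qed.

Lemma Clog_plus_Clog_Cconj (z : C) : slit_plane z ->
  (Clog z + Clog (Cconj z))%C = RtoC (2 * ln (Cmod z)).
Proof.
  intros slit_z. rewrite !Clog_half_angle_arg by auto using slit_plane_Cconj.
  unfold half_angle_arg. rewrite Cmod_conj, re_conj, im_conj.
  apply C_eq_Re_Im; simpl; [ring|].
  rewrite Rdiv_opp_l, atan_opp. ring.
Qed.

Lemma slit_plane_locally (f : R -> C) (t : R) (a : C) :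
  is_derive f t a -> slit_plane (f t) -> locally t (fun s => slit_plane (f s)).
Proof.
  intros der_f slit_ft. apply is_derive_Re_Im in der_f. destruct der_f as [der_re der_im].
  assert (locally_pos : forall (g : R -> R) l, is_derive g t l -> 0 < g t ->
    locally t (fun s => 0 < g s)).
  { intros g l der_g g_pos. apply (ex_derive_continuous g t (ex_intro _ l der_g) (fun y => 0 < y)).
    apply open_gt, g_pos. }
  destruct (Rle_lt_dec (Re (f t)) 0) as [re_le | re_pos].
  - assert (im_nz : Im (f t) <> 0) by (intros E; apply slit_ft; auto).
    assert (im_sqr_pos : locally t (fun s => 0 < Im (f s) * Im (f s))).
    { eapply locally_pos; [apply is_derive_Rmult; eassumption | nra]. }
    revert im_sqr_pos. apply filter_imp. intros s im_sqr_pos [E _]. rewrite E in im_sqr_pos. lra.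
  - generalize (locally_pos _ _ der_re re_pos). apply filter_imp. intros s re_pos' [_ re_le]. lra.
Qed.

Lemma is_derive_Cmod (f : R -> C) (t : R) (a : C) : f t <> RtoC 0 -> is_derive f t a ->
  is_derive (fun s => Cmod (f s)) t ((Re (f t) * Re a + Im (f t) * Im a) / Cmod (f t)).
Proof.
  intros ft_nz der_f. apply is_derive_Re_Im in der_f. destruct der_f as [der_re der_im].
  assert (Cmod_pos := proj1 (Cmod_gt_0 _) ft_nz).
  assert (Cmod_sqrt : forall z, Cmod z = sqrt (Re z * Re z + Im z * Im z)).
  { intros z. unfold Cmod, Re, Im. f_equal. ring. }
  apply is_derive_ext with (fun s => sqrt (Re (f s) * Re (f s) + Im (f s) * Im (f s))).
  { intros s. symmetry. apply Cmod_sqrt. }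
  evar_last.
  - apply is_derive_sqrt.
    + apply (is_derive_plus (fun s => Re (f s) * Re (f s)) (fun s => Im (f s) * Im (f s)));
        apply is_derive_Rmult; eassumption.
    + generalize (Cmod2_alt (f t)). nra.
  - cbv beta. rewrite <- Cmod_sqrt. unfold plus; simpl. field. lra.
Qed.

Lemma Cdiv_Re_Im (a z : C) : z <> RtoC 0 ->
  (a / z)%C = ((Re a * Re z + Im a * Im z) / Cmod z ^ 2, (Im a * Re z - Re a * Im z) / Cmod z ^ 2).
Proof.
  intros z_nz. assert (Cmod_pos := proj1 (Cmod_gt_0 _) z_nz).
  assert (Cmod_sqr := Cmod2_alt z). rewrite Cmod_sqr.
  apply C_eq_Re_Im; unfold Cdiv, Cinv, Re, Im in *; simpl in *; field; nra.
Qed.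

Lemma is_derive_half_angle_arg (f : R -> C) (t : R) (a : C) :
  slit_plane (f t) -> is_derive f t a ->
  is_derive (fun s => half_angle_arg (f s)) t (Im (a / f t)%C).
Proof.
  intros slit_ft der_f. assert (ft_nz := slit_plane_neq_0 _ slit_ft).
  assert (Cmod_pos := slit_plane_Cmod_pos _ slit_ft).
  assert (den_pos := slit_plane_Cmod_plus_Re_pos _ slit_ft).
  assert (sec_sqr := half_angle_sec_sqr _ slit_ft). assert (Cmod_sqr := Cmod2_alt (f t)).
  assert (der_Cmod := is_derive_Cmod f t a ft_nz der_f).
  apply is_derive_Re_Im in der_f. destruct der_f as [der_re der_im].
  assert (der_den := is_derive_plus _ _ _ _ _ der_Cmod der_re).
  assert (der_tan := is_derive_div _ _ _ _ _ der_im der_den (Rgt_not_eq _ _ den_pos)).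
  assert (der_arg := is_derive_comp atan _ t _ _ (is_derive_atan _) der_tan).
  evar_last; [exact (is_derive_scal _ _ 2 _ der_arg)|].
  rewrite Cdiv_Re_Im by auto. unfold scal, plus; simpl; unfold mult; simpl.
  rewrite Rsqr_pow2, sec_sqr. revert Cmod_sqr den_pos Cmod_pos. clear.
  generalize (Cmod (f t)) (Re (f t)) (Im (f t)) (Re a) (Im a).
  intros r x y dx dy r_sqr den_pos r_pos.
  transitivity ((r * (dy * (r + x) - y * dx) - x * y * dx - y ^ 2 * dy) / (r ^ 2 * (r + x))).
  - field. lra.
  - replace (y ^ 2) with (r ^ 2 - x ^ 2) by lra. field. lra.
Qed.

Lemma is_derive_Clog (f : R -> C) (t : R) (a : C) :
  slit_plane (f t) -> is_derive f t a -> is_derive (fun s => Clog (f s)) t (a / f t)%C.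
Proof.
  intros slit_ft der_f. assert (ft_nz := slit_plane_neq_0 _ slit_ft).
  assert (Cmod_pos := slit_plane_Cmod_pos _ slit_ft).
  apply (is_derive_ext_loc (fun s => (ln (Cmod (f s)), half_angle_arg (f s)))).
  { generalize (slit_plane_locally f t a der_f slit_ft). apply filter_imp.
    intros s slit_fs. symmetry. apply Clog_half_angle_arg, slit_fs. }
  apply is_derive_Re_Im. split; [|exact (is_derive_half_angle_arg f t a slit_ft der_f)].
  evar_last.
  - apply (is_derive_comp ln (fun s => Cmod (f s)) t); [apply is_derive_ln, Cmod_pos|].
    apply is_derive_Cmod; eassumption.
  - rewrite Cdiv_Re_Im by auto. unfold scal; simpl; unfold mult; simpl. field. lra.
Qed.

Lemma is_derive_Clog_line (w v : C) (t : R) : slit_plane (w + t * v)%C ->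
  is_derive (fun s : R => Clog (w + s * v)) t (v / (w + t * v))%C.
Proof. intros. apply (is_derive_Clog (fun s : R => w + s * v)%C); auto using is_derive_Cline. Qed.

Lemma Clog_first_order (w v : C) (m : R) : 0 < m ->
  (forall t, 0 <= t <= 1 -> slit_plane (w + t * v)%C /\ m <= Cmod (w + t * v)) ->
  Cmod (Clog (w + v) - Clog w - v / w) <= Cmod v ^ 2 / (m * Cmod w).
Proof.
  intros m_pos segment.
  assert (w_nz : w <> RtoC 0).
  { replace w with (w + 0 * v)%C by ring. apply slit_plane_neq_0, segment. lra. }
  assert (Cmod_w_pos := proj1 (Cmod_gt_0 _) w_nz).
  set (f := fun t : R => (Clog (w + t * v) - (0 + t * (v / w)))%C).
  replace (Clog (w + v) - Clog w - v / w)%C with (f 1 - f 0)%C.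
  2:{ unfold f. rewrite Cmult_1_l, !Cmult_0_l, Cplus_0_r. ring. }
  eapply Rle_trans; [apply (Cmod_mean_value f (fun t => v / (w + t * v) - v / w)%C 0 1
    (Cmod v ^ 2 / (m * Cmod w)))|]; try lra; intros t t_in;
    destruct (segment t t_in) as [slit_t m_le].
  - apply is_derive_Cminus; [apply is_derive_Clog_line, slit_t | apply is_derive_Cline].
  - assert (wt_nz := slit_plane_neq_0 _ slit_t).
    replace (v / (w + t * v) - v / w)%C with (- (t * v ^ 2) / ((w + t * v) * w))%C
      by (simpl; field; auto).
    rewrite Cmod_div, Cmod_opp, !Cmod_mult, Cmod_R, Rabs_pos_eq, Cmod_pow
      by (auto using Cmult_neq_0; lra).
    apply Rmult_le_compat.
    + nra.
    + apply Rlt_le, Rinv_0_lt_compat. nra.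
    + nra.
    + apply Rinv_le_contravar; nra.
Qed.

(** * Linear growth along rays in the slit plane *)

Definition cone_bound (c : R) (z : C) : Prop :=
  0 < c <= 1 /\ forall s t, 0 <= s -> 0 <= t -> c * (s * Cmod z + t) <= Cmod (s * z + t).

(* [|s z + t|^2 = (1 + cos arg z)/2 (s|z| + t)^2 + (1 - cos arg z)/2 (s|z| - t)^2]. *)
Lemma cone_bound_cos (z : C) : slit_plane z -> cone_bound ((1 + Re z / Cmod z) / 2) z.
Proof.
  intros slit_z.
  assert (sum_pos := slit_plane_Cmod_plus_Re_pos _ slit_z). assert (r_sqr := Cmod2_alt z).
  assert (re_le := Rle_trans _ _ _ (Rle_abs _) (re_le_Cmod z)).
  set (r := Cmod z) in *. set (q := Re z / r).
  assert (re_eq : Re z = q * r) by (unfold q; field; lra).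
  assert (q_gt : -1 < q) by (apply Rmult_lt_reg_r with r; lra).
  assert (q_le : q <= 1) by (apply Rmult_le_reg_r with r; lra).
  set (c := (1 + q) / 2). assert (c_in : 0 < c <= 1) by (unfold c; lra).
  split; [exact c_in|]. intros s t s_nonneg t_nonneg. fold r.
  assert (dist_sqr : Cmod (s * z + t) ^ 2 = c * (s * r + t) ^ 2 + (1 - c) * (s * r - t) ^ 2).
  { rewrite Cmod2_alt, re_plus, im_plus, re_scal_l, im_scal_l, re_eq. simpl Re. simpl Im.
    replace ((s * Im z + 0) ^ 2) with (s ^ 2 * (r ^ 2 - (q * r) ^ 2))
      by (rewrite r_sqr, <- re_eq; ring).
    unfold c. field. }
  apply Rsqr_incr_0_var; [|apply Cmod_ge_0]. rewrite !Rsqr_pow2, dist_sqr, Rpow_mult_distr.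
  assert (c_sqr_le : c ^ 2 <= c) by nra.
  apply (Rmult_le_compat_r _ _ _ (pow2_ge_0 (s * r + t))) in c_sqr_le.
  assert (square_term_nonneg : 0 <= (1 - c) * (s * r - t) ^ 2)
    by (apply Rmult_le_pos; [lra | apply pow2_ge_0]).
  lra.
Qed.

Lemma slit_plane_cone_bound (z : C) : slit_plane z -> exists c, cone_bound c z.
Proof. intros slit_z. eexists. apply cone_bound_cos, slit_z. Qed.

Lemma cone_bound_scal (c r : R) (z : C) : 0 < r -> cone_bound c z -> cone_bound c (r * z)%C.
Proof.
  intros r_pos [c_in growth]. split; auto. intros s t s_nonneg t_nonneg.
  rewrite Cmod_mult, Cmod_R, Rabs_pos_eq by lra.
  replace (s * (r * z) + t)%C with ((s * r)%R * z + t)%C by (rewrite RtoC_mult; ring).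
  rewrite <- Rmult_assoc. apply growth; nra.
Qed.

Lemma cone_bound_le (c c' : R) (z : C) : 0 < c <= c' -> cone_bound c' z -> cone_bound c z.
Proof.
  intros c_le [c'_in growth]. split; [lra|]. intros s t s_nonneg t_nonneg.
  eapply Rle_trans; [|apply growth; auto]. apply Rmult_le_compat_r; [|lra].
  generalize (Cmod_ge_0 z). nra.
Qed.

Lemma cone_bound_shift (c : R) (z : C) (t : R) :
  cone_bound c z -> 0 <= t -> c * (Cmod z + t) <= Cmod (z + t).
Proof.
  intros [_ growth] t_nonneg. generalize (growth 1 t Rle_0_1 t_nonneg).
  rewrite Rmult_1_l, Cmult_1_l. auto.
Qed.

Lemma cone_bound_Cexp (alpha : R) (w : C) : Rabs (Im w) <= alpha -> alpha < PI ->
  cone_bound ((1 + cos alpha) / 2) (Cexp w).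
Proof.
  intros im_le alpha_lt. assert (im_nonneg := Rabs_pos (Im w)).
  apply cone_bound_le with ((1 + Re (Cexp w) / Cmod (Cexp w)) / 2).
  2:{ apply cone_bound_cos, slit_plane_Cexp. lra. }
  replace (Re (Cexp w) / Cmod (Cexp w)) with (cos (Rabs (Im w))).
  - assert (cos_le : cos alpha <= cos (Rabs (Im w))) by (apply cos_decr_1; lra).
    assert (cos_gt : cos PI < cos alpha) by (apply cos_decreasing_1; lra).
    rewrite cos_PI in cos_gt. lra.
  - rewrite Cmod_Cexp. unfold Cexp; simpl.
    replace (cos (Rabs (Im w))) with (cos (Im w))
      by (unfold Rabs; destruct (Rcase_abs (Im w)); rewrite ?cos_neg; auto).
    field. apply Rgt_not_eq, exp_pos.
Qed.

(** * The digamma function *)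

Lemma INR_S_pos (n : nat) : 0 < INR (S n).
Proof. apply lt_0_INR, Nat.lt_0_succ. Qed.

Lemma INR_S_ge_1 (n : nat) : 1 <= INR (S n).
Proof. rewrite S_INR. generalize (pos_INR n). lra. Qed.

Lemma INR_S_neq_0_C (n : nat) : RtoC (INR (S n)) <> RtoC 0.
Proof. apply RtoC_neq_0, not_0_INR. discriminate. Qed.

Lemma is_lim_seq_inv_INR_S : is_lim_seq (fun n => / INR (S n)) 0.
Proof.
  apply (is_lim_seq_incr_1 (fun n => / INR n)).
  apply (is_lim_seq_inv INR p_infty); [apply is_lim_seq_INR | discriminate].
Qed.

Lemma ln_le_sub_1 (u : R) : 0 < u -> ln u <= u - 1.
Proof.
  intros u_pos. generalize (exp_ineq1_le (ln u)). rewrite exp_ln by auto. lra.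
Qed.

Lemma ln_INR_S_nonneg (n : nat) : 0 <= ln (INR (S n)).
Proof. rewrite <- ln_1. apply ln_le; [lra | apply INR_S_ge_1]. Qed.

Lemma ln_INR_S_increment (n : nat) :
  / INR (S (S n)) <= ln (INR (S (S n))) - ln (INR (S n)) <= / INR (S n).
Proof.
  assert (a_pos := INR_S_pos n). assert (b_pos := INR_S_pos (S n)). assert (b_eq := S_INR (S n)).
  set (a := INR (S n)) in *. set (b := INR (S (S n))) in *. split.
  - assert (bound := ln_le_sub_1 (a / b) ltac:(apply Rdiv_lt_0_compat; auto)).
    rewrite ln_div in bound by auto.
    replace (a / b) with (1 - / b) in bound by (rewrite b_eq; field; lra). lra.
  - assert (bound := ln_le_sub_1 (b / a) ltac:(apply Rdiv_lt_0_compat; auto)).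
    rewrite ln_div in bound by auto.
    replace (b / a - 1) with (/ a) in bound by (rewrite b_eq; field; lra). lra.
Qed.

Lemma inv_shift_increment (r : R) (n : nat) : 0 < r ->
  / (r + INR n) - / (r + INR (S n)) = / ((r + INR n) * (r + INR (S n))).
Proof. intros r_pos. generalize (pos_INR n). intros. rewrite S_INR. field. lra. Qed.

Lemma psum_inv_sqr_le (r : R) (n : nat) : 0 < r ->
  psum (fun i => / (r + INR i) ^ 2) n <= (1 + / r) * / r.
Proof.
  intros r_pos. assert (inv_r_pos := Rinv_0_lt_compat r r_pos).
  apply Rle_trans with ((1 + / r) * (/ r - / (r + INR n))).
  - induction n as [|n IHn].
    + rewrite Rplus_0_r, Rminus_diag, Rmult_0_r. apply Rle_refl.
    + rewrite psum_S_R. assert (n_nonneg := pos_INR n).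
      assert (step : / (r + INR n) ^ 2 <= (1 + / r) * (/ (r + INR n) - / (r + INR (S n)))).
      { rewrite inv_shift_increment, S_INR by auto.
        replace ((1 + / r) * / ((r + INR n) * (r + (INR n + 1))))
          with (/ (r * (r + INR n) * (r + (INR n + 1)) / (r + 1))) by (field; lra).
        apply Rinv_le_contravar.
        - apply Rdiv_lt_0_compat; [repeat apply Rmult_lt_0_compat|]; lra.
        - apply Rle_div_l; nra. }
      lra.
  - apply Rmult_le_compat_l; [lra|].
    assert (0 < / (r + INR n)) by (apply Rinv_0_lt_compat; generalize (pos_INR n); lra). lra.
Qed.

Lemma Clog_increment (c : R) (y : C) (n : nat) : slit_plane y -> cone_bound c y ->
  Cmod (Clog (y + INR (S n)) - Clog (y + INR n) - / (y + INR (S n))) <=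
  / c ^ 2 * (/ (Cmod y + INR n) - / (Cmod y + INR (S n))).
Proof.
  intros slit_y cone_y. assert (y_pos := slit_plane_Cmod_pos y slit_y).
  assert (n_nonneg := pos_INR n). assert (c_in := proj1 cone_y).
  set (w := (y + INR (S n))%C).
  assert (w_ge : c * (Cmod y + INR (S n)) <= Cmod w)
    by (apply cone_bound_shift; auto using pos_INR).
  assert (segment : forall t : R, (w + t * - RtoC 1)%C = (y + (INR n + (1 - t))%R)%C).
  { intros t. unfold w. rewrite S_INR, !RtoC_plus, RtoC_minus. ring. }
  assert (first_order := Clog_first_order w (- RtoC 1)%C (c * (Cmod y + INR n)) ltac:(nra)).
  rewrite Cmod_opp, Cmod_1, pow1 in first_order.
  replace (Clog w - Clog (y + INR n) - / w)%C
    with (- (Clog (w + - RtoC 1) - Clog w - - RtoC 1 / w))%C.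
  2:{ replace (w + - RtoC 1)%C with (y + INR n)%C by (unfold w; rewrite S_INR, RtoC_plus; ring).
      unfold Cdiv. ring. }
  rewrite Cmod_opp. eapply Rle_trans; [apply first_order|].
  - intros t t_in. rewrite segment. split; [apply slit_plane_plus; auto; lra|].
    eapply Rle_trans; [|apply (cone_bound_shift c); auto; lra].
    apply Rmult_le_compat_l; lra.
  - rewrite inv_shift_increment by auto. rewrite S_INR in *. unfold Rdiv.
    rewrite Rmult_1_l, <- Rinv_mult. apply Rinv_le_contravar.
    + apply Rmult_lt_0_compat; [apply pow_lt; lra | apply Rmult_lt_0_compat; lra].
    + replace (c ^ 2 * ((Cmod y + INR n) * (Cmod y + (INR n + 1))))
        with ((c * (Cmod y + INR n)) * (c * (Cmod y + (INR n + 1)))) by ring.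
      apply Rmult_le_compat_l; [nra | exact w_ge].
Qed.

Definition shifted_harmonic (y : C) (n : nat) : C := psum (fun i => / (y + INR (S i)))%C n.

Lemma shifted_harmonic_S (y : C) (n : nat) :
  shifted_harmonic y (S n) = (shifted_harmonic y n + / (y + INR (S n)))%C.
Proof. reflexivity. Qed.

(* [psi (y + 1)], see [Cdigamma_digamma_succ]. *)
Definition digamma_succ (y : C) : C :=
  CLim_seq (fun n => Clog (y + INR n) - shifted_harmonic y n)%C.

Lemma digamma_succ_lim_remainder (c : R) (y : C) : slit_plane y -> cone_bound c y ->
  is_Clim_seq (fun n => Clog (y + INR n) - shifted_harmonic y n)%C (digamma_succ y) /\
  forall n, Cmod (digamma_succ y - (Clog (y + INR n) - shifted_harmonic y n)) <=
    / c ^ 2 * / (Cmod y + INR n).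
Proof.
  intros slit_y cone_y. assert (y_pos := slit_plane_Cmod_pos y slit_y).
  assert (inv_c_pos : 0 < / c ^ 2) by (apply Rinv_0_lt_compat, pow_lt, cone_y).
  destruct (ex_Clim_of_telescoping_bound (fun n => Clog (y + INR n) - shifted_harmonic y n)%C
    (fun n => / c ^ 2 * / (Cmod y + INR n))) as [l [lim_l remainder]].
  - intros n. apply Rmult_le_pos; [lra|].
    apply Rlt_le, Rinv_0_lt_compat. generalize (pos_INR n). lra.
  - intros n. rewrite <- Rmult_minus_distr_l.
    eapply Rle_trans; [|apply Clog_increment; auto]. right.
    rewrite shifted_harmonic_S. f_equal. ring.
  - unfold digamma_succ. rewrite (CLim_seq_unique _ _ lim_l). auto.
Qed.

Lemma Clog_shift_first_order (c a : R) (z : C) : slit_plane z -> cone_bound c z -> 0 < a ->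
  Cmod (Clog (z + a) - ln a - z / a) <= Cmod z ^ 2 / c * / a ^ 2.
Proof.
  intros slit_z cone_z a_pos. assert (c_in := proj1 cone_z).
  rewrite <- Clog_RtoC, (Cplus_comm z) by auto.
  eapply Rle_trans; [apply (Clog_first_order a z (c * a)); [nra|]|].
  - intros t t_in. split; [apply slit_plane_affine; auto; lra|].
    rewrite Cplus_comm. eapply Rle_trans; [|apply (proj2 cone_z); lra].
    apply Rmult_le_compat_l; [lra|]. generalize (Cmod_ge_0 z). nra.
  - rewrite Cmod_R, Rabs_pos_eq by lra. right. field. lra.
Qed.

Lemma Clog_minus_ln_lim (z : C) : slit_plane z ->
  is_Clim_seq (fun n => Clog (z + INR (S n)) - ln (INR (S n)))%C (RtoC 0).
Proof.
  intros slit_z. destruct (slit_plane_cone_bound z slit_z) as [c cone_z].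
  apply is_Clim_seq_bound with (fun n => (Cmod z ^ 2 / c + Cmod z) * / INR (S n)).
  2:{ apply is_lim_seq_scal_0, is_lim_seq_inv_INR_S. }
  intros n. assert (n_ge := INR_S_ge_1 n).
  assert (first_order := Clog_shift_first_order c (INR (S n)) z slit_z cone_z ltac:(lra)).
  set (a := INR (S n)) in *.
  replace (Clog (z + a) - ln a - 0)%C with ((Clog (z + a) - ln a - z / a) + z / a)%C by ring.
  eapply Rle_trans; [apply Cmod_triangle|].
  rewrite Cmod_div, Cmod_R, Rabs_pos_eq by (try apply RtoC_neq_0; lra).
  assert (inv_sqr_le : / a ^ 2 <= / a) by (apply Rinv_le_contravar; nra).
  apply (Rmult_le_compat_l (Cmod z ^ 2 / c)) in inv_sqr_le.
  - unfold Rdiv in *. lra.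
  - apply Rmult_le_pos; [apply pow2_ge_0|]. apply Rlt_le, Rinv_0_lt_compat, cone_z.
Qed.

Lemma digamma_succ_lim (y : C) : slit_plane y ->
  is_Clim_seq (fun n => ln (INR (S n)) - shifted_harmonic y (S n))%C (digamma_succ y).
Proof.
  intros slit_y. destruct (slit_plane_cone_bound y slit_y) as [c cone_y].
  replace (digamma_succ y) with (digamma_succ y - 0)%C by ring.
  apply filterlim_ext with (fun n => (Clog (y + INR (S n)) - shifted_harmonic y (S n)) -
    (Clog (y + INR (S n)) - ln (INR (S n))))%C; [intros n; ring|].
  apply is_Clim_seq_minus; [|apply Clog_minus_ln_lim, slit_y].
  apply (is_Clim_seq_incr_1 (fun n => Clog (y + INR n) - shifted_harmonic y n)%C).
  apply (digamma_succ_lim_remainder c y slit_y cone_y).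
Qed.

(* The logarithm of the [n]-th term of the product defining [CGamma]. *)
Definition ln_gauss_product (z : C) (n : nat) : C :=
  (z * ln (INR n) + ln (INR (fact n)) - psum (fun i => Clog (z + INR i)) (S n))%C.

Lemma ln_gauss_product_S (z : C) (n : nat) :
  ln_gauss_product z (S (S n)) =
  (ln_gauss_product z (S n) + z * (ln (INR (S (S n))) - ln (INR (S n)))
    + ln (INR (S (S n))) - Clog (z + INR (S (S n))))%C.
Proof.
  unfold ln_gauss_product. change (fact (S (S n))) with (S (S n) * fact (S n))%nat.
  rewrite mult_INR, ln_mult, RtoC_plus by auto using INR_S_pos, lt_0_INR, lt_O_fact.
  rewrite (psum_S_C _ (S (S n))). ring.
Qed.

Lemma Crising_Cexp (z : C) (n : nat) : slit_plane z ->
  Crising z n = Cexp (psum (fun i => Clog (z + INR i)) (S n)).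
Proof.
  intros slit_z. induction n as [|n IHn].
  - rewrite psum_S_C. change (psum _ 0) with (RtoC 0).
    rewrite Cplus_0_l, Cplus_0_r, Cexp_Clog; auto.
  - rewrite psum_S_C, Cexp_plus, <- IHn, Cexp_Clog; [reflexivity|].
    apply slit_plane_plus; auto using pos_INR.
Qed.

Lemma Cexp_ln_gauss_product (z : C) (n : nat) : slit_plane z ->
  Cexp (ln_gauss_product z (S n)) =
  (Cpower (INR (S n)) z * INR (fact (S n)) / Crising z (S n))%C.
Proof.
  intros slit_z. unfold ln_gauss_product, Cminus.
  rewrite !Cexp_plus, Cexp_opp, <- Crising_Cexp, Cexp_RtoC by auto.
  rewrite exp_ln by apply lt_0_INR, lt_O_fact.
  unfold Cpower. rewrite Clog_RtoC by apply INR_S_pos. reflexivity.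
Qed.

Lemma ln_gauss_product_increment_le (c : R) (z : C) (n : nat) : slit_plane z -> cone_bound c z ->
  Cmod (ln_gauss_product z (S (S n)) - ln_gauss_product z (S n)) <=
  (Cmod z + Cmod z ^ 2 / c) * (/ INR (S n) - / INR (S (S n))).
Proof.
  intros slit_z cone_z. assert (c_in := proj1 cone_z).
  rewrite ln_gauss_product_S.
  assert (ln_step := ln_INR_S_increment n).
  assert (b_pos := INR_S_pos n). assert (a_eq := S_INR (S n)).
  assert (log_step := Clog_shift_first_order c _ z slit_z cone_z (INR_S_pos (S n))).
  set (a := INR (S (S n))) in *. set (b := INR (S n)) in *.
  replace (ln_gauss_product z (S n) + z * (ln a - ln b) + ln a - Clog (z + a)
      - ln_gauss_product z (S n))%C
    with (z * (ln a - ln b - / a)%R - (Clog (z + a) - ln a - z / a))%C.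
  2:{ rewrite !RtoC_minus, RtoC_inv by lra. unfold Cdiv. ring. }
  eapply Rle_trans; [apply Cmod_triangle|].
  rewrite Cmod_opp, Cmod_mult, Cmod_R, Rabs_pos_eq, Rmult_plus_distr_r by lra.
  apply Rplus_le_compat.
  - apply Rmult_le_compat_l; [apply Cmod_ge_0 | lra].
  - eapply Rle_trans; [exact log_step|]. apply Rmult_le_compat_l.
    + apply Rmult_le_pos; [apply pow2_ge_0 | apply Rlt_le, Rinv_0_lt_compat; lra].
    + replace (/ b - / a) with (/ (b * a)) by (rewrite a_eq; field; lra).
      apply Rinv_le_contravar; nra.
Qed.

Definition ln_Gamma (z : C) : C := CLim_seq (fun n => ln_gauss_product z (S n)).

Lemma ln_Gamma_lim (z : C) : slit_plane z ->
  is_Clim_seq (fun n => ln_gauss_product z (S n)) (ln_Gamma z).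
Proof.
  intros slit_z. destruct (slit_plane_cone_bound z slit_z) as [c cone_z].
  assert (c_in := proj1 cone_z).
  set (K := Cmod z + Cmod z ^ 2 / c).
  assert (K_nonneg : 0 <= K).
  { apply Rplus_le_le_0_compat; [apply Cmod_ge_0|].
    apply Rmult_le_pos; [apply pow2_ge_0 | apply Rlt_le, Rinv_0_lt_compat; lra]. }
  destruct (ex_Clim_of_telescoping_bound (fun n => ln_gauss_product z (S n))
    (fun n => K * / INR (S n))) as [l [lim_l _]].
  - intros n. apply Rmult_le_pos; auto. apply Rlt_le, Rinv_0_lt_compat, INR_S_pos.
  - intros n. rewrite <- Rmult_minus_distr_l. apply ln_gauss_product_increment_le; auto.
  - unfold ln_Gamma. rewrite (CLim_seq_unique _ _ lim_l). exact lim_l.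
Qed.

Lemma CGamma_Cexp (z : C) : slit_plane z -> CGamma z = Cexp (ln_Gamma z).
Proof.
  intros slit_z. apply CLim_seq_unique, is_Clim_seq_incr_1.
  apply filterlim_ext with (fun n => Cexp (ln_gauss_product z (S n))).
  - intros n. apply Cexp_ln_gauss_product, slit_z.
  - apply is_Clim_seq_Cexp, ln_Gamma_lim, slit_z.
Qed.

Lemma ln_gauss_product_first_order (z h : C) (n : nat) :
  (ln_gauss_product (z + h) n - ln_gauss_product z n
    - h * (ln (INR n) - shifted_harmonic z n - / z))%C =
  (- psum (fun i => Clog (z + INR i + h) - Clog (z + INR i) - h / (z + INR i)) (S n))%C.
Proof.
  assert (harmonic_shift : (shifted_harmonic z n + / z)%C =
    psum (fun i => / (z + INR i))%C (S n)).
  { induction n as [|n IHn].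
    - rewrite psum_S_C, Cplus_0_r. reflexivity.
    - rewrite psum_S_C, <- IHn, shifted_harmonic_S. ring. }
  unfold ln_gauss_product, Cdiv. rewrite !psum_Cminus, (psum_Cscal h), <- harmonic_shift.
  rewrite (psum_Cext (fun i => Clog (z + INR i + h)) (fun i => Clog (z + h + INR i)))
    by (intros; f_equal; ring).
  ring.
Qed.

Lemma Clog_first_order_shifted (c d a h : R) (z : C) :
  slit_plane (z - d)%C -> cone_bound c (z - d)%C -> 0 <= a -> Rabs h <= d ->
  Cmod (Clog (z + a + h) - Clog (z + a) - h / (z + a)) <=
  / c ^ 2 * / (Cmod (z - d) + a) ^ 2 * h ^ 2.
Proof.
  intros slit_z0 cone_z0 a_nonneg h_le. assert (c_in := proj1 cone_z0).
  assert (z0_pos := slit_plane_Cmod_pos _ slit_z0). set (z0 := (z - d)%C) in *.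
  apply Rabs_le_between in h_le.
  assert (m_pos : 0 < c * (Cmod z0 + a)) by nra.
  assert (shift : forall t : R, - d <= t <= d ->
    slit_plane (z + a + t)%C /\ c * (Cmod z0 + a) <= Cmod (z + a + t)).
  { intros t t_in. replace (z + a + t)%C with (z0 + (a + (d + t))%R)%C
      by (unfold z0; rewrite !RtoC_plus; ring).
    split; [apply slit_plane_plus; auto; lra|].
    eapply Rle_trans; [|apply (cone_bound_shift c); auto; lra].
    apply Rmult_le_compat_l; lra. }
  destruct (shift 0 ltac:(lra)) as [_ w_ge]. rewrite Cplus_0_r in w_ge.
  eapply Rle_trans; [apply (Clog_first_order (z + a) h (c * (Cmod z0 + a))); auto|].
  - intros t t_in. rewrite <- RtoC_mult. apply shift. nra.
  - rewrite Cmod_R, pow2_abs, (Rmult_comm _ (h ^ 2)).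
    apply Rmult_le_compat_l; [apply pow2_ge_0|].
    rewrite <- Rinv_mult, <- Rpow_mult_distr. apply Rinv_le_contravar; [apply pow_lt, m_pos|].
    rewrite <- Rsqr_pow2. apply Rmult_le_compat_l; lra.
Qed.

Lemma ln_Gamma_first_order (z : C) : slit_plane z ->
  exists d K, 0 < d /\ slit_plane (z - d)%C /\ forall h, Rabs h <= d ->
    Cmod (ln_Gamma (z + h) - ln_Gamma z - h * (digamma_succ z - / z)) <= K * h ^ 2.
Proof.
  intros slit_z. destruct (slit_plane_shift_left z slit_z) as [d [d_pos slit_z0]].
  destruct (slit_plane_cone_bound _ slit_z0) as [c cone_z0].
  assert (r_pos := slit_plane_Cmod_pos _ slit_z0). set (r := Cmod (z - d)) in *.
  exists d, (/ c ^ 2 * ((1 + / r) * / r)). repeat split; auto. intros h h_le.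
  assert (slit_zh : slit_plane (z + h)%C).
  { replace (z + h)%C with (z - d + (d + h)%R)%C by (rewrite RtoC_plus; ring).
    apply slit_plane_plus; auto. apply Rabs_le_between in h_le. lra. }
  replace (ln_Gamma (z + h) - ln_Gamma z - h * (digamma_succ z - / z))%C
    with (ln_Gamma (z + h) - ln_Gamma z - h * (digamma_succ z - / z) - 0)%C by ring.
  apply Cmod_Clim_minus_le with (fun n => ln_gauss_product (z + h) (S n) - ln_gauss_product z (S n)
    - h * (ln (INR (S n)) - shifted_harmonic z (S n) - / z))%C.
  - apply is_Clim_seq_minus.
    + apply is_Clim_seq_minus; apply ln_Gamma_lim; auto.
    + apply is_Clim_seq_scal, is_Clim_seq_minus; [apply digamma_succ_lim, slit_z|].
      apply filterlim_const.
  - intros n. rewrite ln_gauss_product_first_order.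
    unfold Cminus at 1. rewrite Copp_0, Cplus_0_r, Cmod_opp.
    eapply Rle_trans; [apply Cmod_psum_le with
      (b := fun i => (/ c ^ 2 * h ^ 2) * / (r + INR i) ^ 2)|].
    + intros i _. eapply Rle_trans; [apply (Clog_first_order_shifted c d); auto using pos_INR|].
      right. fold r. ring.
    + rewrite psum_Rscal.
      replace (/ c ^ 2 * ((1 + / r) * / r) * h ^ 2)
        with (/ c ^ 2 * h ^ 2 * ((1 + / r) * / r)) by ring.
      apply Rmult_le_compat_l; [|apply psum_inv_sqr_le, r_pos].
      apply Rmult_le_pos; [|apply pow2_ge_0].
      apply Rlt_le, Rinv_0_lt_compat, pow_lt, cone_z0.
Qed.

Lemma is_lim_difference_quotient (f : R -> R) (t l : R) :
  is_derive f t l -> is_lim (fun s => (f s - f t) / (s - t)) t l.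
Proof.
  intros der_f. apply is_derive_Reals in der_f. apply is_lim_spec. intros eps.
  destruct (der_f eps (cond_pos eps)) as [delta near]. exists delta. intros s s_near s_neq.
  replace s with (t + (s - t)) at 1 by ring. apply near; [lra | exact s_near].
Qed.

(* [C_derive] only sees the horizontal line through [z]. *)
Lemma C_derive_horizontal (f : C -> C) (z l : C) :
  is_derive (fun s : R => f (s, Im z)) (Re z) l -> C_derive f z = l.
Proof.
  destruct z as [x y]. cbn [Re Im fst snd]. rewrite is_derive_Re_Im. intros [der_re der_im].
  assert (quotient : forall s, s <> x ->
    ((f (s, y) - f (x, y)) / ((s, y) - (x, y)))%C = ((/ (s - x))%R * (f (s, y) - f (x, y)))%C).
  { intros s s_neq. replace ((s, y) - (x, y))%C with (RtoC (s - x)).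
    - unfold Cdiv. rewrite RtoC_inv by lra. apply Cmult_comm.
    - apply C_eq_Re_Im; rewrite ?re_minus, ?im_minus; simpl; ring. }
  apply C_eq_Re_Im.
  - apply (f_equal real (y := Finite (Re l))), is_lim_unique.
    apply is_lim_ext_loc with (2 := is_lim_difference_quotient _ _ _ der_re).
    exists posreal_one. intros s _ s_neq.
    transitivity (Re ((f (s, y) - f (x, y)) / ((s, y) - (x, y)))%C); [|reflexivity].
    rewrite quotient, re_scal_l, re_minus by exact s_neq. apply Rmult_comm.
  - apply (f_equal real (y := Finite (Im l))), is_lim_unique.
    apply is_lim_ext_loc with (2 := is_lim_difference_quotient _ _ _ der_im).
    exists posreal_one. intros s _ s_neq.
    transitivity (Im ((f (s, y) - f (x, y)) / ((s, y) - (x, y)))%C); [|reflexivity].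
    rewrite quotient, im_scal_l, im_minus by exact s_neq. apply Rmult_comm.
Qed.

Lemma Cdigamma_digamma_succ (z : C) : slit_plane z -> Cdigamma z = (digamma_succ z - / z)%C.
Proof.
  intros slit_z. destruct (ln_Gamma_first_order z slit_z) as [d [K [d_pos [slit_z0 remainder]]]].
  assert (Gamma_nz : CGamma z <> RtoC 0) by (rewrite CGamma_Cexp by auto; apply Cexp_neq_0).
  destruct z as [x y]. set (l := (digamma_succ (x, y) - / (x, y))%C) in *.
  assert (der_ln_Gamma : is_derive (fun s : R => ln_Gamma (s, y)) x l).
  { apply is_derive_Cquadratic_remainder with d K; auto. intros h h_le.
    replace (x + h, y) with ((x, y) + h)%C by (apply C_eq_Re_Im; simpl; ring).
    apply remainder, h_le. }
  assert (slit_near : forall s : R, Rabs (s - x) < d -> slit_plane (s, y)).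
  { intros s s_near. apply Rabs_def2 in s_near.
    replace (s, y) with ((x, y) - d + (d + (s - x))%R)%C by (apply C_eq_Re_Im; simpl; ring).
    apply slit_plane_plus; auto. lra. }
  unfold Cdigamma. rewrite (C_derive_horizontal CGamma (x, y) (l * CGamma (x, y))%C).
  - field. exact Gamma_nz.
  - rewrite (CGamma_Cexp (x, y)) by auto.
    apply (is_derive_ext_loc (fun s : R => Cexp (ln_Gamma (s, y)))).
    + exists (mkposreal d d_pos). intros s s_near. symmetry. apply CGamma_Cexp, slit_near, s_near.
    + apply is_derive_Cexp, der_ln_Gamma.
Qed.

(** * The zeta function and Herglotz series *)

Lemma Rpower_pos (a s : R) : 0 < Rpower a s.
Proof. apply exp_pos. Qed.

Lemma Rpower_INR_S (n N : nat) : Rpower (INR (S n)) (INR N) = INR (S n) ^ N.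
Proof. apply Rpower_pow, INR_S_pos. Qed.

Lemma Cpower_RtoC (a s : R) : 0 < a -> Cpower a s = RtoC (Rpower a s).
Proof.
  intros a_pos. unfold Cpower, Rpower. rewrite Clog_RtoC, <- RtoC_mult by auto. apply Cexp_RtoC.
Qed.

Lemma Rpower_S_le_increment (s : R) (n : nat) : 1 < s ->
  Rpower (INR (S (S n))) (- s) <=
  / (s - 1) * Rpower (INR (S n)) (1 - s) - / (s - 1) * Rpower (INR (S (S n))) (1 - s).
Proof.
  intros s_gt_1.
  assert (ln_step := proj1 (ln_INR_S_increment n)). assert (b_pos := INR_S_pos (S n)).
  set (a := INR (S n)) in *. set (b := INR (S (S n))) in *.
  assert (b_power_pos := Rpower_pos b (1 - s)).
  replace (Rpower b (- s)) with (Rpower b (1 - s) * / b).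
  2:{ replace (- s) with (1 - s + - (1)) by ring.
      rewrite Rpower_plus, (Rpower_Ropp b 1), Rpower_1; auto. }
  replace (Rpower a (1 - s)) with (Rpower b (1 - s) * exp ((s - 1) * (ln b - ln a))).
  2:{ unfold Rpower. rewrite <- exp_plus. f_equal. ring. }
  apply Rmult_le_reg_l with (s - 1); [lra|].
  rewrite <- Rmult_minus_distr_l, <- (Rmult_assoc (s - 1) (/ (s - 1))), Rinv_r, Rmult_1_l by lra.
  assert (exp_ge : (s - 1) * / b <= exp ((s - 1) * (ln b - ln a)) - 1).
  { apply Rle_trans with ((s - 1) * (ln b - ln a)); [apply Rmult_le_compat_l; lra|].
    generalize (exp_ineq1_le ((s - 1) * (ln b - ln a))). lra. }
  apply (Rmult_le_compat_l (Rpower b (1 - s))) in exp_ge; lra.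
Qed.

Lemma ex_series_Rpower (s : R) : 1 < s -> ex_series (fun n => Rpower (INR (S n)) (- s)).
Proof.
  intros s_gt_1. apply ex_series_incr_1.
  apply ex_series_telescoping_le with (fun n => / (s - 1) * Rpower (INR (S n)) (1 - s)).
  - intros n. apply Rmult_le_pos; apply Rlt_le; [apply Rinv_0_lt_compat; lra | apply Rpower_pos].
  - intros n. split; [apply Rlt_le, Rpower_pos | apply Rpower_S_le_increment, s_gt_1].
Qed.

Lemma is_series_Czeta (s : R) : 1 < s ->
  is_series (fun n => RtoC (Rpower (INR (S n)) (- s))) (Czeta s).
Proof.
  intros s_gt_1. destruct (ex_series_Rpower s s_gt_1) as [l sum_l].
  apply is_series_RtoC in sum_l. replace (Czeta s) with (RtoC l); [exact sum_l|].
  symmetry. apply CSeries_unique. eapply is_series_Cext; [|exact sum_l].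
  intros n. cbv beta. rewrite <- RtoC_opp, Cpower_RtoC by apply INR_S_pos. reflexivity.
Qed.

Lemma exp_second_order (u : R) : Rabs (exp u - 1 - u) <= u ^ 2 * exp (Rabs u).
Proof.
  assert (exp_ge := exp_ineq1_le u). assert (exp_opp_ge := exp_ineq1_le (- u)).
  assert (exp_mul_opp : exp u * exp (- u) = 1) by (rewrite <- exp_plus, Rplus_opp_r; apply exp_0).
  assert (exp_sub_1_le : exp u - 1 <= u * exp u) by nra.
  rewrite Rabs_pos_eq by lra. destruct (Rle_dec 0 u) as [u_nonneg | u_neg].
  - rewrite Rabs_pos_eq by auto. nra.
  - rewrite Rabs_left by lra. assert (1 <= exp (- u)) by lra.
    apply Rle_trans with (u ^ 2); nra.
Qed.

Lemma ln_le_Rpower (a e : R) : 0 < e -> ln a <= / e * Rpower a e.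
Proof.
  intros e_pos. assert (bound := ln_le_sub_1 (Rpower a e) (Rpower_pos a e)).
  unfold Rpower at 1 in bound. rewrite ln_exp in bound.
  apply Rmult_le_reg_l with e; [exact e_pos|].
  rewrite <- Rmult_assoc, Rinv_r, Rmult_1_l; lra.
Qed.

Lemma Rpower_second_order (a s e h : R) : 1 <= a -> 0 < e -> Rabs h <= e ->
  Rabs (Rpower a (- (s + h)) - Rpower a (- s) + h * (ln a * Rpower a (- s))) <=
  h ^ 2 * (/ e ^ 2 * Rpower a (- (s - 3 * e))).
Proof.
  intros a_ge_1 e_pos h_le.
  assert (ln_nonneg : 0 <= ln a) by (rewrite <- ln_1; apply ln_le; lra).
  assert (ln_le := ln_le_Rpower a e e_pos).
  set (L := ln a) in *.
  replace (Rpower a (- (s + h)) - Rpower a (- s) + h * (L * Rpower a (- s)))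
    with (Rpower a (- s) * (exp (- h * L) - 1 - - h * L)).
  2:{ replace (Rpower a (- (s + h))) with (Rpower a (- s) * exp (- h * L)); [ring|].
      unfold Rpower. fold L. rewrite <- exp_plus. f_equal. ring. }
  replace (Rpower a (- (s - 3 * e)))
    with (Rpower a (- s) * (Rpower a e * Rpower a e * Rpower a e))
    by (rewrite <- !Rpower_plus; f_equal; ring).
  rewrite Rabs_mult, (Rabs_pos_eq (Rpower a (- s))) by apply Rlt_le, Rpower_pos.
  assert (exp_le_power : exp (Rabs (- h * L)) <= Rpower a e).
  { unfold Rpower. fold L. rewrite Rabs_mult, Rabs_Ropp, (Rabs_pos_eq L) by auto.
    apply exp_le, Rmult_le_compat_r; auto. }
  assert (sqr_le : (- h * L) ^ 2 <= h ^ 2 * (/ e * Rpower a e) ^ 2).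
  { rewrite Rpow_mult_distr, <- Rsqr_pow2, <- Rsqr_neg, Rsqr_pow2.
    apply Rmult_le_compat_l; [apply pow2_ge_0|]. apply pow_incr; auto. }
  apply Rle_trans with (Rpower a (- s) * (h ^ 2 * (/ e * Rpower a e) ^ 2 * Rpower a e)).
  - apply Rmult_le_compat_l; [apply Rlt_le, Rpower_pos|].
    eapply Rle_trans; [apply exp_second_order|].
    apply Rmult_le_compat; auto using pow2_ge_0. apply Rlt_le, exp_pos.
  - right. field. lra.
Qed.

Lemma ex_series_ln_Rpower (s : R) : 1 < s ->
  ex_series (fun n => ln (INR (S n)) * Rpower (INR (S n)) (- s)).
Proof.
  intros s_gt_1. set (e := (s - 1) / 2). assert (e_pos : 0 < e) by (unfold e; lra).
  apply (ex_series_le (V := R_CompleteNormedModule) _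
    (fun n => / e * Rpower (INR (S n)) (- (s - e)))).
  - intros n. change (Rabs (ln (INR (S n)) * Rpower (INR (S n)) (- s)) <=
      / e * Rpower (INR (S n)) (- (s - e))).
    assert (power_pos := Rpower_pos (INR (S n)) (- s)).
    rewrite Rabs_pos_eq by (apply Rmult_le_pos; [apply ln_INR_S_nonneg | lra]).
    replace (Rpower (INR (S n)) (- (s - e)))
      with (Rpower (INR (S n)) e * Rpower (INR (S n)) (- s))
      by (rewrite <- Rpower_plus; f_equal; ring).
    rewrite <- Rmult_assoc. apply Rmult_le_compat_r; [lra | apply ln_le_Rpower, e_pos].
  - apply ex_series_Rscal, ex_series_Rpower. unfold e. lra.
Qed.

Lemma is_series_C_derive_Czeta (s : R) : 1 < s ->
  is_series (fun n => RtoC (ln (INR (S n)) * Rpower (INR (S n)) (- s))) (- C_derive Czeta s)%C.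
Proof.
  intros s_gt_1. destruct (ex_series_ln_Rpower s s_gt_1) as [l sum_l].
  apply is_series_RtoC in sum_l.
  replace (- C_derive Czeta s)%C with (RtoC l); [exact sum_l|].
  rewrite (C_derive_horizontal Czeta s (- l)%C); [ring|].
  set (e := (s - 1) / 4). assert (e_pos : 0 < e) by (unfold e; lra).
  set (b := fun n => Rpower (INR (S n)) (- (s - 3 * e))).
  assert (ex_b : ex_series b) by (apply ex_series_Rpower; unfold e; lra).
  apply is_derive_Cquadratic_remainder with e (/ e ^ 2 * Series b); auto.
  intros h h_le. change (Cmod (Czeta (RtoC (s + h)) - Czeta (RtoC s) - h * - l) <=
    / e ^ 2 * Series b * h ^ 2).
  assert (sh_gt_1 : 1 < s + h) by (apply Rabs_le_between in h_le; unfold e in h_le; lra).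
  replace (/ e ^ 2 * Series b * h ^ 2) with (Series (fun n => h ^ 2 * / e ^ 2 * b n))
    by (rewrite Series_scal_l; ring).
  apply Cmod_series_le with (fun n => RtoC (Rpower (INR (S n)) (- (s + h)) -
    Rpower (INR (S n)) (- s) + h * (ln (INR (S n)) * Rpower (INR (S n)) (- s)))).
  - replace (h * - l)%C with (- h * l)%C by ring.
    eapply is_series_Cext; [|exact (is_series_Cminus _ _ _ _
      (is_series_Cminus _ _ _ _ (is_series_Czeta _ sh_gt_1) (is_series_Czeta _ s_gt_1))
      (is_series_Cscal (- h)%C _ _ sum_l))].
    intros n. cbv beta. rewrite !RtoC_plus, !RtoC_minus, !RtoC_mult. ring.
  - intros n. rewrite Cmod_R, Rmult_assoc. apply Rpower_second_order; auto using INR_S_ge_1.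
  - apply ex_series_Rscal, ex_b.
Qed.

(* [psi (y + 1) - log y] *)
Definition digamma_gap (y : C) : C := (digamma_succ y - Clog y)%C.

Lemma Cmod_digamma_gap_le (c : R) (y : C) : slit_plane y -> cone_bound c y ->
  Cmod (digamma_gap y) <= / c ^ 2 * / Cmod y.
Proof.
  intros slit_y cone_y.
  assert (remainder := proj2 (digamma_succ_lim_remainder c y slit_y cone_y) O).
  change (shifted_harmonic y 0) with (RtoC 0) in remainder.
  rewrite Cplus_0_r, Rplus_0_r in remainder.
  unfold digamma_gap. replace (Clog y) with (Clog y - 0)%C by ring. exact remainder.
Qed.

Lemma Cmod_Herglotz_term_le (c k a u : R) (x : C) : slit_plane x -> cone_bound c x ->
  Cmod (digamma_gap (Rpower u a * x) / Rpower u k) <=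
  / c ^ 2 * / Cmod x * Rpower u (- (k + a)).
Proof.
  intros slit_x cone_x. assert (x_pos := slit_plane_Cmod_pos x slit_x).
  assert (a_pos := Rpower_pos u a). assert (k_pos := Rpower_pos u k).
  rewrite Cmod_div, Cmod_R, (Rabs_pos_eq (Rpower u k)) by (try apply RtoC_neq_0; lra).
  apply Rle_div_l; [exact k_pos|].
  eapply Rle_trans; [apply (Cmod_digamma_gap_le c)|].
  - apply slit_plane_scal; auto.
  - apply cone_bound_scal; auto.
  - rewrite Cmod_mult, Cmod_R, Rabs_pos_eq by lra.
    rewrite Ropp_plus_distr, Rpower_plus, !Rpower_Ropp. right.
    assert (c_in := proj1 cone_x). field. repeat split; lra.
Qed.

Lemma is_series_Herglotz (k a : R) (x : C) : slit_plane x -> 1 < k + a ->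
  is_series (fun n => digamma_gap (Rpower (INR (S n)) a * x) / Rpower (INR (S n)) k)%C
    (Herglotz k a x + Czeta (k + a)%R / x)%C.
Proof.
  intros slit_x exponent_gt_1. destruct (slit_plane_cone_bound x slit_x) as [c cone_x].
  set (term := fun n => (digamma_gap (Rpower (INR (S n)) a * x) / Rpower (INR (S n)) k)%C).
  destruct (ex_series_Cmod_le term
    (fun n => / c ^ 2 * / Cmod x * Rpower (INR (S n)) (- (k + a)))) as [l sum_l].
  - intros n. exact (Cmod_Herglotz_term_le c k a (INR (S n)) x slit_x cone_x).
  - apply ex_series_Rscal, ex_series_Rpower, exponent_gt_1.
  - replace (Herglotz k a x + Czeta (k + a)%R / x)%C with l; [exact sum_l|].
    cut (Herglotz k a x = (l - / x * Czeta (k + a)%R)%C); [intros ->; unfold Cdiv; ring|].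
    apply CSeries_unique. eapply is_series_Cext; [|exact (is_series_Cminus _ _ _ _ sum_l
      (is_series_Cscal (/ x)%C _ _ (is_series_Czeta _ exponent_gt_1)))].
    intros n. cbv beta zeta. unfold term, digamma_gap.
    assert (a_pos := Rpower_pos (INR (S n)) a). assert (k_pos := Rpower_pos (INR (S n)) k).
    rewrite Cdigamma_digamma_succ by (apply slit_plane_scal; auto).
    rewrite Ropp_plus_distr, Rpower_plus, !Rpower_Ropp, RtoC_mult, !RtoC_inv by lra.
    field. repeat split; try (apply RtoC_neq_0; lra). apply slit_plane_neq_0, slit_x.
Qed.

Lemma is_series_Herglotz_nat (k N : nat) (x : C) : (1 < k + N)%nat -> slit_plane x ->
  is_series (fun n => digamma_gap (INR (S n) ^ N * x) / INR (S n) ^ k)%C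
    (Herglotz (INR k) (INR N) x + Czeta (INR k + INR N)%R / x)%C.
Proof.
  intros exponent_gt_1 slit_x. apply lt_INR in exponent_gt_1. rewrite plus_INR in exponent_gt_1.
  eapply is_series_Cext; [|apply is_series_Herglotz; [exact slit_x | exact exponent_gt_1]].
  intros n. cbv beta. rewrite !Rpower_INR_S, !RtoC_pow. reflexivity.
Qed.

(** * Roots of unity and partial fractions *)

Definition cis (a : R) : C := (cos a, sin a).

Lemma cis_Cexp (a : R) : cis a = Cexp (Ci * a).
Proof.
  unfold cis, Cexp. replace (Re (Ci * a)) with 0 by (simpl; ring).
  replace (Im (Ci * a)) with a by (simpl; ring). rewrite exp_0, !Rmult_1_l. reflexivity.
Qed.

Lemma cis_plus (a b : R) : cis (a + b) = (cis a * cis b)%C.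
Proof. rewrite !cis_Cexp, <- Cexp_plus, RtoC_plus. f_equal. ring. Qed.

Lemma cis_0 : cis 0 = RtoC 1.
Proof. unfold cis. rewrite cos_0, sin_0. reflexivity. Qed.

Lemma cis_neq_0 (a : R) : cis a <> RtoC 0.
Proof. rewrite cis_Cexp. apply Cexp_neq_0. Qed.

Lemma cis_opp (a : R) : cis (- a) = (/ cis a)%C.
Proof. rewrite !cis_Cexp, <- Cexp_opp, RtoC_opp. f_equal. ring. Qed.

Lemma cis_INR_mult (n : nat) (a : R) : cis (INR n * a) = (cis a ^ n)%C.
Proof. rewrite !cis_Cexp, <- Cexp_INR_mult, RtoC_mult. f_equal. ring. Qed.

Lemma cis_PI : cis PI = (- RtoC 1)%C.
Proof. unfold cis. rewrite cos_PI, sin_PI. apply C_eq_Re_Im; simpl; ring. Qed.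

Lemma cis_INR_mult_PI (n : nat) : cis (INR n * PI) = ((-1) ^ n)%C.
Proof. rewrite cis_INR_mult, cis_PI, <- RtoC_opp. reflexivity. Qed.

Lemma cis_2_PI_INR (n : nat) : cis (2 * (INR n * PI)) = RtoC 1.
Proof.
  replace (2 * (INR n * PI)) with (INR n * (PI + PI)) by ring.
  rewrite cis_INR_mult, cis_plus, cis_PI.
  replace (- (1) * - (1))%C with (RtoC 1) by ring. apply Cpow_1_l.
Qed.

Lemma Cpow_opp_1_neq_0 (n : nat) : ((-1) ^ n)%C <> RtoC 0.
Proof. apply Cpow_nz, RtoC_neq_0. lra. Qed.

Lemma Cpow_opp_1_sqr (n : nat) : ((-1) ^ n * (-1) ^ n)%C = RtoC 1.
Proof. rewrite <- Cpow_mult_l. replace (-1 * -1)%C with (RtoC 1) by ring. apply Cpow_1_l. Qed.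

Lemma Cinv_Cpow_opp_1 (n : nat) : (/ (-1) ^ n)%C = ((-1) ^ n)%C.
Proof.
  rewrite <- (Cmult_1_l (/ _)), <- (Cpow_opp_1_sqr n). field. apply Cpow_opp_1_neq_0.
Qed.

Lemma Cpow_opp (z : C) (n : nat) : ((- z) ^ n)%C = ((-1) ^ n * z ^ n)%C.
Proof. rewrite <- Cpow_mult_l. f_equal. ring. Qed.

Lemma cis_double_sub_1 (a : R) : (cis (2 * a) - 1)%C = (2 * Ci * sin a * cis a)%C.
Proof.
  apply C_eq_Re_Im; unfold cis; rewrite ?re_minus, ?im_minus; simpl.
  - rewrite cos_2a_sin. ring.
  - rewrite sin_2a. ring.
Qed.

Lemma psum_geometric (r : C) (n : nat) :
  ((r - 1) * psum (fun l => r ^ l)%C n)%C = (r ^ n - 1)%C.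
Proof.
  induction n as [|n IHn]; [change (psum _ 0) with (RtoC 0); simpl; ring|].
  rewrite psum_S_C, Cmult_plus_distr_l, IHn, Cpow_S. ring.
Qed.

Lemma psum_arith_geometric (r : C) (n : nat) :
  ((r - 1) * psum (fun l => INR l * r ^ l)%C n)%C =
  (INR n * r ^ n - r * psum (fun l => r ^ l)%C n)%C.
Proof.
  induction n as [|n IHn]; [change (psum _ 0) with (RtoC 0); simpl; ring|].
  rewrite !psum_S_C, Cmult_plus_distr_l, IHn, Cpow_S, S_INR, RtoC_plus. ring.
Qed.

Lemma psum_pow_mult_pow (t w : C) (n : nat) :
  ((t - w) * psum (fun i => t ^ (n - 1 - i) * w ^ i)%C n)%C = (t ^ n - w ^ n)%C.
Proof.
  induction n as [|n IHn]; [change (psum _ 0) with (RtoC 0); simpl; ring|].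
  rewrite psum_S_C, (psum_Cext _ (fun i => t * (t ^ (n - 1 - i) * w ^ i))%C).
  - rewrite psum_Cscal. replace (S n - 1 - n)%nat with 0%nat by lia. rewrite !Cpow_S.
    replace ((t - w) * (t * psum (fun i => t ^ (n - 1 - i) * w ^ i)%C n + t ^ 0 * w ^ n))%C
      with (t * ((t - w) * psum (fun i => t ^ (n - 1 - i) * w ^ i)%C n) + (t - w) * w ^ n)%C
      by (simpl; ring).
    rewrite IHn. ring.
  - intros i i_lt. replace (S n - 1 - i)%nat with (S (n - 1 - i)) by lia. rewrite Cpow_S. ring.
Qed.

Lemma psum_delta (n k : nat) (v : C) : (k < n)%nat ->
  psum (fun i => if Nat.eq_dec i k then v else RtoC 0) n = v :> C.
Proof.
  induction n as [|n IHn]; intros k_lt; [lia|]. rewrite psum_S_C.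
  destruct (Nat.eq_dec n k) as [n_eq | n_neq].
  - rewrite (psum_Cext _ (fun _ => RtoC 0)).
    + rewrite psum_Cconst. ring.
    + intros i i_lt. destruct (Nat.eq_dec i k); [lia | reflexivity].
  - rewrite IHn by lia. apply Cplus_0_r.
Qed.

(* The index [j = 2 l - (N - 1)] of the sum [sum_step2]. *)
Definition sym_index (N l : nat) : R := 2 * INR l - (INR N - 1).

Lemma IZR_sym_index (N l : nat) : IZR (2 * Z.of_nat l - (Z.of_nat N - 1)) = sym_index N l.
Proof. unfold sym_index. rewrite !minus_IZR, mult_IZR, <- !INR_IZR_INZ. reflexivity. Qed.

Lemma sum_step2_psum (N : nat) (f : Z -> C) : (1 <= N)%nat ->
  sum_step2 N f = psum (fun l => f (2 * Z.of_nat l - (Z.of_nat N - 1))%Z) N.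
Proof. intros N_ge_1. unfold sum_step2. rewrite <- psum_sum_n. f_equal. lia. Qed.

Lemma Rabs_sym_index_le (N l : nat) : (l < N)%nat -> Rabs (sym_index N l) <= INR N - 1.
Proof.
  intros l_lt. apply le_INR in l_lt. rewrite S_INR in l_lt. unfold sym_index.
  apply Rabs_le. generalize (pos_INR l). lra.
Qed.

Lemma psum_sym_index (N : nat) : psum (fun l => RtoC (sym_index N l)) N = RtoC 0 :> C.
Proof.
  assert (partial : forall M, psum (fun l => RtoC (sym_index N l)) M =
    (INR M * (INR M - INR N))%C :> C).
  { induction M as [|M IHM]; [symmetry; apply Cmult_0_l|].
    rewrite psum_S_C, IHM. unfold sym_index.
    rewrite S_INR, !RtoC_minus, RtoC_mult, RtoC_plus. ring. }
  rewrite partial. ring.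
Qed.

Lemma cis_sym_index_mult (N l : nat) (a : R) :
  cis (sym_index N l * a) = (cis (- (INR N - 1) * a) * cis (2 * a) ^ l)%C.
Proof. unfold sym_index. rewrite <- cis_INR_mult, <- cis_plus. f_equal. ring. Qed.

Section SymmetricSums.

Variables (N : nat) (a : R).
Hypothesis sin_neq_0 : sin a <> 0.
Hypothesis cis_pow_N : (cis (2 * a) ^ N)%C = RtoC 1.

Lemma psum_cis_pow_eq_0 : psum (fun l => cis (2 * a) ^ l)%C N = RtoC 0 :> C.
Proof.
  assert (ratio_nz : (cis (2 * a) - 1)%C <> RtoC 0).
  { rewrite cis_double_sub_1. repeat apply Cmult_neq_0; auto using cis_neq_0, Ci_nz, RtoC_neq_0. }
  assert (geometric := psum_geometric (cis (2 * a)) N). rewrite cis_pow_N in geometric.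
  replace (psum (fun l => cis (2 * a) ^ l)%C N : C)
    with ((cis (2 * a) - 1) * psum (fun l => cis (2 * a) ^ l)%C N / (cis (2 * a) - 1))%C
    by (field; exact ratio_nz).
  rewrite geometric. field. exact ratio_nz.
Qed.

Lemma psum_cis_sym_index_eq_0 : psum (fun l => cis (sym_index N l * a)) N = RtoC 0 :> C.
Proof.
  rewrite (psum_Cext _ (fun l => cis (- (INR N - 1) * a) * cis (2 * a) ^ l)%C)
    by (intros; apply cis_sym_index_mult).
  rewrite (psum_Cscal _ (fun l => cis (2 * a) ^ l)%C), psum_cis_pow_eq_0. ring.
Qed.

Lemma psum_sym_index_mult_cis :
  psum (fun l => sym_index N l * cis (sym_index N l * a))%C N =
  (INR N / (Ci * sin a * cis (INR N * a)))%C :> C.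
Proof.
  assert (sinC_nz := RtoC_neq_0 _ sin_neq_0). assert (cis_nz := cis_neq_0 a).
  assert (cis_N_nz := cis_neq_0 (INR N * a)).
  assert (arith_geometric := psum_arith_geometric (cis (2 * a)) N).
  rewrite psum_cis_pow_eq_0, cis_pow_N, cis_double_sub_1 in arith_geometric.
  assert (weighted : psum (fun l => INR l * cis (2 * a) ^ l)%C N =
    (INR N / (2 * Ci * sin a * cis a))%C :> C).
  { replace (psum (fun l => INR l * cis (2 * a) ^ l)%C N : C) with
      (2 * Ci * sin a * cis a * psum (fun l => INR l * cis (2 * a) ^ l)%C N
        / (2 * Ci * sin a * cis a))%C by (field; auto using Ci_nz).
    rewrite arith_geometric. f_equal. ring. }
  rewrite (psum_Cext _ (fun l => cis (- (INR N - 1) * a) *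
    (2 * (INR l * cis (2 * a) ^ l) - (INR N - 1) * cis (2 * a) ^ l))%C).
  2:{ intros l _. rewrite cis_sym_index_mult. unfold sym_index.
      rewrite !RtoC_minus, RtoC_mult. ring. }
  rewrite psum_Cscal, psum_Cminus, (psum_Cscal _ (fun l => INR l * cis (2 * a) ^ l)%C),
    (psum_Cscal _ (fun l => cis (2 * a) ^ l)%C), psum_cis_pow_eq_0, weighted.
  replace (- (INR N - 1) * a) with (- (INR N * a) + a) by ring.
  rewrite cis_plus, cis_opp. field. auto using Ci_nz.
Qed.

End SymmetricSums.

Lemma sin_PI_frac_neq_0 (N p : nat) : (0 < p < N)%nat -> sin (PI * INR p / INR N) <> 0.
Proof.
  intros [p_pos p_lt]. apply lt_INR in p_lt. apply lt_0_INR in p_pos. assert (PI_pos := PI_RGT_0).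
  apply Rgt_not_eq, sin_gt_0; [apply Rdiv_lt_0_compat; nra | apply Rlt_div_l; nra].
Qed.

Lemma cis_PI_frac_pow (N p : nat) : (0 < N)%nat ->
  (cis (2 * (PI * INR p / INR N)) ^ N)%C = RtoC 1.
Proof.
  intros N_pos. rewrite <- cis_INR_mult, <- (cis_2_PI_INR p). f_equal. field.
  apply not_0_INR. lia.
Qed.

Lemma psum_cis_sym_index (N i j : nat) : (i < N)%nat -> (j < N)%nat ->
  psum (fun l => cis (sym_index N l * (PI * (INR i - INR j) / INR N))) N =
  (if Nat.eq_dec j i then RtoC (INR N) else RtoC 0) :> C.
Proof.
  intros i_lt j_lt. destruct (Nat.eq_dec j i) as [-> | j_neq].
  - rewrite (psum_Cext _ (fun _ => RtoC 1)), psum_Cconst; [ring|].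
    intros l _. rewrite <- cis_0. f_equal. unfold Rdiv. ring.
  - destruct (proj1 (Nat.lt_gt_cases j i) j_neq) as [lt | lt].
    + rewrite <- minus_INR by lia.
      apply psum_cis_sym_index_eq_0; [apply sin_PI_frac_neq_0 | apply cis_PI_frac_pow]; lia.
    + replace (PI * (INR i - INR j) / INR N) with (- (PI * INR (j - i) / INR N))
        by (rewrite minus_INR by lia; unfold Rdiv; ring).
      apply psum_cis_sym_index_eq_0.
      * rewrite sin_neg. apply Ropp_neq_0_compat, sin_PI_frac_neq_0. lia.
      * rewrite Ropp_mult_distr_r_reverse, cis_opp, Cpow_inv, cis_PI_frac_pow
          by (apply cis_neq_0 || lia).
        field.
Qed.

Lemma Cinv_minus_psum (t w : C) (n : nat) : (t ^ n - w ^ n)%C <> RtoC 0 ->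
  (/ (t - w))%C = (/ (t ^ n - w ^ n) * psum (fun i => t ^ (n - 1 - i) * w ^ i)%C n)%C.
Proof.
  intros pow_nz. assert (factor := psum_pow_mult_pow t w n).
  assert (diff_nz : (t - w)%C <> RtoC 0).
  { intros E. apply pow_nz. rewrite <- factor, E. ring. }
  rewrite <- factor in *. field. split; [|exact diff_nz].
  intros E. apply pow_nz. rewrite E. ring.
Qed.

Lemma opp_mult_cis_sym_index_pow (N l : nat) (z : C) : (0 < N)%nat ->
  ((- (z * cis (- (sym_index N l * (PI / INR N))))) ^ N)%C = (- z ^ N)%C.
Proof.
  intros N_pos. assert (N_nz : INR N <> 0) by (apply not_0_INR; lia).
  rewrite Cpow_opp, Cpow_mult_l, <- cis_INR_mult.
  replace (INR N * - (sym_index N l * (PI / INR N)))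
    with (- (2 * (INR l * PI)) + (INR N * PI + - PI)) by (unfold sym_index; field; exact N_nz).
  rewrite !cis_plus, !cis_opp, cis_2_PI_INR, cis_INR_mult_PI, cis_PI.
  replace ((-1) ^ N * (z ^ N * (/ 1 * ((-1) ^ N * / - (1)))))%C
    with (- ((-1) ^ N * (-1) ^ N) * z ^ N)%C
    by field.
  rewrite Cpow_opp_1_sqr. ring.
Qed.

Lemma psum_partial_fractions (N k : nat) (z t : C) : (1 <= k <= N)%nat ->
  (t ^ N + z ^ N)%C <> RtoC 0 ->
  psum (fun l => cis (sym_index N l * (PI * (INR k - 1) / INR N)) /
    (t + z * cis (- (sym_index N l * (PI / INR N)))))%C N =
  (INR N * (-1) ^ (k - 1) * z ^ (k - 1) * t ^ (N - k) / (t ^ N + z ^ N))%C :> C.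
Proof.
  intros k_in sum_nz. assert (N_nz : INR N <> 0) by (apply not_0_INR; lia).
  rewrite (psum_Cext _ (fun l => / (t ^ N + z ^ N) * psum (fun i => t ^ (N - 1 - i) * (- z) ^ i *
      cis (sym_index N l * (PI * (INR (k - 1) - INR i) / INR N))) N)%C).
  - rewrite psum_Cscal, psum_switch.
    rewrite (psum_Cext _ (fun i => if Nat.eq_dec i (k - 1)
      then (t ^ (N - 1 - i) * (- z) ^ i * INR N)%C else RtoC 0)).
    2:{ intros i i_lt. rewrite psum_Cscal, psum_cis_sym_index by lia.
        destruct (Nat.eq_dec i (k - 1)); ring. }
    rewrite (psum_Cext _ (fun i => if Nat.eq_dec i (k - 1)
      then (t ^ (N - k) * (- z) ^ (k - 1) * INR N)%C else RtoC 0)).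
    2:{ intros i _. destruct (Nat.eq_dec i (k - 1)) as [-> |]; [|reflexivity].
        replace (N - 1 - (k - 1))%nat with (N - k)%nat by lia. reflexivity. }
    rewrite psum_delta, Cpow_opp by lia. field. exact sum_nz.
  - intros l l_lt. set (w := (- (z * cis (- (sym_index N l * (PI / INR N)))))%C).
    assert (w_pow : (w ^ N)%C = (- z ^ N)%C) by (apply opp_mult_cis_sym_index_pow; lia).
    replace (t + z * cis (- (sym_index N l * (PI / INR N))))%C with (t - w)%C by (unfold w; ring).
    replace (t ^ N + z ^ N)%C with (t ^ N - w ^ N)%C in * by (rewrite w_pow; ring).
    unfold Cdiv. rewrite (Cinv_minus_psum t w N) by exact sum_nz.
    rewrite Cmult_comm, <- Cmult_assoc. f_equal. rewrite Cmult_comm, <- psum_Cscal.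
    apply psum_Cext. intros i _. unfold w.
    replace (- (z * cis (- (sym_index N l * (PI / INR N)))))%C
      with (- z * cis (- (sym_index N l * (PI / INR N))))%C by ring.
    rewrite Cpow_mult_l, <- cis_INR_mult.
    replace (sym_index N l * (PI * (INR (k - 1) - INR i) / INR N)) with
      (sym_index N l * (PI * (INR k - 1) / INR N) + INR i * - (sym_index N l * (PI / INR N)))
      by (rewrite minus_INR by lia; simpl (INR 1); field; exact N_nz).
    rewrite cis_plus. ring.
Qed.

(** * The points of the dual Herglotz functions *)

Lemma Cpower_opp (x : C) (s : R) : Cpower x (- s)%R = (/ Cpower x s)%C.
Proof. unfold Cpower. rewrite <- Cexp_opp, RtoC_opp. f_equal. ring. Qed.

Definition Nth_root (N : nat) (x : C) : C := Cpower x (1 / INR N)%R.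

Lemma Nth_root_neq_0 (N : nat) (x : C) : Nth_root N x <> RtoC 0.
Proof. apply Cexp_neq_0. Qed.

(* [exp (- i pi j / N) / x^(1/N)] for [j = 2 l - (N - 1)] *)
Definition dual_point (N : nat) (x : C) (l : nat) : C :=
  (cis (- (sym_index N l * (PI / INR N))) / Nth_root N x)%C.

Definition dual_log (N : nat) (x : C) (l : nat) : C :=
  (- ((1 / INR N)%R * Clog x) - Ci * (sym_index N l * (PI / INR N))%R)%C.

Lemma dual_point_Cexp (N : nat) (x : C) (l : nat) : dual_point N x l = Cexp (dual_log N x l).
Proof.
  unfold dual_point, dual_log, Nth_root, Cpower, Cdiv, Cminus.
  rewrite Cexp_plus, Cexp_opp, cis_Cexp, RtoC_opp, Cmult_comm. do 2 f_equal. ring.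
Qed.

(* For each [a > 0], these are the roots of [(- y)^N + a / x]. *)
Definition dual_pole (N : nat) (x : C) (a : R) (l : nat) : C :=
  (Rpower a (1 / INR N) * dual_point N x l)%C.

Definition dual_weight (k N l : nat) : C := cis (sym_index N l * (PI * (INR k - 1) / INR N)).

Lemma dual_weight_1 (N l : nat) : dual_weight 1 N l = RtoC 1.
Proof. unfold dual_weight. rewrite <- cis_0. f_equal. simpl. unfold Rdiv. ring. Qed.

(* With [a] and [b] ranging over the positive integers, the sums over [a] and over [b] are, up to
   elementary terms, those of the two Herglotz functions. *)
Definition herglotz_kernel (k N : nat) (x : C) (a b : R) : C :=
  (b ^ (N - k) / (a * (b ^ N + a / x)))%C.

Section DualPoints.

Variables (N : nat) (x : C).
Hypothesis N_pos : (0 < N)%nat.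
Hypothesis slit_x : slit_plane x.

Let INR_N_pos : 0 < INR N.
Proof. apply lt_0_INR, N_pos. Qed.

Lemma Nth_root_pow_N : (Nth_root N x ^ N)%C = x.
Proof.
  unfold Nth_root, Cpower. rewrite <- Cexp_INR_mult, Cmult_assoc, <- RtoC_mult.
  replace (INR N * (1 / INR N)) with 1 by (field; lra).
  rewrite Cmult_1_l. apply Cexp_Clog, slit_x.
Qed.

Lemma Cpower_INR_div (p : nat) : Cpower x (INR p / INR N)%R = (Nth_root N x ^ p)%C.
Proof.
  unfold Nth_root, Cpower. rewrite <- Cexp_INR_mult, Cmult_assoc, <- RtoC_mult.
  do 3 f_equal. field. lra.
Qed.

Lemma Re_dual_log (l : nat) : Re (dual_log N x l) = - (Re (Clog x) / INR N).
Proof. unfold dual_log. rewrite re_minus, re_opp, re_scal_l, re_scal_r. simpl. field. lra. Qed.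

Lemma Rabs_Im_dual_log_le (l : nat) : (l < N)%nat ->
  Rabs (Im (dual_log N x l)) <= (Rabs (Im (Clog x)) + (INR N - 1) * PI) / INR N.
Proof.
  intros l_lt. assert (PI_pos := PI_RGT_0). assert (index_le := Rabs_sym_index_le N l l_lt).
  replace (Im (dual_log N x l)) with (- ((Im (Clog x) + sym_index N l * PI) / INR N)).
  2:{ unfold dual_log. rewrite im_minus, im_opp, im_scal_l, im_scal_r. simpl. field. lra. }
  unfold Rdiv. rewrite Rabs_Ropp, Rabs_mult, (Rabs_pos_eq (/ INR N))
    by (apply Rlt_le, Rinv_0_lt_compat; lra).
  apply Rmult_le_compat_r; [apply Rlt_le, Rinv_0_lt_compat; lra|].
  eapply Rle_trans; [apply Rabs_triang|].
  rewrite Rabs_mult, (Rabs_pos_eq PI) by lra. nra.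
Qed.

Lemma dual_log_bound_lt_PI : (Rabs (Im (Clog x)) + (INR N - 1) * PI) / INR N < PI.
Proof. assert (im_lt := Im_Clog_lt x slit_x). apply Rlt_div_l; lra. Qed.

Lemma Rabs_Im_dual_log_lt (l : nat) : (l < N)%nat -> Rabs (Im (dual_log N x l)) < PI.
Proof.
  intros l_lt. eapply Rle_lt_trans; [apply Rabs_Im_dual_log_le, l_lt | apply dual_log_bound_lt_PI].
Qed.

Lemma slit_plane_dual_point (l : nat) : (l < N)%nat -> slit_plane (dual_point N x l).
Proof. intros. rewrite dual_point_Cexp. apply slit_plane_Cexp, Rabs_Im_dual_log_lt; auto. Qed.

Lemma Clog_dual_point (l : nat) : (l < N)%nat -> Clog (dual_point N x l) = dual_log N x l.
Proof. intros. rewrite dual_point_Cexp. apply Clog_Cexp, Rabs_Im_dual_log_lt; auto. Qed.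

Lemma slit_plane_dual_pole (a : R) (l : nat) : (l < N)%nat -> slit_plane (dual_pole N x a l).
Proof. intros. apply slit_plane_scal; auto using Rpower_pos, slit_plane_dual_point. Qed.

Lemma Clog_dual_pole (a : R) (l : nat) : (l < N)%nat ->
  Clog (dual_pole N x a l) =
  ((1 / INR N)%R * (ln a - Clog x) - Ci * (PI / INR N)%R * sym_index N l)%C.
Proof.
  intros l_lt. unfold dual_pole.
  rewrite Clog_scal, Clog_dual_point by auto using Rpower_pos, slit_plane_dual_point.
  unfold Rpower, dual_log. rewrite ln_exp, !RtoC_mult. ring.
Qed.

Lemma slit_plane_div (a : R) : 0 < a -> slit_plane (a / x)%C.
Proof. intros. apply slit_plane_scal; auto using slit_plane_inv. Qed.

Lemma Clog_div (a : R) : 0 < a -> Clog (a / x) = (ln a - Clog x)%C.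
Proof. intros. unfold Cdiv. rewrite Clog_scal, Clog_inv by auto using slit_plane_inv. ring. Qed.

Lemma kernel_denominator_neq_0 (a t : R) : 0 < a -> 0 <= t -> (t ^ N + a / x)%C <> RtoC 0.
Proof.
  intros a_pos t_nonneg. rewrite Cplus_comm, <- RtoC_pow.
  apply slit_plane_neq_0, slit_plane_plus; [apply pow_le, t_nonneg | apply slit_plane_div, a_pos].
Qed.

Lemma kernel_denominator_mult_neq_0 (a t : R) : 0 < a -> 0 <= t -> (t ^ N * x + a)%C <> RtoC 0.
Proof.
  intros a_pos t_nonneg E. apply (kernel_denominator_neq_0 a t a_pos t_nonneg).
  replace (t ^ N + a / x)%C with ((t ^ N * x + a) / x)%C
    by (field; apply slit_plane_neq_0, slit_x).
  rewrite E. unfold Cdiv. ring.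
Qed.

Lemma psum_dual_weight_inv (k : nat) (a t : R) : (1 <= k <= N)%nat -> 0 < a -> 0 <= t ->
  psum (fun l => dual_weight k N l / (t + dual_pole N x a l))%C N =
  (INR N * (-1) ^ (k - 1) * Rpower a ((INR k - 1) / INR N) / Nth_root N x ^ (k - 1)
    * t ^ (N - k) / (t ^ N + a / x))%C :> C.
Proof.
  intros k_in a_pos t_nonneg. assert (root_nz := Nth_root_neq_0 N x).
  set (z := (Rpower a (1 / INR N) / Nth_root N x)%C).
  assert (z_pow : forall p, (z ^ p)%C =
    (Rpower a (INR p / INR N) / Nth_root N x ^ p)%C).
  { intros p. unfold z, Cdiv. rewrite Cpow_mult_l, Cpow_inv by exact root_nz.
    rewrite <- RtoC_pow, <- Rpower_pow, Rpower_mult by apply Rpower_pos.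
    do 3 f_equal. field. lra. }
  assert (z_pow_N : (z ^ N)%C = (a / x)%C).
  { rewrite z_pow, Nth_root_pow_N. unfold Rdiv at 1. rewrite Rinv_r, Rpower_1; auto. lra. }
  assert (fractions := psum_partial_fractions N k z t k_in).
  rewrite z_pow_N in fractions.
  rewrite (psum_Cext _ (fun l => cis (sym_index N l * (PI * (INR k - 1) / INR N)) /
    (t + z * cis (- (sym_index N l * (PI / INR N)))))%C).
  - rewrite fractions by (apply kernel_denominator_neq_0; auto).
    rewrite z_pow, minus_INR by lia. simpl (INR 1). unfold Cdiv. ring.
  - intros l _. unfold dual_weight.
    replace (dual_pole N x a l) with (z * cis (- (sym_index N l * (PI / INR N))))%C; [reflexivity|].
    unfold dual_pole, dual_point, z, Cdiv. ring.
Qed.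

Lemma psum_dual_weight_shifted_harmonic (k M : nat) (a : R) : (1 <= k <= N)%nat -> 0 < a ->
  psum (fun l => dual_weight k N l * shifted_harmonic (dual_pole N x a l) M)%C N =
  (INR N * (-1) ^ (k - 1) * Rpower a ((INR N + INR k - 1) / INR N) / Nth_root N x ^ (k - 1)
    * psum (fun n => herglotz_kernel k N x a (INR (S n))) M)%C :> C.
Proof.
  intros k_in a_pos. unfold shifted_harmonic.
  rewrite (psum_Cext _ (fun l => psum (fun i => dual_weight k N l *
    / (dual_pole N x a l + INR (S i)))%C M)) by (intros; symmetry; apply psum_Cscal).
  rewrite psum_switch, <- psum_Cscal. apply psum_Cext. intros n _.
  rewrite (psum_Cext _ (fun l => dual_weight k N l / (INR (S n) + dual_pole N x a l))%C)
    by (intros; unfold Cdiv; do 2 f_equal; apply Cplus_comm).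
  rewrite psum_dual_weight_inv by auto using pos_INR.
  replace ((INR N + INR k - 1) / INR N) with (1 + (INR k - 1) / INR N) by (field; lra).
  rewrite Rpower_plus, Rpower_1, RtoC_mult by auto.
  unfold herglotz_kernel. field. repeat split.
  - apply slit_plane_neq_0, slit_x.
  - apply kernel_denominator_mult_neq_0; auto using pos_INR.
  - apply RtoC_neq_0; lra.
  - apply Cpow_nz, Nth_root_neq_0.
Qed.

Lemma herglotz_kernel_partial_fractions (k : nat) (a b : R) : (k <= N)%nat -> 0 < a -> 0 < b ->
  herglotz_kernel k N x a b = ((/ a - / (b ^ N * x + a)) / b ^ k)%C.
Proof.
  intros k_le a_pos b_pos. unfold herglotz_kernel.
  assert (aC_nz : RtoC a <> RtoC 0) by (apply RtoC_neq_0; lra).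
  assert (bC_nz : RtoC b <> RtoC 0) by (apply RtoC_neq_0; lra).
  assert (den_nz := kernel_denominator_mult_neq_0 a b a_pos (Rlt_le _ _ b_pos)).
  replace (b ^ N)%C with (b ^ k * b ^ (N - k))%C in *
    by (rewrite <- Cpow_add_r; f_equal; lia).
  field. auto using Cpow_nz, slit_plane_neq_0.
Qed.

Lemma psum_dual_weight_div_dual_point (k : nat) : (1 <= k <= N)%nat ->
  psum (fun l => dual_weight k N l / dual_point N x l)%C N =
  (Nth_root N x * if Nat.eq_dec k N then INR N * (-1) ^ (N + 1) else 0)%C :> C.
Proof.
  intros k_in. assert (root_nz := Nth_root_neq_0 N x).
  rewrite (psum_Cext _ (fun l => Nth_root N x * cis (sym_index N l * (PI * INR k / INR N)))%C).
  - rewrite psum_Cscal. f_equal. destruct (Nat.eq_dec k N) as [-> | k_neq].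
    + rewrite (psum_Cext _ (fun _ => ((-1) ^ (N + 1))%C)); [apply psum_Cconst|].
      intros l l_lt.
      replace (sym_index N l * (PI * INR N / INR N))
        with (2 * (INR l * PI) + - (INR (N + 1) * PI) + 2 * (INR 1 * PI))
        by (unfold sym_index; rewrite plus_INR; simpl (INR 1); field; lra).
      rewrite !cis_plus, !cis_2_PI_INR, cis_opp, cis_INR_mult_PI, Cinv_Cpow_opp_1. ring.
    + apply psum_cis_sym_index_eq_0; [apply sin_PI_frac_neq_0 | apply cis_PI_frac_pow]; lia.
  - intros l _. unfold dual_weight, dual_point. rewrite cis_opp.
    replace (sym_index N l * (PI * INR k / INR N)) with
      (sym_index N l * (PI * (INR k - 1) / INR N) + sym_index N l * (PI / INR N)) by (field; lra).
    rewrite cis_plus. field. auto using cis_neq_0.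
Qed.

Definition dual_Herglotz_sum (k : nat) : C :=
  psum (fun l => dual_weight k N l *
    Herglotz ((INR N + INR k - 1) / INR N) (1 / INR N) (dual_point N x l))%C N.

Lemma is_series_dual_Herglotz (k : nat) : (1 <= k <= N)%nat ->
  is_series (fun m => psum (fun l => dual_weight k N l *
      digamma_gap (dual_pole N x (INR (S m)) l))%C N
      / Rpower (INR (S m)) ((INR N + INR k - 1) / INR N))%C
    (dual_Herglotz_sum k + (-1) ^ k * INR N * Bterm k N x)%C.
Proof.
  intros k_in. assert (k_ge_1 := le_INR 1 k (proj1 k_in)). simpl in k_ge_1.
  set (s := (INR N + INR k - 1) / INR N).
  assert (exponent : s + 1 / INR N = 1 + INR k / INR N) by (unfold s; field; lra).
  assert (exponent_gt_1 : 1 < s + 1 / INR N).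
  { rewrite exponent. assert (0 < INR k / INR N) by (apply Rdiv_lt_0_compat; lra). lra. }
  replace ((-1) ^ k * INR N * Bterm k N x)%C with (Czeta (1 + INR k / INR N)%R *
    psum (fun l => dual_weight k N l / dual_point N x l)%C N)%C.
  2:{ rewrite psum_dual_weight_div_dual_point by exact k_in. unfold Bterm.
      destruct (Nat.eq_dec k N) as [-> | _]; [|ring].
      replace ((-1) ^ (N + N + 1))%C with ((-1) ^ N * (-1) ^ (N + 1))%C
        by (rewrite <- Cpow_add_r; f_equal; lia).
      fold (Nth_root N x). rewrite <- (Cmult_1_l (INR N * (-1) ^ (N + 1))%C), <- (Cpow_opp_1_sqr N).
      ring. }
  unfold dual_Herglotz_sum. fold s. rewrite <- psum_Cscal, <- psum_Cplus. apply is_series_psum_C.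
  apply filterlim_ext with (fun M => psum (fun l => dual_weight k N l *
    psum (fun m => digamma_gap (dual_pole N x (INR (S m)) l) / Rpower (INR (S m)) s)%C M)%C N).
  - intros M. rewrite (psum_Cext _ (fun l => psum (fun m => dual_weight k N l *
      (digamma_gap (dual_pole N x (INR (S m)) l) / Rpower (INR (S m)) s))%C M))
      by (intros; symmetry; apply psum_Cscal).
    rewrite psum_switch. apply psum_Cext. intros m _. unfold Cdiv at 2.
    rewrite Cmult_comm, <- psum_Cscal. apply psum_Cext. intros l _. unfold Cdiv. ring.
  - apply (is_Clim_seq_psum (fun l M => (dual_weight k N l *
      psum (fun m => digamma_gap (dual_pole N x (INR (S m)) l) / Rpower (INR (S m)) s)%C M)%C)).
    intros l l_lt.
    replace (dual_weight k N l * Herglotz s (1 / INR N) (dual_point N x l) +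
        Czeta (1 + INR k / INR N)%R * (dual_weight k N l / dual_point N x l))%C
      with (dual_weight k N l * (Herglotz s (1 / INR N) (dual_point N x l) +
        Czeta (s + 1 / INR N)%R / dual_point N x l))%C
      by (rewrite exponent; unfold Cdiv; ring).
    apply is_Clim_seq_scal, is_series_psum_C, is_series_Herglotz; auto using slit_plane_dual_point.
Qed.

End DualPoints.

(** * Interchange of summations *)

Lemma is_lim_seq_Series_tail (b : nat -> R) : ex_series b ->
  is_lim_seq (fun P => Series b - psum b P) 0.
Proof.
  intros ex_b. rewrite <- (Rminus_diag (Series b)).
  apply is_lim_seq_minus'; [apply is_lim_seq_const|].
  apply is_series_psum_R, Series_correct, ex_b.
Qed.

Lemma ex_series_of_dominated_rows (a : nat -> nat -> C) (u v : nat -> R) (row : nat -> C) :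
  ex_series u -> ex_series v -> (forall m n, Cmod (a m n) <= u m * v n) ->
  (forall m, is_series (a m) (row m)) -> exists S : C, is_series row S.
Proof.
  intros ex_u ex_v a_le sum_row. apply ex_series_Cmod_le with (fun m => Series v * u m).
  - intros m. rewrite Rmult_comm, <- Series_scal_l.
    apply Cmod_series_le with (a m); auto. apply ex_series_Rscal, ex_v.
  - apply ex_series_Rscal, ex_u.
Qed.

Lemma Cmod_psum_rows_minus_psum_le (a : nat -> nat -> C) (u v : nat -> R) (row : nat -> C)
    (P Q : nat) :
  (forall m, 0 <= u m) -> (forall n, 0 <= v n) -> ex_series u -> ex_series v ->
  (forall m n, Cmod (a m n) <= u m * v n) -> (forall m, is_series (a m) (row m)) ->
  Cmod (psum row Q - psum (fun m => psum (a m) P) Q) <= Series u * (Series v - psum v P).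
Proof.
  intros u_nonneg v_nonneg ex_u ex_v a_le sum_row.
  assert (tail_nonneg := psum_le_Series v P v_nonneg ex_v).
  rewrite <- psum_Cminus.
  apply Rle_trans with (psum (fun m => (Series v - psum v P) * u m) Q).
  - apply Cmod_psum_le. intros m _.
    replace ((Series v - psum v P) * u m)
      with (Series (fun n => u m * v n) - psum (fun n => u m * v n) P)
      by (rewrite Series_scal_l, psum_Rscal; ring).
    apply Cmod_series_tail_le; auto. apply ex_series_Rscal, ex_v.
  - rewrite psum_Rscal, Rmult_comm. apply Rmult_le_compat_r; [lra|].
    apply psum_le_Series; auto.
Qed.

Lemma is_series_switch (a : nat -> nat -> C) (u v : nat -> R) (row col : nat -> C) :
  (forall m, 0 <= u m) -> (forall n, 0 <= v n) -> ex_series u -> ex_series v ->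
  (forall m n, Cmod (a m n) <= u m * v n) ->
  (forall m, is_series (a m) (row m)) -> (forall n, is_series (fun m => a m n) (col n)) ->
  exists S : C, is_series row S /\ is_series col S.
Proof.
  intros u_nonneg v_nonneg ex_u ex_v a_le sum_row sum_col.
  assert (a_le_swap : forall n m, Cmod (a m n) <= v n * u m)
    by (intros; rewrite Rmult_comm; auto).
  destruct (ex_series_of_dominated_rows a u v row) as [S sum_S]; auto.
  destruct (ex_series_of_dominated_rows (fun n m => a m n) v u col) as [T sum_T]; auto.
  exists S. split; [exact sum_S|]. replace S with T; [exact sum_T|].
  apply is_series_psum_C in sum_S. apply is_series_psum_C in sum_T.
  apply Ceq_minus, is_Clim_seq_unique with (fun M => psum col M - psum row M)%C.
  { apply is_Clim_seq_minus; auto. }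
  apply is_Clim_seq_bound with (fun M =>
    Series v * (Series u - psum u M) + Series u * (Series v - psum v M)).
  - intros M.
    replace (psum col M - psum row M - 0)%C with
      ((psum col M - psum (fun n => psum (fun m => a m n) M) M) -
       (psum row M - psum (fun m => psum (a m) M) M))%C by (rewrite (psum_switch a); ring).
    eapply Rle_trans; [apply Cmod_triangle|]. rewrite Cmod_opp. apply Rplus_le_compat.
    + apply Cmod_psum_rows_minus_psum_le with (a := fun n m => a m n); auto.
    + apply Cmod_psum_rows_minus_psum_le; auto.
  - apply is_lim_seq_plus_0; apply is_lim_seq_scal_0, is_lim_seq_Series_tail; auto.
Qed.

Lemma Rpower_weighted_le (a b s : R) : 0 < a -> 0 < b -> 0 <= s <= 1 ->
  Rpower a s * Rpower b (1 - s) <= a + b.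
Proof.
  intros a_pos b_pos s_in. unfold Rpower. rewrite <- exp_plus.
  destruct (Rle_dec (ln a) (ln b)) as [ln_le | ln_gt].
  - apply Rle_trans with (exp (ln b)); [apply exp_le; nra | rewrite exp_ln; lra].
  - apply Rle_trans with (exp (ln a)); [apply exp_le; nra | rewrite exp_ln; lra].
Qed.

Lemma kernel_denominator_ge (N : nat) (x : C) : slit_plane x ->
  exists d, 0 < d /\ forall a b : R, 0 < a -> 0 < b -> d * (b ^ N + a) <= Cmod (b ^ N + a / x).
Proof.
  intros slit_x. assert (slit_inv := slit_plane_inv x slit_x).
  destruct (slit_plane_cone_bound _ slit_inv) as [c [c_in growth]].
  assert (inv_pos := slit_plane_Cmod_pos _ slit_inv).
  set (e := Rmin 1 (Cmod (/ x))).
  assert (e_pos : 0 < e) by (apply Rmin_pos; lra).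
  assert (e_le_1 : e <= 1) by apply Rmin_l. assert (e_le_inv : e <= Cmod (/ x)) by apply Rmin_r.
  exists (c * e). split; [nra|]. intros a b a_pos b_pos.
  assert (power_pos := pow_lt b N b_pos).
  rewrite <- RtoC_pow, Cplus_comm.
  eapply Rle_trans; [|apply (growth a (b ^ N)); lra].
  rewrite Rmult_assoc. apply Rmult_le_compat_l; nra.
Qed.

Lemma Cmod_herglotz_kernel_le (k N : nat) (x : C) (e : R) : (1 <= k <= N)%nat -> slit_plane x ->
  0 < e <= INR k ->
  exists K, 0 <= K /\ forall a b, 0 < a -> 0 < b -> Cmod (herglotz_kernel k N x a b) <=
    K * Rpower a (- (1 + (INR k - e) / INR N)) * Rpower b (- e).
Proof.
  intros k_in slit_x e_in.
  assert (k_le := le_INR _ _ (proj2 k_in)).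
  destruct (kernel_denominator_ge N x slit_x) as [d [d_pos denominator_ge]].
  exists (/ d). split; [apply Rlt_le, Rinv_0_lt_compat, d_pos|].
  intros a b a_pos b_pos. specialize (denominator_ge a b a_pos b_pos).
  set (s := (INR N - INR k + e) / INR N).
  assert (s_in : 0 <= s <= 1).
  { unfold s. split; [apply Rlt_le, Rdiv_lt_0_compat; lra | apply Rle_div_l; lra]. }
  assert (weighted := Rpower_weighted_le (b ^ N) a s (pow_lt b N b_pos) a_pos s_in).
  rewrite <- (Rpower_pow N b b_pos), Rpower_mult in weighted at 1.
  set (w := Rpower b (INR N * s) * Rpower a (1 - s)) in *.
  assert (w_pos : 0 < w) by (apply Rmult_lt_0_compat; apply Rpower_pos).
  assert (den_pos : 0 < Cmod (b ^ N + a / x)) by nra.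
  assert (kernel_le : Cmod (herglotz_kernel k N x a b) <= b ^ (N - k) * / (a * (d * w))).
  { unfold herglotz_kernel. assert (den_nz := proj2 (Cmod_gt_0 _) den_pos).
    assert (aC_nz : RtoC a <> RtoC 0) by (apply RtoC_neq_0; lra).
    rewrite Cmod_div, Cmod_mult, Cmod_pow, !Cmod_R, !Rabs_pos_eq
      by (auto using Cmult_neq_0; lra).
    apply Rmult_le_compat_l; [apply pow_le; lra|].
    apply Rinv_le_contravar; [apply Rmult_lt_0_compat; nra|].
    apply Rmult_le_compat_l; nra. }
  eapply Rle_trans; [exact kernel_le|]. right.
  replace (b ^ (N - k)) with (Rpower b (- e) * Rpower b (INR N * s)).
  2:{ rewrite <- Rpower_plus, <- Rpower_pow, minus_INR by (auto; lia).
      f_equal. unfold s. field. lra. }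
  replace (Rpower a (- (1 + (INR k - e) / INR N))) with (/ (a * Rpower a (1 - s))).
  2:{ rewrite <- (Rpower_1 a) at 1 by exact a_pos. rewrite <- Rpower_plus, <- Rpower_Ropp.
      f_equal. unfold s. field. lra. }
  unfold w. assert (a_power_pos := Rpower_pos a (1 - s)).
  assert (b_power_pos := Rpower_pos b (INR N * s)). field. repeat split; lra.
Qed.

(** * Harmonic sums *)

Definition harmonic (n : nat) : R := psum (fun i => / INR (S i)) n.

Lemma harmonic_S (n : nat) : harmonic (S n) = harmonic n + / INR (S n).
Proof. reflexivity. Qed.

Lemma psum_Cinv_INR (n : nat) : psum (fun i => / INR (S i))%C n = RtoC (harmonic n) :> C.
Proof.
  unfold harmonic. rewrite <- psum_RtoC. apply psum_Cext. intros i _.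
  rewrite RtoC_inv; [reflexivity | apply Rgt_not_eq, INR_S_pos].
Qed.

Lemma is_lim_seq_of_summable_increments (u b : nat -> R) :
  (forall n, Rabs (u (S n) - u n) <= b n) -> ex_series b -> is_lim_seq u (real (Lim_seq u)).
Proof.
  intros increment_le ex_b.
  destruct (ex_lim_of_summable_increments (V := R_NormedModule) u) as [l lim_u].
  { apply (ex_series_le (V := R_CompleteNormedModule) _ b); auto. }
  change (is_lim_seq u (Finite l)) in lim_u.
  rewrite (is_lim_seq_unique _ _ lim_u). exact lim_u.
Qed.

Lemma euler_gamma_lim : is_lim_seq (fun n => harmonic (S n) - ln (INR (S n))) euler_gamma.
Proof.
  replace euler_gamma
    with (real (Lim_seq (fun n => harmonic (S n) - ln (INR (S n))))).
  2:{ unfold euler_gamma. f_equal. etransitivity; [|apply Lim_seq_incr_1].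
      apply Lim_seq_ext. intros n. f_equal.
      unfold harmonic. apply (psum_sum_n_m (fun m => / INR m)). }
  apply is_lim_seq_of_summable_increments with (fun n => / INR (S n) - / INR (S (S n))).
  - intros n. rewrite (harmonic_S (S n)). generalize (ln_INR_S_increment n). intros ln_step.
    apply Rabs_le. lra.
  - apply ex_series_telescoping_le with (fun n => / INR (S n)).
    + intros n. apply Rlt_le, Rinv_0_lt_compat, INR_S_pos.
    + intros n. generalize (ln_INR_S_increment n). lra.
Qed.

Lemma is_series_digamma_gap (y : C) : slit_plane y ->
  is_series (fun m => / INR (S m) - / (y + INR (S m)))%C (digamma_gap y + Clog y + euler_gamma)%C.
Proof.
  intros slit_y. apply is_series_psum_C, is_Clim_seq_incr_1.
  apply filterlim_ext with (fun n => ln (INR (S n)) - shifted_harmonic y (S n) +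
    RtoC (harmonic (S n) - ln (INR (S n))))%C.
  - intros n. rewrite psum_Cminus, psum_Cinv_INR, RtoC_minus. unfold shifted_harmonic. ring.
  - replace (digamma_gap y + Clog y)%C with (digamma_succ y) by (unfold digamma_gap; ring).
    apply is_Clim_seq_plus; [apply digamma_succ_lim, slit_y|].
    apply is_Clim_seq_RtoC, euler_gamma_lim.
Qed.

(** * The case [k > 1] *)

Section HigherHerglotz.

Variables (k N : nat) (x : C).
Hypothesis k_in : (1 < k <= N)%nat.
Hypothesis slit_x : slit_plane x.

Let N_pos : (0 < N)%nat.
Proof. lia. Qed.

Let INR_N_pos : 0 < INR N.
Proof. apply lt_0_INR, N_pos. Qed.

Let INR_N_neq_0_C : RtoC (INR N) <> RtoC 0.
Proof. apply RtoC_neq_0. lra. Qed.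

Let INR_k_ge_2 : 2 <= INR k.
Proof. apply (le_INR 2), k_in. Qed.

Lemma sin_weight_angle_neq_0 : sin (PI / INR N * (INR k - 1)) <> 0.
Proof.
  replace (PI / INR N * (INR k - 1)) with (PI * INR (k - 1) / INR N)
    by (rewrite minus_INR by lia; simpl (INR 1); field; lra).
  apply sin_PI_frac_neq_0. lia.
Qed.

Lemma psum_dual_weight : psum (dual_weight k N) N = RtoC 0 :> C.
Proof.
  unfold dual_weight.
  replace (INR k - 1) with (INR (k - 1)) by (rewrite minus_INR by lia; reflexivity).
  apply psum_cis_sym_index_eq_0; [apply sin_PI_frac_neq_0 | apply cis_PI_frac_pow]; lia.
Qed.

Lemma psum_dual_weight_Clog (a : R) :
  psum (fun l => dual_weight k N l * Clog (dual_pole N x a l))%C N =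
  (- ((-1) ^ (k - 1) * (PI / sin (PI / INR N * (INR k - 1))%R)))%C :> C.
Proof.
  assert (angle : PI / INR N * (INR k - 1) = PI * INR (k - 1) / INR N)
    by (rewrite minus_INR by lia; simpl (INR 1); field; lra).
  assert (sin_nz := sin_weight_angle_neq_0). rewrite angle in *.
  rewrite (psum_Cext _ (fun l => (1 / INR N)%R * (ln a - Clog x) * dual_weight k N l
    - Ci * (PI / INR N)%R * (sym_index N l * cis (sym_index N l * (PI * INR (k - 1) / INR N))))%C).
  2:{ intros l l_lt. rewrite Clog_dual_pole by auto. unfold dual_weight.
      rewrite minus_INR by lia. simpl (INR 1). ring. }
  rewrite psum_Cminus, !psum_Cscal, psum_dual_weight, psum_sym_index_mult_cis
    by (try apply sin_PI_frac_neq_0; try apply cis_PI_frac_pow; lia).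
  replace (INR N * (PI * INR (k - 1) / INR N)) with (INR (k - 1) * PI) by (field; lra).
  rewrite cis_INR_mult_PI, <- (Cinv_Cpow_opp_1 (k - 1)) at 1. rewrite !RtoC_div by lra.
  apply RtoC_neq_0 in sin_nz. field. auto using Cpow_opp_1_neq_0, Ci_nz.
Qed.

Definition kernel_row (a : R) : C :=
  (- ((-1) ^ (k - 1) * Nth_root N x ^ (k - 1) /
    (INR N * Rpower a ((INR N + INR k - 1) / INR N)) *
    psum (fun l => dual_weight k N l * digamma_succ (dual_pole N x a l)) N))%C.

Lemma is_series_kernel_row (a : R) : 0 < a ->
  is_series (fun n => herglotz_kernel k N x a (INR (S n))) (kernel_row a).
Proof.
  intros a_pos. apply is_series_psum_C, is_Clim_seq_incr_1. unfold kernel_row.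
  set (s := (INR N + INR k - 1) / INR N).
  assert (power_nz := RtoC_neq_0 _ (Rgt_not_eq _ _ (Rpower_pos a s))).
  assert (root_nz := Nth_root_neq_0 N x). assert (sign_nz := Cpow_opp_1_neq_0 (k - 1)).
  replace (- ((-1) ^ (k - 1) * Nth_root N x ^ (k - 1) / (INR N * Rpower a s) *
      psum (fun l => dual_weight k N l * digamma_succ (dual_pole N x a l)) N))%C with
    (- ((-1) ^ (k - 1) * Nth_root N x ^ (k - 1) / (INR N * Rpower a s)) *
      psum (fun l => dual_weight k N l * digamma_succ (dual_pole N x a l)) N)%C by ring.
  apply filterlim_ext with (fun n =>
    - ((-1) ^ (k - 1) * Nth_root N x ^ (k - 1) / (INR N * Rpower a s)) *
    psum (fun l => dual_weight k N l *
      (ln (INR (S n)) - shifted_harmonic (dual_pole N x a l) (S n))) N)%C.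
  - intros n.
    rewrite (psum_Cext _ (fun l => ln (INR (S n)) * dual_weight k N l -
      dual_weight k N l * shifted_harmonic (dual_pole N x a l) (S n))%C) by (intros; ring).
    rewrite psum_Cminus, psum_Cscal, psum_dual_weight, psum_dual_weight_shifted_harmonic
      by (auto; lia).
    fold s. rewrite <- (Cinv_Cpow_opp_1 (k - 1)) at 1. field. auto using Cpow_nz.
  - apply is_Clim_seq_scal.
    apply (is_Clim_seq_psum (fun l n => (dual_weight k N l *
      (ln (INR (S n)) - shifted_harmonic (dual_pole N x a l) (S n)))%C)).
    intros l l_lt. apply is_Clim_seq_scal, digamma_succ_lim, slit_plane_dual_pole; auto.
Qed.

Definition kernel_col (b : R) : C :=
  ((digamma_gap (b ^ N * x) + (INR N * ln b + Clog x) + euler_gamma) / b ^ k)%C.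

Lemma is_series_kernel_col (b : R) : 0 < b ->
  is_series (fun m => herglotz_kernel k N x (INR (S m)) b) (kernel_col b).
Proof.
  intros b_pos. assert (power_pos := pow_lt b N b_pos). unfold kernel_col.
  replace (INR N * ln b + Clog x)%C with (Clog (b ^ N * x)).
  2:{ rewrite <- RtoC_pow, Clog_scal, ln_pow, RtoC_mult by auto. reflexivity. }
  unfold Cdiv. rewrite Cmult_comm.
  apply is_series_Cext with (fun m => / b ^ k * (/ INR (S m) - / (b ^ N * x + INR (S m))))%C.
  - intros m. rewrite herglotz_kernel_partial_fractions by (auto using INR_S_pos; lia).
    unfold Cdiv. apply Cmult_comm.
  - apply is_series_Cscal, is_series_digamma_gap.
    rewrite <- RtoC_pow. apply slit_plane_scal; auto.
Qed.

Lemma ex_kernel_double_series : exists S : C,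
  is_series (fun m => kernel_row (INR (Datatypes.S m))) S /\
  is_series (fun n => kernel_col (INR (Datatypes.S n))) S.
Proof.
  destruct (Cmod_herglotz_kernel_le k N x (3 / 2) ltac:(lia) slit_x ltac:(lra))
    as [K [K_nonneg kernel_le]].
  apply is_series_switch with
    (a := fun m n => herglotz_kernel k N x (INR (S m)) (INR (S n)))
    (u := fun m => K * Rpower (INR (S m)) (- (1 + (INR k - 3 / 2) / INR N)))
    (v := fun n => Rpower (INR (S n)) (- (3 / 2))).
  - intros m. apply Rmult_le_pos; [exact K_nonneg | apply Rlt_le, Rpower_pos].
  - intros n. apply Rlt_le, Rpower_pos.
  - apply ex_series_Rscal, ex_series_Rpower.
    assert (0 < (INR k - 3 / 2) / INR N) by (apply Rdiv_lt_0_compat; lra). lra.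
  - apply ex_series_Rpower. lra.
  - intros m n. apply kernel_le; apply INR_S_pos.
  - intros m. apply is_series_kernel_row, INR_S_pos.
  - intros n. apply is_series_kernel_col, INR_S_pos.
Qed.

Lemma is_series_kernel_col_Herglotz :
  is_series (fun n => kernel_col (INR (S n)))
    (Herglotz (INR k) (INR N) x + Czeta (INR k + INR N)%R / x
      + (euler_gamma + Clog x) * Czeta (INR k) - INR N * C_derive Czeta (INR k))%C.
Proof.
  assert (sum_Herglotz := is_series_Herglotz_nat k N x ltac:(lia) slit_x).
  assert (sum_zeta := is_series_Czeta (INR k) ltac:(lra)).
  assert (sum_zeta' := is_series_C_derive_Czeta (INR k) ltac:(lra)).
  replace (_ - INR N * C_derive Czeta (INR k))%C with
    (Herglotz (INR k) (INR N) x + Czeta (INR k + INR N)%R / x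
      + (euler_gamma + Clog x) * Czeta (INR k) + INR N * - C_derive Czeta (INR k))%C by ring.
  eapply is_series_Cext; [|exact (is_series_Cplus _ _ _ _ (is_series_Cplus _ _ _ _ sum_Herglotz
    (is_series_Cscal (euler_gamma + Clog x) _ _ sum_zeta))
    (is_series_Cscal (INR N) _ _ sum_zeta'))].
  intros n. cbv beta. unfold kernel_col.
  rewrite RtoC_mult, Rpower_Ropp, Rpower_INR_S, RtoC_inv, RtoC_pow
    by apply pow_nonzero, Rgt_not_eq, INR_S_pos.
  unfold Cdiv. ring.
Qed.

Lemma psum_dual_weight_digamma_gap (a : R) :
  (psum (fun l => dual_weight k N l * digamma_gap (dual_pole N x a l))%C N
    / Rpower a ((INR N + INR k - 1) / INR N))%C =
  ((-1) ^ (k - 1) * (PI / sin (PI / INR N * (INR k - 1))%R)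
      * Rpower a (- ((INR N + INR k - 1) / INR N))
    - INR N * (-1) ^ (k - 1) / Nth_root N x ^ (k - 1) * kernel_row a)%C.
Proof.
  unfold kernel_row. set (s := (INR N + INR k - 1) / INR N).
  assert (power_nz := RtoC_neq_0 _ (Rgt_not_eq _ _ (Rpower_pos a s))).
  assert (root_pow_nz := Cpow_nz _ (k - 1) (Nth_root_neq_0 N x)).
  assert (sinC_nz := RtoC_neq_0 _ sin_weight_angle_neq_0).
  rewrite Rpower_Ropp, RtoC_inv by apply Rgt_not_eq, Rpower_pos.
  rewrite (psum_Cext _ (fun l => dual_weight k N l * digamma_succ (dual_pole N x a l)
    - dual_weight k N l * Clog (dual_pole N x a l))%C)
    by (intros; unfold digamma_gap; ring).
  rewrite psum_Cminus, psum_dual_weight_Clog.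
  rewrite <- (Cinv_Cpow_opp_1 (k - 1)) at 3. field. auto using Cpow_opp_1_neq_0.
Qed.

(* Both Herglotz functions are read off the common sum of [kernel_row] and [kernel_col]. *)
Lemma Herglotz_transform :
  (Herglotz (INR k) (INR N) x / Nth_root N x ^ (k - 1)
    - (-1) ^ k / INR N * dual_Herglotz_sum N x k)%C =
  (PI / INR N * (Czeta (1 + (INR k - 1) / INR N)%R / sin (PI / INR N * (INR k - 1))%R)
    + (- ((euler_gamma + Clog x) * Czeta (INR k)) + INR N * C_derive Czeta (INR k))
      / Nth_root N x ^ (k - 1)
    - Czeta (INR k + INR N)%R / (x * Nth_root N x ^ (k - 1)) + Bterm k N x)%C.
Proof.
  destruct ex_kernel_double_series as [S [sum_row sum_col]].
  assert (col_total := is_series_Cunique _ _ _ sum_col is_series_kernel_col_Herglotz).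
  assert (exponent : (INR N + INR k - 1) / INR N = 1 + (INR k - 1) / INR N) by (field; lra).
  assert (exponent_gt_1 : 1 < 1 + (INR k - 1) / INR N).
  { assert (0 < (INR k - 1) / INR N) by (apply Rdiv_lt_0_compat; lra). lra. }
  assert (sum_zeta := is_series_Czeta _ exponent_gt_1). rewrite <- exponent in *.
  set (q := (PI / sin (PI / INR N * (INR k - 1))%R)%C).
  assert (row_total : (dual_Herglotz_sum N x k + (-1) ^ k * INR N * Bterm k N x)%C =
    ((-1) ^ (k - 1) * q * Czeta ((INR N + INR k - 1) / INR N)%R
      - INR N * (-1) ^ (k - 1) / Nth_root N x ^ (k - 1) * S)%C).
  { eapply is_series_Cunique; [apply is_series_dual_Herglotz; auto; lia|].
    eapply is_series_Cext; [|exact (is_series_Cminus _ _ _ _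
      (is_series_Cscal ((-1) ^ (k - 1) * q) _ _ sum_zeta)
      (is_series_Cscal (INR N * (-1) ^ (k - 1) / Nth_root N x ^ (k - 1)) _ _ sum_row))].
    intros m. symmetry. apply psum_dual_weight_digamma_gap. }
  replace (dual_Herglotz_sum N x k) with
    ((-1) ^ (k - 1) * q * Czeta ((INR N + INR k - 1) / INR N)%R
      - INR N * (-1) ^ (k - 1) / Nth_root N x ^ (k - 1) * S
      - (-1) ^ k * INR N * Bterm k N x)%C by (rewrite <- row_total; ring).
  rewrite col_total. clear S sum_row sum_col col_total row_total sum_zeta. unfold q.
  assert (sinC_nz := RtoC_neq_0 _ sin_weight_angle_neq_0).
  assert (root_pow_nz := Cpow_nz _ (k - 1) (Nth_root_neq_0 N x)).
  assert (x_nz := slit_plane_neq_0 x slit_x).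
  assert (sign_succ : ((-1) ^ k)%C = (- (-1) ^ (k - 1))%C).
  { replace k with (1 + (k - 1))%nat at 1 by lia. rewrite Cpow_add_r. simpl. ring. }
  rewrite sign_succ. generalize (Cinv_Cpow_opp_1 (k - 1)) (Cpow_opp_1_neq_0 (k - 1)).
  generalize ((-1) ^ (k - 1))%C. intros sign sign_inv sign_nz.
  rewrite <- sign_inv at 2 3 4. field. auto.
Qed.

End HigherHerglotz.

(** * A dilogarithm identity through Riemann sums *)

Lemma Clog_1_plus_div (z : C) (t : R) : slit_plane z -> 0 <= t ->
  Clog (1 + t / z) = (Clog (z + t) - Clog z)%C.
Proof.
  intros slit_z t_nonneg. assert (slit_inv := slit_plane_inv z slit_z).
  set (f := fun s : R => (Clog (z + s * 1) - Clog (1 + s * / z))%C).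
  assert (f_const : f t = f 0).
  { apply is_derive_0_const; [exact t_nonneg|]. intros s s_in.
    assert (slit_shift : slit_plane (z + s * 1)%C)
      by (rewrite Cmult_1_r; apply slit_plane_plus; auto; lra).
    assert (slit_ratio : slit_plane (1 + s * / z)%C) by (apply slit_plane_affine; auto; lra).
    evar_last; [apply is_derive_Cminus; apply is_derive_Clog_line; assumption|].
    apply slit_plane_neq_0 in slit_z, slit_shift. rewrite Cmult_1_r in *.
    replace (1 + s * / z)%C with ((z + s) / z)%C by (field; exact slit_z).
    field. auto. }
  unfold f in f_const. rewrite !Cmult_0_l, !Cplus_0_r, Cmult_1_r, (Clog_RtoC 1), ln_1 in f_const
    by lra.
  unfold Cdiv. replace (Clog (z + t)) with (Clog z - 0 + Clog (1 + t * / z))%C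
    by (rewrite <- f_const; ring).
  ring.
Qed.

Lemma is_derive_Clog_1_plus_scal (f : R -> C) (t r : R) (d : C) :
  0 <= r -> slit_plane (f t) -> is_derive f t d ->
  is_derive (fun s => Clog (1 + r * f s)) t (d / f t * (r * f t / (1 + r * f t)))%C.
Proof.
  intros r_nonneg slit_ft der_f.
  assert (slit_sum : slit_plane (1 + r * f t)%C) by (apply slit_plane_affine; auto; lra).
  evar_last.
  - apply is_derive_Clog; [exact slit_sum|].
    apply is_derive_Cplus; [apply is_derive_Cconst | apply is_derive_Cscal, der_f].
  - cbv beta. field. auto using slit_plane_neq_0.
Qed.

Lemma is_derive_Clog_1_plus_div (f : R -> C) (t r : R) (d : C) :
  0 <= r -> slit_plane (f t) -> is_derive f t d ->
  is_derive (fun s => Clog (1 + r / f s)) t (- (d / f t * (r / (f t + r))))%C.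
Proof.
  intros r_nonneg slit_ft der_f.
  assert (slit_sum : slit_plane (f t + r)%C) by (apply slit_plane_plus; auto).
  assert (der_shift : is_derive (fun s => f s + r)%C t d).
  { evar_last; [apply is_derive_Cplus; [exact der_f | apply is_derive_Cconst] | apply Cplus_0_r]. }
  assert (der_diff := is_derive_Cminus _ _ t _ _ (is_derive_Clog _ t d slit_sum der_shift)
    (is_derive_Clog f t d slit_ft der_f)).
  replace (- (d / f t * (r / (f t + r))))%C with (d / (f t + r) - d / f t)%C
    by (field; auto using slit_plane_neq_0).
  apply is_derive_ext_loc with (2 := der_diff).
  generalize (slit_plane_locally f t d der_f slit_ft). apply filter_imp.
  intros s slit_fs. symmetry. apply Clog_1_plus_div; assumption.
Qed.

Lemma psum_Clog_dual_pole (N : nat) (x : C) (a t : R) : (0 < N)%nat -> slit_plane x ->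
  0 < a -> 0 <= t ->
  psum (fun l => Clog (dual_pole N x a l + t)) N = Clog (a / x + (t ^ N)%R) :> C.
Proof.
  intros N_pos slit_x a_pos t_nonneg. assert (INR_N_nz : INR N <> 0) by (apply not_0_INR; lia).
  set (f := fun s : R => (psum (fun l => Clog (dual_pole N x a l + s * 1)) N
    - Clog (a / x + (s ^ N)%R))%C).
  assert (slit_right : forall s, 0 <= s -> slit_plane (a / x + (s ^ N)%R)%C).
  { intros s s_nonneg. apply slit_plane_plus; [apply pow_le, s_nonneg|].
    apply slit_plane_div; assumption. }
  assert (f_const : f t = f 0).
  { apply is_derive_0_const; [exact t_nonneg|]. intros s s_in.
    assert (right_nz := slit_plane_neq_0 _ (slit_right s (proj1 s_in))).
    evar_last.
    - apply is_derive_Cminus.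
      + apply (is_derive_psum (fun l s => Clog (dual_pole N x a l + s * 1))
          (fun l => 1 / (dual_pole N x a l + s * 1))%C).
        intros l l_lt. apply is_derive_Clog_line. rewrite Cmult_1_r.
        apply slit_plane_plus; [lra | apply slit_plane_dual_pole; assumption].
      + apply is_derive_Clog; [apply slit_right; lra|].
        apply is_derive_Cplus; [apply is_derive_Cconst|].
        apply is_derive_RtoC, is_derive_pow, @is_derive_id.
    - rewrite (psum_Cext _ (fun l => dual_weight 1 N l / (s + dual_pole N x a l))%C)
        by (intros; rewrite dual_weight_1, Cmult_1_r, Cplus_comm; reflexivity).
      rewrite psum_dual_weight_inv by (auto; try lia; lra).
      simpl (1 - 1)%nat. simpl (INR 1). rewrite Rminus_diag, Rdiv_0_l.
      replace (N - 1)%nat with (Nat.pred N) by lia.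
      rewrite Rpower_O, <- !RtoC_pow, !RtoC_mult, (Cplus_comm (RtoC (s ^ N))) by exact a_pos.
      unfold one; simpl. set (den := (a / x + (s ^ N)%R)%C) in *. field. exact right_nz. }
  apply Ceq_minus. transitivity (f t); [unfold f; rewrite Cmult_1_r; reflexivity|].
  rewrite f_const. unfold f.
  rewrite pow_i, Cplus_0_r, Clog_div by (assumption || lia).
  rewrite (psum_Cext _ (fun l => (1 / INR N)%R * (ln a - Clog x)
    - Ci * (PI / INR N)%R * sym_index N l)%C).
  - rewrite psum_Cminus, psum_Cconst.
    rewrite (psum_Cscal _ (fun l => RtoC (sym_index N l))), psum_sym_index.
    rewrite RtoC_div by exact INR_N_nz. field. apply RtoC_neq_0, INR_N_nz.
  - intros l l_lt. rewrite Cmult_0_l, Cplus_0_r. apply Clog_dual_pole; assumption.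
Qed.

Lemma shifted_harmonic_Clog_remainder (c : R) (y : C) (n : nat) : slit_plane y -> cone_bound c y ->
  Cmod (shifted_harmonic y n - (Clog (y + INR n) - Clog y)) <= 2 * (/ c ^ 2 * / Cmod y).
Proof.
  intros slit_y cone_y. assert (y_pos := slit_plane_Cmod_pos y slit_y).
  assert (inv_c_pos : 0 < / c ^ 2) by (apply Rinv_0_lt_compat, pow_lt, cone_y).
  assert (gap_le := Cmod_digamma_gap_le c y slit_y cone_y).
  assert (remainder := proj2 (digamma_succ_lim_remainder c y slit_y cone_y) n).
  replace (shifted_harmonic y n - (Clog (y + INR n) - Clog y))%C with
    ((digamma_succ y - (Clog (y + INR n) - shifted_harmonic y n)) - digamma_gap y)%C
    by (unfold digamma_gap; ring).
  eapply Rle_trans; [apply Cmod_triangle|]. rewrite Cmod_opp.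
  assert (inv_le : / (Cmod y + INR n) <= / Cmod y).
  { apply Rinv_le_contravar; auto. generalize (pos_INR n). lra. }
  apply (Rmult_le_compat_l (/ c ^ 2)) in inv_le; lra.
Qed.

(* As [P] tends to infinity, the two [psum]s tend to [- Li2 (- z) / N] and [- Li2 (- 1 / z)]. *)
Definition log_riemann_sum (N P : nat) (z : C) : C :=
  (psum (fun i => / INR (S i) * Clog (1 + ((INR (S i) / INR P) ^ N)%R * z)) P
   + / INR N * psum (fun i => / INR (S i) * Clog (1 + (INR (S i) / INR P ^ N)%R / z)) (P ^ N))%C.

Definition log_riemann_slope (N P : nat) (z : C) : C :=
  (/ INR N * (psum (fun l => shifted_harmonic (dual_pole N z (INR P ^ N) l) P) N
    - shifted_harmonic ((INR P ^ N)%R * z) (P ^ N)))%C.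

Section LogRiemannSum.

Variables N P : nat.
Hypothesis N_pos : (0 < N)%nat.
Hypothesis P_pos : (0 < P)%nat.

Let INR_N_ge_1 : 1 <= INR N.
Proof. apply (le_INR 1), N_pos. Qed.

Let INR_N_neq_0_C : RtoC (INR N) <> RtoC 0.
Proof. apply RtoC_neq_0. lra. Qed.

Let INR_P_ge_1 : 1 <= INR P.
Proof. apply (le_INR 1), P_pos. Qed.

Let power_ge : INR P <= INR P ^ N.
Proof.
  rewrite <- (pow_1 (INR P)) at 1. apply Rle_pow; [exact INR_P_ge_1 | exact N_pos].
Qed.

Lemma Rpower_INR_pow_inv : Rpower (INR P ^ N) (1 / INR N) = INR P.
Proof.
  rewrite <- Rpower_pow, Rpower_mult by lra.
  replace (INR N * (1 / INR N)) with 1 by (field; lra). apply Rpower_1. lra.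
Qed.

Lemma psum_shifted_harmonic_dual_pole (z : C) : slit_plane z ->
  (/ INR N * psum (fun l => shifted_harmonic (dual_pole N z (INR P ^ N) l) P) N)%C =
  psum (fun i => / INR (S i) * (((INR (S i) / INR P) ^ N)%R * z /
    (1 + ((INR (S i) / INR P) ^ N)%R * z)))%C P.
Proof.
  intros slit_z.
  rewrite (psum_Cext (fun l => shifted_harmonic _ P)
    (fun l => dual_weight 1 N l * shifted_harmonic (dual_pole N z (INR P ^ N) l) P)%C)
    by (intros; rewrite dual_weight_1; ring).
  rewrite psum_dual_weight_shifted_harmonic by (assumption || lia || lra).
  replace ((INR N + INR 1 - 1) / INR N) with 1 by (simpl (INR 1); field; lra).
  rewrite Rpower_1 by lra. rewrite <- !psum_Cscal. apply psum_Cext. intros i _.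
  assert (i_pos := INR_S_pos i). assert (iC_nz := INR_S_neq_0_C i).
  assert (powerC_nz : RtoC (INR P ^ N) <> RtoC 0) by (apply RtoC_neq_0; lra).
  assert (ratio_nonneg : 0 <= (INR (S i) / INR P) ^ N)
    by (apply pow_le, Rlt_le, Rdiv_lt_0_compat; lra).
  assert (den_nz : (1 + ((INR (S i) / INR P) ^ N)%R * z)%C <> RtoC 0)
    by (apply slit_plane_neq_0, slit_plane_affine; auto; lra).
  replace ((INR (S i) / INR P) ^ N) with (INR (S i) ^ N / INR P ^ N) in *
    by (unfold Rdiv; rewrite Rpow_mult_distr, pow_inv; reflexivity).
  unfold herglotz_kernel. rewrite RtoC_div, (RtoC_pow (INR (S i))) in * by lra.
  replace (INR (S i) ^ N)%C with (INR (S i) * INR (S i) ^ (N - 1))%C in *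
    by (rewrite <- Cpow_S; f_equal; lia).
  simpl (1 - 1)%nat. simpl (Cpow _ 0).
  set (power := RtoC (INR P ^ N)) in *. set (b := RtoC (INR (S i))) in *.
  assert (den_mult_nz : (power + b * b ^ (N - 1) * z)%C <> RtoC 0).
  { intros E. apply den_nz.
    replace (1 + b * b ^ (N - 1) / power * z)%C with ((power + b * b ^ (N - 1) * z) / power)%C
      by (field; exact powerC_nz).
    rewrite E. unfold Cdiv. ring. }
  field. repeat split; auto using slit_plane_neq_0.
Qed.

Lemma is_derive_log_riemann_sum (f : R -> C) (t : R) (d : C) :
  slit_plane (f t) -> is_derive f t d ->
  is_derive (fun s => log_riemann_sum N P (f s)) t (d / f t * log_riemann_slope N P (f t))%C.
Proof.
  intros slit_ft der_f. assert (ft_nz := slit_plane_neq_0 _ slit_ft).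
  set (r := fun i => (INR (S i) / INR P) ^ N). set (q := fun i => INR (S i) / INR P ^ N).
  assert (r_nonneg : forall i, 0 <= r i)
    by (intros; apply pow_le, Rlt_le, Rdiv_lt_0_compat; [apply INR_S_pos | lra]).
  assert (q_nonneg : forall i, 0 <= q i)
    by (intros; apply Rlt_le, Rdiv_lt_0_compat; [apply INR_S_pos | lra]).
  assert (der_first := is_derive_psum (fun i s => / INR (S i) * Clog (1 + r i * f s))%C _ t P
    (fun i _ => is_derive_Cscal _ _ _ _
      (is_derive_Clog_1_plus_scal f t (r i) d (r_nonneg i) slit_ft der_f))).
  assert (der_second := is_derive_psum (fun i s => / INR (S i) * Clog (1 + q i / f s))%C _ t (P ^ N)
    (fun i _ => is_derive_Cscal _ _ _ _
      (is_derive_Clog_1_plus_div f t (q i) d (q_nonneg i) slit_ft der_f))).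
  assert (der_sum := is_derive_Cplus _ _ t _ _ der_first
    (is_derive_Cscal (/ INR N) _ t _ der_second)).
  evar_last; [exact der_sum|]. clear der_first der_second der_sum.
  unfold log_riemann_slope. unfold Cminus.
  rewrite !Cmult_plus_distr_l, psum_shifted_harmonic_dual_pole by exact slit_ft. f_equal.
  - rewrite <- psum_Cscal. apply psum_Cext. intros i _. unfold r. ring.
  - replace (d / f t * (/ INR N * - shifted_harmonic ((INR P ^ N)%R * f t) (P ^ N)))%C
      with (/ INR N * (- (d / f t) * shifted_harmonic ((INR P ^ N)%R * f t) (P ^ N)))%C by ring.
    f_equal. unfold shifted_harmonic. rewrite <- psum_Cscal. apply psum_Cext. intros i _.
    assert (powerC_nz : RtoC (INR P ^ N) <> RtoC 0) by (apply RtoC_neq_0; lra).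
    assert (sum_nz : (f t + q i)%C <> RtoC 0) by (apply slit_plane_neq_0, slit_plane_plus; auto).
    unfold q in *. rewrite RtoC_div in * by lra.
    replace ((INR P ^ N)%R * f t + INR (S i))%C
      with ((INR P ^ N)%R * (f t + INR (S i) / (INR P ^ N)%R))%C by (field; exact powerC_nz).
    set (sum := (f t + INR (S i) / (INR P ^ N)%R)%C) in *. field.
    auto using INR_S_neq_0_C.
Qed.

End LogRiemannSum.

Definition cone_bound_away (c e : R) (z : C) : Prop := cone_bound c z /\ e <= Cmod z.

Lemma cone_bound_away_Cexp (alpha rho : R) (w : C) :
  Rabs (Im w) <= alpha -> alpha < PI -> Rabs (Re w) <= rho ->
  cone_bound_away ((1 + cos alpha) / 2) (exp (- rho)) (Cexp w).
Proof.
  intros im_le alpha_lt re_le. split; [apply cone_bound_Cexp; assumption|].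
  rewrite Cmod_Cexp. apply exp_le. apply Rabs_le_between in re_le. lra.
Qed.

Lemma shifted_harmonic_Clog_remainder_away (c e p : R) (y : C) (n : nat) :
  slit_plane y -> cone_bound c y -> 0 < e -> 0 < p -> e * p <= Cmod y ->
  Cmod (shifted_harmonic y n - (Clog (y + INR n) - Clog y)) <= 2 * (/ (c ^ 2 * e) * / p).
Proof.
  intros slit_y cone_y e_pos p_pos y_ge.
  assert (c_pos : 0 < c) by apply cone_y. assert (ep_pos : 0 < e * p) by nra.
  eapply Rle_trans; [apply (shifted_harmonic_Clog_remainder c y n); assumption|].
  apply Rmult_le_compat_l; [lra|].
  replace (/ (c ^ 2 * e) * / p) with (/ c ^ 2 * / (e * p)) by (rewrite !Rinv_mult; ring).
  apply Rmult_le_compat_l; [apply Rlt_le, Rinv_0_lt_compat, pow_lt, c_pos|].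
  apply Rinv_le_contravar; assumption.
Qed.

Lemma psum_Clog_dual_pole_increment (N P : nat) (z : C) :
  (0 < N)%nat -> (0 < P)%nat -> slit_plane z ->
  psum (fun l => Clog (dual_pole N z (INR P ^ N) l + INR P)
    - Clog (dual_pole N z (INR P ^ N) l))%C N = Clog (1 + z) :> C.
Proof.
  intros N_pos P_pos slit_z. assert (INR_P_pos := lt_0_INR P P_pos).
  assert (power_pos : 0 < INR P ^ N) by (apply pow_lt, INR_P_pos).
  set (Q := INR P ^ N) in *. assert (QC_nz : RtoC Q <> RtoC 0) by (apply RtoC_neq_0; lra).
  rewrite psum_Cminus.
  rewrite (psum_Cext (fun l => Clog (dual_pole N z Q l)) (fun l => Clog (dual_pole N z Q l + 0)))
    by (intros; rewrite Cplus_0_r; reflexivity).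
  rewrite !psum_Clog_dual_pole, pow_i, Cplus_0_r by (auto; lra || lia). fold Q.
  rewrite <- Clog_1_plus_div by (try apply slit_plane_div; auto; lra).
  f_equal. field. auto using slit_plane_neq_0.
Qed.

Lemma Clog_scal_plus_increment (q : R) (z : C) : 0 < q -> slit_plane z ->
  (Clog (q * z + q) - Clog (q * z))%C = (Clog (1 + z) - Clog z)%C.
Proof.
  intros q_pos slit_z. assert (qC_nz : RtoC q <> RtoC 0) by (apply RtoC_neq_0; lra).
  rewrite <- Clog_1_plus_div by (try apply slit_plane_scal; auto; lra).
  replace (q / (q * z))%C with (1 / z)%C by (field; auto using slit_plane_neq_0).
  rewrite Clog_1_plus_div, Cplus_comm by (auto; lra). reflexivity.
Qed.

Lemma Cmod_log_riemann_slope_le (N P : nat) (c e : R) (z : C) :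
  (0 < N)%nat -> (0 < P)%nat -> slit_plane z -> 0 < e -> cone_bound_away c e z ->
  (forall l, (l < N)%nat -> cone_bound_away c e (dual_point N z l)) ->
  Cmod (log_riemann_slope N P z - / INR N * Clog z) <= 4 * / (c ^ 2 * e) * / INR P.
Proof.
  intros N_pos P_pos slit_z e_pos [cone_z z_ge] cone_dual.
  assert (INR_N_ge_1 : 1 <= INR N) by (apply (le_INR 1), N_pos).
  assert (INR_P_ge_1 : 1 <= INR P) by (apply (le_INR 1), P_pos).
  assert (NC_nz : RtoC (INR N) <> RtoC 0) by (apply RtoC_neq_0; lra).
  assert (power_ge : INR P <= INR P ^ N)
    by (rewrite <- (pow_1 (INR P)) at 1; apply Rle_pow; assumption).
  assert (root := Rpower_INR_pow_inv N P N_pos P_pos).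
  assert (power_C : INR (P ^ N) = INR P ^ N) by apply pow_INR.
  unfold log_riemann_slope. set (Q := INR P ^ N) in *.
  set (B := / (c ^ 2 * e) * / INR P).
  assert (dual_le : Cmod (psum (fun l => shifted_harmonic (dual_pole N z Q l) P) N - Clog (1 + z))
    <= INR N * (2 * B)).
  { rewrite <- (psum_Clog_dual_pole_increment N P z N_pos P_pos slit_z). fold Q.
    rewrite <- psum_Cminus, <- psum_Rconst. apply Cmod_psum_le. intros l l_lt.
    destruct (cone_dual l l_lt) as [cone_l l_ge].
    apply shifted_harmonic_Clog_remainder_away; auto using slit_plane_dual_pole; try lra.
    - apply cone_bound_scal; auto using Rpower_pos.
    - unfold dual_pole. rewrite root, Cmod_mult, Cmod_R, Rabs_pos_eq by lra. nra. }
  assert (direct_le : Cmod (shifted_harmonic (Q * z) (P ^ N) - (Clog (1 + z) - Clog z)) <= 2 * B).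
  { rewrite <- (Clog_scal_plus_increment Q z) by (assumption || lra). rewrite <- power_C.
    apply shifted_harmonic_Clog_remainder_away; try lra.
    - apply slit_plane_scal; auto; lra.
    - apply cone_bound_scal; auto; lra.
    - rewrite Cmod_mult, Cmod_R, Rabs_pos_eq by lra. nra. }
  set (dual := psum (fun l => shifted_harmonic (dual_pole N z Q l) P) N : C) in *.
  set (direct := shifted_harmonic (Q * z) (P ^ N)) in *.
  replace (/ INR N * (dual - direct) - / INR N * Clog z)%C with
    (/ INR N * ((dual - Clog (1 + z)) - (direct - (Clog (1 + z) - Clog z))))%C by ring.
  rewrite Cmod_mult, Cmod_inv, Cmod_R, Rabs_pos_eq by (exact NC_nz || lra).
  apply Rmult_le_reg_l with (INR N); [lra|].
  rewrite <- Rmult_assoc, Rinv_r, Rmult_1_l, (Rmult_assoc 4) by lra. fold B.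
  assert (B_nonneg : 0 <= B) by (generalize (Cmod_ge_0 (direct - (Clog (1 + z) - Clog z))); lra).
  eapply Rle_trans; [apply Cmod_triangle|]. rewrite Cmod_opp. nra.
Qed.

Lemma cone_bound_away_segment (N : nat) (L : C) : (0 < N)%nat -> Rabs (Im L) < PI ->
  exists c e, 0 < e /\ forall s, 0 <= s <= 1 ->
    cone_bound_away c e (Cexp (s * L)) /\
    forall l, (l < N)%nat -> cone_bound_away c e (dual_point N (Cexp (s * L)) l).
Proof.
  intros N_pos im_lt. assert (INR_N_ge_1 : 1 <= INR N) by (apply (le_INR 1), N_pos).
  set (alpha := (Rabs (Im L) + (INR N - 1) * PI) / INR N).
  assert (alpha_lt : alpha < PI) by (apply Rlt_div_l; lra).
  assert (im_le_alpha : Rabs (Im L) <= alpha) by (apply Rle_div_r; nra).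
  exists ((1 + cos alpha) / 2), (exp (- Rabs (Re L))). split; [apply exp_pos|]. intros s s_in.
  assert (scaled_im_le : Rabs (Im (s * L)) <= Rabs (Im L)).
  { rewrite im_scal_l, Rabs_mult, (Rabs_pos_eq s) by lra. generalize (Rabs_pos (Im L)). nra. }
  assert (scaled_re_le : Rabs (Re (s * L)) <= Rabs (Re L)).
  { rewrite re_scal_l, Rabs_mult, (Rabs_pos_eq s) by lra. generalize (Rabs_pos (Re L)). nra. }
  split; [apply cone_bound_away_Cexp; lra|]. intros l l_lt.
  assert (log_eq : Clog (Cexp (s * L)) = (s * L)%C) by (apply Clog_Cexp; lra).
  rewrite dual_point_Cexp. apply cone_bound_away_Cexp; [|exact alpha_lt|].
  - eapply Rle_trans; [apply Rabs_Im_dual_log_le; assumption|]. rewrite log_eq.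
    apply Rmult_le_compat_r; [apply Rlt_le, Rinv_0_lt_compat; lra | lra].
  - rewrite Re_dual_log, log_eq, Rabs_Ropp by assumption.
    eapply Rle_trans; [|exact scaled_re_le].
    unfold Rdiv. rewrite Rabs_mult, (Rabs_pos_eq (/ INR N))
      by (apply Rlt_le, Rinv_0_lt_compat; lra).
    apply Rle_div_l; [lra|]. generalize (Rabs_pos (Re (s * L))). nra.
Qed.

(* Along [s -> exp (s log x)] the derivative of the sum tends to [s (log x)^2 / N]. *)
Lemma log_riemann_sum_minus_1_lim (N : nat) (x : C) : (0 < N)%nat -> slit_plane x ->
  is_Clim_seq (fun p => log_riemann_sum N (S p) x - log_riemann_sum N (S p) 1)%C
    (/ INR N * (Clog x ^ 2 / 2))%C.
Proof.
  intros N_pos slit_x. set (L := Clog x).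
  assert (NC_nz : RtoC (INR N) <> RtoC 0) by (apply RtoC_neq_0, not_0_INR; lia).
  assert (im_lt : Rabs (Im L) < PI) by (apply Im_Clog_lt, slit_x).
  destruct (cone_bound_away_segment N L N_pos im_lt) as [c [e [e_pos path_bounds]]].
  apply is_Clim_seq_bound with (fun p => (Cmod L * (4 * / (c ^ 2 * e))) * / INR (S p)).
  2:{ apply is_lim_seq_scal_0, is_lim_seq_inv_INR_S. }
  intros p. set (z := fun s : R => Cexp (0 + s * L)).
  set (f := fun s : R => (log_riemann_sum N (S p) (z s) - (s * s)%R * (/ INR N * (L ^ 2 / 2)))%C).
  assert (z_scal : forall s, z s = Cexp (s * L))
    by (intros; unfold z; rewrite Cplus_0_l; reflexivity).
  replace (log_riemann_sum N (S p) x - log_riemann_sum N (S p) 1 - / INR N * (L ^ 2 / 2))%C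
    with (f 1 - f 0)%C.
  2:{ unfold f. rewrite !z_scal, Cmult_0_l, Cmult_1_l, Cexp_0, Rmult_1_l, Rmult_0_l.
      unfold L at 1. rewrite Cexp_Clog by exact slit_x. ring. }
  eapply Rle_trans; [apply (Cmod_mean_value f
    (fun s => L * (log_riemann_slope N (S p) (z s) - / INR N * Clog (z s)))%C 0 1
    (Cmod L * (4 * / (c ^ 2 * e)) * / INR (S p)))|]; try lra; intros s s_in.
  - assert (scaled_im_lt : Rabs (Im (s * L)) < PI).
    { rewrite im_scal_l, Rabs_mult, (Rabs_pos_eq s) by lra. generalize (Rabs_pos (Im L)). nra. }
    assert (slit_zs : slit_plane (z s)) by (rewrite z_scal; apply slit_plane_Cexp, scaled_im_lt).
    evar_last.
    + apply is_derive_Cminus.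
      * apply is_derive_log_riemann_sum; [exact N_pos | lia | exact slit_zs|].
        apply is_derive_Cexp, is_derive_Cline.
      * apply is_derive_Cmult; [|apply is_derive_Cconst].
        apply is_derive_RtoC, is_derive_Rmult; apply @is_derive_id.
    + cbv beta. fold (z s). rewrite (z_scal s), (Clog_Cexp (s * L)) by exact scaled_im_lt.
      rewrite RtoC_plus, !RtoC_mult. unfold one; simpl.
      assert (z_nz := Cexp_neq_0 (s * L)). field. auto.
  - destruct (path_bounds s s_in) as [cone_z cone_dual]. rewrite <- z_scal in *.
    rewrite Cmod_mult, Rmult_assoc. apply Rmult_le_compat_l; [apply Cmod_ge_0|].
    apply Cmod_log_riemann_slope_le; auto; [lia|].
    rewrite z_scal. apply slit_plane_Cexp.
    rewrite im_scal_l, Rabs_mult, (Rabs_pos_eq s) by lra. generalize (Rabs_pos (Im L)). nra.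
Qed.

Definition ln_riemann_sum (a P : nat) : R :=
  psum (fun i => / INR (S i) * ln (1 + (INR (S i) / INR P) ^ a)) P.

Lemma INR_S_div_nonneg (i P : nat) : (0 < P)%nat -> 0 <= INR (S i) / INR P.
Proof.
  intros P_pos. apply Rlt_le, Rdiv_lt_0_compat; [apply INR_S_pos | apply lt_0_INR, P_pos].
Qed.

Lemma log_riemann_sum_1 (N P : nat) : (0 < N)%nat -> (0 < P)%nat ->
  log_riemann_sum N P 1 = RtoC (ln_riemann_sum N P + / INR N * ln_riemann_sum 1 (P ^ N)).
Proof.
  intros N_pos P_pos. unfold log_riemann_sum, ln_riemann_sum.
  rewrite RtoC_plus, RtoC_mult, RtoC_inv, <- !psum_RtoC by (apply not_0_INR; lia).
  assert (summand : forall (i : nat) (r : R), 0 <= r ->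
    (/ INR (S i) * Clog (1 + r))%C = RtoC (/ INR (S i) * ln (1 + r))).
  { intros i r r_nonneg.
    rewrite <- RtoC_plus, Clog_RtoC, RtoC_mult, RtoC_inv by (lra || apply not_0_INR; lia).
    reflexivity. }
  f_equal; [|f_equal]; apply psum_Cext; intros i _.
  - rewrite Cmult_1_r. apply summand, pow_le, INR_S_div_nonneg, P_pos.
  - rewrite <- pow_INR, pow_1. unfold Cdiv.
    replace (/ 1)%C with (RtoC 1) by field. rewrite Cmult_1_r.
    apply summand, INR_S_div_nonneg. apply Nat.neq_0_lt_0, Nat.pow_nonzero. lia.
Qed.

Lemma slit_plane_Ci : slit_plane Ci.
Proof. intros [im_0 _]. simpl in im_0. lra. Qed.

Lemma Clog_Ci : Clog Ci = (Ci * (PI / 2)%R)%C.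
Proof.
  assert (PI_pos := PI_RGT_0). replace Ci with (Cexp (Ci * (PI / 2)%R)) at 1.
  - apply Clog_Cexp. replace (Im (Ci * (PI / 2)%R)) with (PI / 2) by (simpl; ring).
    rewrite Rabs_pos_eq; lra.
  - rewrite <- cis_Cexp. unfold cis. rewrite cos_PI2, sin_PI2. reflexivity.
Qed.

Lemma Clog_opp_Ci : Clog (- Ci) = (- (Ci * (PI / 2)%R))%C.
Proof. rewrite <- Ci_inv, Clog_inv, Clog_Ci by apply slit_plane_Ci. reflexivity. Qed.

Lemma slit_plane_opp_Ci : slit_plane (- Ci)%C.
Proof. rewrite <- Ci_inv. apply slit_plane_inv, slit_plane_Ci. Qed.

Lemma Clog_1_plus_mult_Ci (r : R) :
  (Clog (1 + r * Ci) + Clog (1 + r * - Ci))%C = RtoC (ln (1 + r ^ 2)).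
Proof.
  assert (slit_sum : slit_plane (1 + r * Ci)%C).
  { intros [_ re_le]. rewrite re_plus, re_scal_l in re_le. simpl in re_le. lra. }
  replace (1 + r * - Ci)%C with (Cconj (1 + r * Ci)) by (apply C_eq_Re_Im; simpl; ring).
  rewrite Clog_plus_Clog_Cconj by exact slit_sum. f_equal.
  replace (1 + r ^ 2) with (Cmod (1 + r * Ci) ^ 2).
  - rewrite ln_pow by apply slit_plane_Cmod_pos, slit_sum. simpl (INR 2). ring.
  - rewrite Cmod2_alt, re_plus, im_plus, re_scal_l, im_scal_l. simpl. ring.
Qed.

Lemma log_riemann_sum_Ci (N P : nat) : (0 < N)%nat ->
  (log_riemann_sum N P Ci + log_riemann_sum N P (- Ci))%C =
  RtoC (ln_riemann_sum (2 * N) P + / INR N * ln_riemann_sum 2 (P ^ N)).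
Proof.
  intros N_pos. assert (INR_N_nz : INR N <> 0) by (apply not_0_INR; lia).
  assert (sum_pair : forall (r : nat -> R) n,
    (psum (fun i => / INR (S i) * Clog (1 + r i * Ci)) n
      + psum (fun i => / INR (S i) * Clog (1 + r i * - Ci)) n)%C =
    RtoC (psum (fun i => / INR (S i) * ln (1 + r i ^ 2)) n)).
  { intros r n. rewrite <- psum_Cplus, <- psum_RtoC. apply psum_Cext. intros i _.
    rewrite <- Cmult_plus_distr_l, Clog_1_plus_mult_Ci, RtoC_mult, RtoC_inv;
      [reflexivity | apply not_0_INR; lia]. }
  assert (even_power : ln_riemann_sum (2 * N) P =
    psum (fun i => / INR (S i) * ln (1 + ((INR (S i) / INR P) ^ N) ^ 2)) P).
  { apply psum_ext. intros i _. rewrite <- pow_mult, Nat.mul_comm. reflexivity. }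
  rewrite even_power. unfold log_riemann_sum, ln_riemann_sum, Cdiv.
  replace (/ - Ci)%C with Ci by (rewrite <- Ci_inv; field; auto using Ci_nz).
  rewrite Ci_inv, pow_INR, RtoC_plus, RtoC_mult, RtoC_inv, <- !sum_pair by exact INR_N_nz.
  ring.
Qed.

Lemma log_riemann_sum_Ci_minus_1_lim (N : nat) : (0 < N)%nat ->
  is_lim_seq (fun p =>
    ln_riemann_sum (2 * N) (S p) + / INR N * ln_riemann_sum 2 (S p ^ N)
    - 2 * (ln_riemann_sum N (S p) + / INR N * ln_riemann_sum 1 (S p ^ N)))
    (- (PI ^ 2 / (4 * INR N))).
Proof.
  intros N_pos. assert (INR_N_nz : INR N <> 0) by (apply not_0_INR; lia).
  assert (lim_sum := is_Clim_seq_plus _ _ _ _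
    (log_riemann_sum_minus_1_lim N Ci N_pos slit_plane_Ci)
    (log_riemann_sum_minus_1_lim N (- Ci)%C N_pos slit_plane_opp_Ci)).
  apply is_Clim_seq_Re_Im, proj1 in lim_sum.
  replace (- (PI ^ 2 / (4 * INR N))) with
    (Re (/ INR N * (Clog Ci ^ 2 / 2) + / INR N * (Clog (- Ci) ^ 2 / 2))).
  - apply is_lim_seq_ext with (2 := lim_sum). intros p.
    rewrite <- (re_RtoC (_ - _)). f_equal.
    rewrite RtoC_minus, RtoC_mult, <- log_riemann_sum_Ci, <- log_riemann_sum_1 by lia. ring.
  - rewrite Clog_opp_Ci, Clog_Ci, <- (re_RtoC (- _)). f_equal.
    assert (Ci_sqr : (Ci * Ci)%C = (- RtoC 1)%C) by (apply C_eq_Re_Im; simpl; ring).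
    replace ((- (Ci * (PI / 2)%R)) ^ 2)%C with (Ci * Ci * ((PI / 2) ^ 2)%R)%C
      by (rewrite RtoC_pow; ring).
    replace ((Ci * (PI / 2)%R) ^ 2)%C with (Ci * Ci * ((PI / 2) ^ 2)%R)%C
      by (rewrite RtoC_pow; ring).
    rewrite Ci_sqr, RtoC_opp, <- RtoC_inv by exact INR_N_nz.
    replace (PI ^ 2 / (4 * INR N)) with (/ INR N * (PI / 2) ^ 2) by (field; exact INR_N_nz).
    rewrite RtoC_mult. field.
Qed.

Lemma filterlim_S_pow (N : nat) : (0 < N)%nat ->
  filterlim (fun p => S p ^ N)%nat eventually eventually.
Proof.
  intros N_pos A [n0 A_n0]. exists n0. intros p n0_le. apply A_n0.
  apply Nat.le_trans with (S p ^ 1)%nat; [rewrite Nat.pow_1_r; lia|].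
  apply Nat.pow_le_mono_r; lia.
Qed.

Lemma is_lim_seq_S_pow (u : nat -> R) (l : R) (N : nat) : (0 < N)%nat ->
  is_lim_seq (fun n => u (S n)) l -> is_lim_seq (fun p => u (S p ^ N)%nat) l.
Proof.
  intros N_pos lim_u. apply (is_lim_seq_subseq u l (fun p => S p ^ N)%nat).
  - apply filterlim_S_pow, N_pos.
  - apply is_lim_seq_incr_1, lim_u.
Qed.

Lemma ln_riemann_sum_double_lim (a : nat) : (0 < a)%nat ->
  is_lim_seq (fun p => ln_riemann_sum (2 * a) (S p) - 2 * ln_riemann_sum a (S p))
    (- (PI ^ 2 / (8 * INR a))).
Proof.
  intros a_pos. assert (INR_a_nz : INR a <> 0) by (apply not_0_INR; lia).
  assert (lim_base : is_lim_seq (fun P => ln_riemann_sum 2 (S P) - 2 * ln_riemann_sum 1 (S P))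
    (- (PI ^ 2 / 8))).
  { assert (lim_1 := log_riemann_sum_Ci_minus_1_lim 1 ltac:(lia)).
    replace (- (PI ^ 2 / 8)) with (/ 2 * - (PI ^ 2 / (4 * INR 1))) by (simpl (INR 1); field).
    apply is_lim_seq_ext with
      (2 := is_lim_seq_mult' _ _ _ _ (is_lim_seq_const (/ 2)) lim_1).
    intros p. rewrite Nat.pow_1_r. simpl (2 * 1)%nat. simpl (INR 1). field. }
  replace (- (PI ^ 2 / (8 * INR a)))
    with (- (PI ^ 2 / (4 * INR a)) - / INR a * - (PI ^ 2 / 8)) by (field; exact INR_a_nz).
  apply is_lim_seq_ext with (2 := is_lim_seq_minus' _ _ _ _
    (log_riemann_sum_Ci_minus_1_lim a a_pos)
    (is_lim_seq_mult' _ _ _ _ (is_lim_seq_const (/ INR a))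
      (is_lim_seq_S_pow (fun P => ln_riemann_sum 2 P - 2 * ln_riemann_sum 1 P) _ a a_pos
        lim_base))).
  intros p. ring.
Qed.

Lemma ln_riemann_sum_bounds (a P : nat) : (0 < a)%nat -> (0 < P)%nat ->
  0 <= ln_riemann_sum a P <= 1.
Proof.
  intros a_pos P_pos. assert (INR_P_pos := lt_0_INR P P_pos).
  assert (summand_bounds : forall i, (i < P)%nat ->
    0 <= / INR (S i) * ln (1 + (INR (S i) / INR P) ^ a) <= / INR P).
  { intros i i_lt. assert (i_pos := INR_S_pos i).
    assert (ratio_nonneg := INR_S_div_nonneg i P P_pos).
    assert (ratio_le_1 : INR (S i) / INR P <= 1).
    { apply Rle_div_l; [exact INR_P_pos|]. rewrite Rmult_1_l. apply le_INR, i_lt. }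
    replace (/ INR P) with (/ INR (S i) * (INR (S i) / INR P)) by (field; lra).
    set (r := INR (S i) / INR P) in *.
    assert (power_nonneg : 0 <= r ^ a) by (apply pow_le, ratio_nonneg).
    assert (power_le : r ^ a <= r).
    { replace a with (S (Nat.pred a)) by lia. simpl.
      assert (pred_power_le_1 : r ^ Nat.pred a <= 1)
        by (rewrite <- (pow1 (Nat.pred a)); apply pow_incr; lra).
      nra. }
    assert (inv_pos := Rinv_0_lt_compat _ i_pos). split.
    - apply Rmult_le_pos; [lra|]. rewrite <- ln_1. apply ln_le; lra.
    - apply Rmult_le_compat_l; [lra|]. generalize (ln_le_sub_1 (1 + r ^ a)). lra. }
  split.
  - apply psum_nonneg. apply summand_bounds.
  - replace 1 with (INR P * / INR P) by (field; lra). rewrite <- psum_Rconst.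
    apply psum_le. apply summand_bounds.
Qed.

(* Iterate [e_a = e_(2a) / 2 + o(1)]. *)
Lemma is_lim_seq_0_of_doubling (e : nat -> nat -> R) (M : R) :
  (forall a p, (0 < a)%nat -> Rabs (e a p) <= M) ->
  (forall a, (0 < a)%nat -> is_lim_seq (fun p => e (2 * a)%nat p - 2 * e a p) 0) ->
  forall a, (0 < a)%nat -> is_lim_seq (e a) 0.
Proof.
  intros e_le doubling a a_pos.
  assert (eventually_le : forall (eps : posreal) j b, (0 < b)%nat ->
    eventually (fun p => Rabs (e b p) <= M * / 2 ^ j + eps)).
  { intros eps j. induction j as [|j IHj]; intros b b_pos.
    - exists O. intros p _. simpl. rewrite Rinv_1, Rmult_1_r.
      generalize (e_le b p b_pos) (cond_pos eps). lra.
    - assert (small := doubling b b_pos). apply is_lim_seq_spec in small. specialize (small eps).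
      generalize (filter_and (F := eventually) _ _ (IHj (2 * b)%nat ltac:(lia)) small).
      apply filter_imp. intros p [double_le gap_lt]. rewrite Rminus_0_r in gap_lt.
      replace (e b p) with (/ 2 * (e (2 * b)%nat p - (e (2 * b)%nat p - 2 * e b p))) by field.
      rewrite Rabs_mult, (Rabs_pos_eq (/ 2)) by lra.
      assert (triangle := Rabs_triang (e (2 * b)%nat p) (- (e (2 * b)%nat p - 2 * e b p))).
      rewrite Rabs_Ropp in triangle. unfold Rminus at 1.
      replace (/ 2 ^ S j) with (/ 2 * / 2 ^ j) by (simpl; rewrite Rinv_mult; reflexivity).
      lra. }
  apply is_lim_seq_spec. intros eps.
  assert (geometric : is_lim_seq (fun j => M * / 2 ^ j) 0).
  { apply is_lim_seq_scal_0. apply is_lim_seq_ext with (fun j => (/ 2) ^ j);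
      [intros; apply pow_inv | apply is_lim_seq_geom; rewrite Rabs_pos_eq; lra]. }
  apply is_lim_seq_spec in geometric. assert (eps_pos := cond_pos eps).
  destruct (geometric (mkposreal (eps / 2) ltac:(lra))) as [j near_0].
  specialize (near_0 j (Nat.le_refl j)). simpl in near_0. rewrite Rminus_0_r in near_0.
  generalize (eventually_le (mkposreal (eps / 2) ltac:(lra)) j a a_pos). apply filter_imp.
  intros p e_a_le. simpl in e_a_le. rewrite Rminus_0_r.
  generalize (Rle_abs (M * / 2 ^ j)). lra.
Qed.

Lemma ln_riemann_sum_lim (a : nat) : (0 < a)%nat ->
  is_lim_seq (fun p => ln_riemann_sum a (S p)) (PI ^ 2 / (12 * INR a)).
Proof.
  intros a_pos.
  assert (lim_error : is_lim_seq (fun p => ln_riemann_sum a (S p) - PI ^ 2 / (12 * INR a)) 0).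
  2:{ replace (PI ^ 2 / (12 * INR a)) with (0 + PI ^ 2 / (12 * INR a)) by ring.
      apply is_lim_seq_ext with (2 := is_lim_seq_plus' _ _ _ _ lim_error
        (is_lim_seq_const (PI ^ 2 / (12 * INR a)))).
      intros p. ring. }
  apply (is_lim_seq_0_of_doubling
    (fun b p => ln_riemann_sum b (S p) - PI ^ 2 / (12 * INR b)) 2); [| |exact a_pos].
  - intros b p b_pos. assert (b_ge := le_INR 1 b b_pos). simpl in b_ge.
    assert (sum_bounds := ln_riemann_sum_bounds b (S p) b_pos ltac:(lia)).
    assert (limit_bounds : 0 <= PI ^ 2 / (12 * INR b) <= 2).
    { assert (PI_pos := PI_RGT_0). assert (PI_le := PI_4).
      split; [apply Rdiv_le_0_compat; nra | apply Rle_div_l; nra]. }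
    apply Rabs_le. lra.
  - intros b b_pos. assert (INR_b_nz : INR b <> 0) by (apply not_0_INR; lia).
    replace 0 with (- (PI ^ 2 / (8 * INR b)) - - (PI ^ 2 / (8 * INR b))) by ring.
    apply is_lim_seq_ext with (2 := is_lim_seq_minus' _ _ _ _
      (ln_riemann_sum_double_lim b b_pos) (is_lim_seq_const (- (PI ^ 2 / (8 * INR b))))).
    intros p. rewrite mult_INR. simpl (INR 2). field. exact INR_b_nz.
Qed.

Lemma log_riemann_sum_lim (N : nat) (x : C) : (0 < N)%nat -> slit_plane x ->
  is_Clim_seq (fun p => log_riemann_sum N (S p) x)
    (/ INR N * (PI ^ 2 / 6 + Clog x ^ 2 / 2))%C.
Proof.
  intros N_pos slit_x. assert (INR_N_nz : INR N <> 0) by (apply not_0_INR; lia).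
  apply filterlim_ext with (fun p => (log_riemann_sum N (S p) x - log_riemann_sum N (S p) 1)
    + RtoC (ln_riemann_sum N (S p) + / INR N * ln_riemann_sum 1 (S p ^ N)))%C.
  { intros p. rewrite <- log_riemann_sum_1 by lia. ring. }
  replace (/ INR N * (PI ^ 2 / 6 + Clog x ^ 2 / 2))%C with (/ INR N * (Clog x ^ 2 / 2)
    + RtoC (PI ^ 2 / (12 * INR N) + / INR N * (PI ^ 2 / (12 * INR 1))))%C.
  - apply is_Clim_seq_plus; [apply log_riemann_sum_minus_1_lim; assumption|].
    apply is_Clim_seq_RtoC, is_lim_seq_plus'; [apply ln_riemann_sum_lim, N_pos|].
    apply is_lim_seq_mult'; [apply is_lim_seq_const|].
    apply is_lim_seq_S_pow; [exact N_pos | apply ln_riemann_sum_lim; lia].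
  - replace (PI ^ 2 / (12 * INR N) + / INR N * (PI ^ 2 / (12 * INR 1)))
      with (/ INR N * (PI ^ 2 / 6)) by (simpl (INR 1); field; exact INR_N_nz).
    rewrite RtoC_mult, RtoC_inv, RtoC_div, RtoC_pow by (exact INR_N_nz || lra). ring.
Qed.

(** * The case [k = 1] *)

Definition ln_harmonic (n : nat) : R := psum (fun i => ln (INR (S i)) / INR (S i)) n.

Lemma ln_harmonic_S (n : nat) : ln_harmonic (S n) = ln_harmonic n + ln (INR (S n)) / INR (S n).
Proof. reflexivity. Qed.

Lemma psum_ln_div_INR (n : nat) :
  psum (fun i => ln (INR (S i)) / INR (S i))%C n = RtoC (ln_harmonic n) :> C.
Proof.
  unfold ln_harmonic. rewrite <- psum_RtoC. apply psum_Cext. intros i _.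
  rewrite RtoC_div; [reflexivity | apply Rgt_not_eq, INR_S_pos].
Qed.

Lemma ln_harmonic_increment_le (n : nat) :
  Rabs ((ln_harmonic (S (S n)) - ln (INR (S (S n))) ^ 2 / 2)
    - (ln_harmonic (S n) - ln (INR (S n)) ^ 2 / 2)) <=
  6 * Rpower (INR (S (S n))) (- (3 / 2)).
Proof.
  rewrite (ln_harmonic_S (S n)).
  assert (A_ge := INR_S_ge_1 n). assert (B_eq := S_INR (S n)).
  assert (ln_step := ln_INR_S_increment n).
  assert (b_nonneg := ln_INR_S_nonneg (S n)).
  assert (b_le := ln_le_Rpower (INR (S (S n))) (1 / 2) ltac:(lra)).
  assert (root_ge_1 : 1 <= Rpower (INR (S (S n))) (1 / 2)).
  { rewrite <- (Rpower_O (INR (S (S n)))) at 1 by lra. apply Rle_Rpower; lra. }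
  replace (Rpower (INR (S (S n))) (- (3 / 2)))
    with (Rpower (INR (S (S n))) (1 / 2) * / INR (S (S n)) ^ 2).
  2:{ rewrite <- Rpower_pow, <- Rpower_Ropp, <- Rpower_plus by apply INR_S_pos.
      f_equal. simpl. lra. }
  set (A := INR (S n)) in *. set (B := INR (S (S n))) in *.
  set (a := ln A) in *. set (b := ln B) in *. set (root := Rpower B (1 / 2)) in *.
  replace (ln_harmonic (S n) + b / B - b ^ 2 / 2 - (ln_harmonic (S n) - a ^ 2 / 2))
    with ((b - a) ^ 2 / 2 - b * ((b - a) - / B)) by (field; lra).
  assert (inv_A_le : / A <= 2 * / B).
  { replace (2 * / B) with (/ (B / 2)) by (field; lra). apply Rinv_le_contravar; lra. }
  assert (inv_diff_le : / A - / B <= 2 * (/ B * / B)).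
  { replace (/ A - / B) with (/ A * / B) by (rewrite B_eq; field; lra). nra. }
  replace (/ B ^ 2) with (/ B * / B) by (field; lra).
  assert (square_bounds : 0 <= (b - a) ^ 2 / 2 <= 2 * (root * (/ B * / B))).
  { assert (square_le : (b - a) ^ 2 <= (2 * / B) ^ 2) by (apply pow_incr; lra).
    assert (inv_sqr_le : / B * / B <= root * (/ B * / B)) by nra.
    split; [generalize (pow2_ge_0 (b - a)); lra | nra]. }
  assert (product_bounds : 0 <= b * (b - a - / B) <= 4 * (root * (/ B * / B))).
  { split; [apply Rmult_le_pos; lra|].
    apply Rle_trans with ((/ (1 / 2) * root) * (2 * (/ B * / B))); [|right; field; lra].
    apply Rmult_le_compat; lra. }
  apply Rabs_le. lra.
Qed.

Lemma stieltjes_gamma1_lim :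
  is_lim_seq (fun n => ln_harmonic (S n) - ln (INR (S n)) ^ 2 / 2) stieltjes_gamma1.
Proof.
  replace stieltjes_gamma1
    with (real (Lim_seq (fun n => ln_harmonic (S n) - ln (INR (S n)) ^ 2 / 2))).
  2:{ unfold stieltjes_gamma1. f_equal. etransitivity; [|apply Lim_seq_incr_1].
      apply Lim_seq_ext. intros n. f_equal.
      unfold ln_harmonic. apply (psum_sum_n_m (fun m => ln (INR m) / INR m)). }
  apply is_lim_seq_of_summable_increments with
    (fun n => 6 * Rpower (INR (S (S n))) (- (3 / 2))).
  - apply ln_harmonic_increment_le.
  - apply (ex_series_incr_1 (fun n => 6 * Rpower (INR (S n)) (- (3 / 2)))).
    apply ex_series_Rscal, ex_series_Rpower. lra.
Qed.

Lemma harmonic_nonneg (n : nat) : 0 <= harmonic n.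
Proof. apply psum_nonneg. intros i _. apply Rlt_le, Rinv_0_lt_compat, INR_S_pos. Qed.

Lemma harmonic_S_le_ln (n : nat) : harmonic (S n) <= 1 + ln (INR (S n)).
Proof.
  induction n as [|n IHn].
  - unfold harmonic. rewrite psum_S_R. simpl. rewrite Rinv_1, ln_1. unfold zero; simpl. lra.
  - rewrite harmonic_S. generalize (ln_INR_S_increment n). lra.
Qed.

Lemma is_lim_seq_ln_div_INR_S : is_lim_seq (fun n => ln (INR (S n)) / INR (S n)) 0.
Proof.
  apply (is_lim_comp_seq (fun y => ln y / y) (fun n => INR (S n)) p_infty).
  - apply is_lim_div_ln_p.
  - exists O. intros n _. discriminate.
  - apply (is_lim_seq_incr_1 INR), is_lim_seq_INR.
Qed.

Lemma is_lim_seq_harmonic_pow_div (N : nat) :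
  is_lim_seq (fun p => harmonic (S p ^ N) * / INR (S p)) 0.
Proof.
  apply is_lim_seq_squeeze_0 with (fun p => / INR (S p) + INR N * (ln (INR (S p)) / INR (S p))).
  - intros p. assert (P_pos := INR_S_pos p). assert (inv_P_pos := Rinv_0_lt_compat _ P_pos).
    split; [apply Rmult_le_pos; [apply harmonic_nonneg | lra]|].
    assert (power_pos : (0 < S p ^ N)%nat) by (apply Nat.neq_0_lt_0, Nat.pow_nonzero; lia).
    assert (harmonic_le := harmonic_S_le_ln (Nat.pred (S p ^ N))).
    rewrite Nat.succ_pred_pos, pow_INR, ln_pow in harmonic_le by assumption.
    apply (Rmult_le_compat_r (/ INR (S p))) in harmonic_le; [|lra]. unfold Rdiv. lra.
  - apply is_lim_seq_plus_0; [apply is_lim_seq_inv_INR_S|].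
    apply is_lim_seq_scal_0, is_lim_seq_ln_div_INR_S.
Qed.

Definition truncated_gap (y : C) (n : nat) : C :=
  (Clog (y + INR n) - Clog y - shifted_harmonic y n)%C.

Lemma Cmod_digamma_gap_minus_truncated_le (c : R) (y : C) (n : nat) :
  slit_plane y -> cone_bound c y -> (0 < n)%nat ->
  Cmod (digamma_gap y - truncated_gap y n) <= / c ^ 2 * / INR n.
Proof.
  intros slit_y cone_y n_pos.
  assert (remainder := proj2 (digamma_succ_lim_remainder c y slit_y cone_y) n).
  replace (digamma_gap y - truncated_gap y n)%C
    with (digamma_succ y - (Clog (y + INR n) - shifted_harmonic y n))%C
    by (unfold digamma_gap, truncated_gap; ring).
  eapply Rle_trans; [exact remainder|]. apply Rmult_le_compat_l.
  - apply Rlt_le, Rinv_0_lt_compat, pow_lt, cone_y.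
  - apply Rinv_le_contravar; [apply lt_0_INR, n_pos|]. generalize (Cmod_ge_0 y). lra.
Qed.

Lemma Cmod_psum_div_INR_le (a : nat -> C) (K : R) (n : nat) :
  (forall i, (i < n)%nat -> Cmod (a i) <= K) ->
  Cmod (psum (fun i => a i / INR (S i))%C n) <= K * harmonic n.
Proof.
  intros a_le. unfold harmonic. rewrite <- psum_Rscal. apply Cmod_psum_le. intros i i_lt.
  assert (i_pos := INR_S_pos i).
  rewrite Cmod_div, Cmod_R, Rabs_pos_eq by (try apply INR_S_neq_0_C; lra).
  apply Rmult_le_compat_r; auto. apply Rlt_le, Rinv_0_lt_compat, i_pos.
Qed.

Lemma psum_const_div_INR (c : C) (n : nat) :
  psum (fun i => c / INR (S i))%C n = (c * harmonic n)%C :> C.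
Proof. rewrite <- psum_Cinv_INR, <- psum_Cscal. reflexivity. Qed.

Section FirstHerglotz.

Variables (N : nat) (x : C).
Hypothesis N_pos : (0 < N)%nat.
Hypothesis slit_x : slit_plane x.

Let INR_N_pos : 0 < INR N.
Proof. apply lt_0_INR, N_pos. Qed.

Let INR_N_neq_0_C : RtoC (INR N) <> RtoC 0.
Proof. apply RtoC_neq_0. lra. Qed.

Let slit_plane_direct (n : nat) : slit_plane (INR (S n) ^ N * x)%C.
Proof. rewrite <- RtoC_pow. apply slit_plane_scal; [apply pow_lt, INR_S_pos | exact slit_x]. Qed.

Definition truncated_direct_sum (P : nat) : C :=
  psum (fun n => truncated_gap (INR (S n) ^ N * x) (P ^ N) / INR (S n))%C P.

Definition truncated_dual_sum (P : nat) : C :=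
  psum (fun m => psum (fun l => truncated_gap (dual_pole N x (INR (S m)) l) P) N / INR (S m))%C
    (P ^ N).

Lemma truncated_direct_sum_error_lim :
  is_Clim_seq (fun p => psum (fun n => digamma_gap (INR (S n) ^ N * x) / INR (S n))%C (S p)
    - truncated_direct_sum (S p))%C (RtoC 0).
Proof.
  destruct (slit_plane_cone_bound x slit_x) as [c cone_x].
  apply is_Clim_seq_bound with (fun p => / c ^ 2 * (harmonic (S p ^ 1) * / INR (S p))).
  2:{ apply is_lim_seq_scal_0, is_lim_seq_harmonic_pow_div. }
  intros p. unfold Cminus at 1. rewrite Copp_0, Cplus_0_r, Nat.pow_1_r.
  unfold truncated_direct_sum. rewrite <- psum_Cminus.
  rewrite (psum_Cext _ (fun n => (digamma_gap (INR (S n) ^ N * x)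
    - truncated_gap (INR (S n) ^ N * x) (S p ^ N)) / INR (S n))%C)
    by (intros; unfold Cdiv; ring).
  eapply Rle_trans; [apply (Cmod_psum_div_INR_le _ (/ c ^ 2 * / INR (S p)))|right; ring].
  intros n _.
  assert (power_ge : (S p <= S p ^ N)%nat)
    by (rewrite <- (Nat.pow_1_r (S p)) at 1; apply Nat.pow_le_mono_r; lia).
  eapply Rle_trans; [apply (Cmod_digamma_gap_minus_truncated_le c); auto; [|lia]|].
  - rewrite <- RtoC_pow. apply cone_bound_scal; [apply pow_lt, INR_S_pos | exact cone_x].
  - apply Rmult_le_compat_l; [apply Rlt_le, Rinv_0_lt_compat, pow_lt, cone_x|].
    apply Rinv_le_contravar; [apply INR_S_pos | apply le_INR, power_ge].
Qed.

Lemma truncated_dual_sum_error_lim :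
  is_Clim_seq (fun p =>
    psum (fun m => psum (fun l => digamma_gap (dual_pole N x (INR (S m)) l)) N / INR (S m))%C
      (S p ^ N)
    - truncated_dual_sum (S p))%C (RtoC 0).
Proof.
  set (alpha := (Rabs (Im (Clog x)) + (INR N - 1) * PI) / INR N).
  assert (alpha_lt : alpha < PI) by (apply dual_log_bound_lt_PI; assumption).
  set (c := (1 + cos alpha) / 2).
  apply is_Clim_seq_bound with
    (fun p => INR N * / c ^ 2 * (harmonic (S p ^ N) * / INR (S p))).
  2:{ apply is_lim_seq_scal_0, is_lim_seq_harmonic_pow_div. }
  intros p. unfold Cminus at 1. rewrite Copp_0, Cplus_0_r.
  unfold truncated_dual_sum. rewrite <- psum_Cminus.
  rewrite (psum_Cext _ (fun m => psum (fun l => digamma_gap (dual_pole N x (INR (S m)) l) -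
    truncated_gap (dual_pole N x (INR (S m)) l) (S p)) N / INR (S m))%C)
    by (intros; rewrite (psum_Cminus (fun l => digamma_gap _)); unfold Cdiv; ring).
  eapply Rle_trans; [apply (Cmod_psum_div_INR_le _ (INR N * (/ c ^ 2 * / INR (S p))))|right; ring].
  intros m _. rewrite <- psum_Rconst. apply Cmod_psum_le. intros l l_lt.
  apply Cmod_digamma_gap_minus_truncated_le; [apply slit_plane_dual_pole; assumption| |lia].
  apply cone_bound_scal; [apply Rpower_pos|]. rewrite dual_point_Cexp.
  apply cone_bound_Cexp; [apply Rabs_Im_dual_log_le; assumption | exact alpha_lt].
Qed.

Lemma truncated_direct_term (P n : nat) : (0 < P)%nat ->
  (truncated_gap (INR (S n) ^ N * x) (P ^ N) / INR (S n))%C =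
  (/ INR (S n) * Clog (1 + ((INR (S n) / INR P) ^ N)%R * x)
    + (INR N * ln (INR P) - Clog x - harmonic (P ^ N)) / INR (S n)
    - INR N * (ln (INR (S n)) / INR (S n))
    + psum (fun m => herglotz_kernel 1 N x (INR (S m)) (INR (S n))) (P ^ N))%C.
Proof.
  intros P_pos. assert (INR_P_pos := lt_0_INR P P_pos). assert (n_pos := INR_S_pos n).
  assert (nC_nz := INR_S_neq_0_C n).
  assert (power_pos := pow_lt _ N INR_P_pos). assert (n_power_pos := pow_lt _ N n_pos).
  assert (ratio_pos : 0 < (INR (S n) / INR P) ^ N) by (apply pow_lt, Rdiv_lt_0_compat; assumption).
  assert (log_shifted : Clog (INR (S n) ^ N * x + INR (P ^ N)) =
    (INR N * ln (INR P) + Clog (1 + ((INR (S n) / INR P) ^ N)%R * x))%C).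
  { replace (INR (S n) ^ N * x + INR (P ^ N))%C
      with ((INR P ^ N)%R * (1 + ((INR (S n) / INR P) ^ N)%R * x))%C.
    - rewrite Clog_scal, ln_pow, RtoC_mult
        by (try apply slit_plane_affine; auto; lra). reflexivity.
    - unfold Rdiv.
      rewrite Rpow_mult_distr, pow_inv, pow_INR, RtoC_mult, RtoC_inv, <- RtoC_pow by lra.
      field. apply RtoC_neq_0. lra. }
  assert (log_direct : Clog (INR (S n) ^ N * x) = (INR N * ln (INR (S n)) + Clog x)%C).
  { rewrite <- RtoC_pow, Clog_scal, ln_pow, RtoC_mult by auto. reflexivity. }
  assert (kernel_sum : psum (fun m => herglotz_kernel 1 N x (INR (S m)) (INR (S n))) (P ^ N) =
    ((harmonic (P ^ N) - shifted_harmonic (INR (S n) ^ N * x) (P ^ N)) / INR (S n))%C :> C).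
  { rewrite (psum_Cext _ (fun m => / INR (S n) *
      (/ INR (S m) - / (INR (S n) ^ N * x + INR (S m))))%C).
    - rewrite psum_Cscal, psum_Cminus, psum_Cinv_INR. unfold Cdiv, shifted_harmonic. ring.
    - intros m _. rewrite herglotz_kernel_partial_fractions by (auto using INR_S_pos; lia).
      rewrite Cpow_1_r. apply Cmult_comm. }
  unfold truncated_gap. rewrite log_shifted, log_direct, kernel_sum. field. exact nC_nz.
Qed.

Lemma truncated_dual_term (P m : nat) : (0 < P)%nat ->
  (psum (fun l => truncated_gap (dual_pole N x (INR (S m)) l) P) N / INR (S m))%C =
  (/ INR (S m) * Clog (1 + (INR (S m) / INR P ^ N)%R / x)
    + (INR N * ln (INR P) + Clog x) / INR (S m) - ln (INR (S m)) / INR (S m)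
    - INR N * psum (fun n => herglotz_kernel 1 N x (INR (S m)) (INR (S n))) P)%C.
Proof.
  intros P_pos. assert (INR_P_pos := lt_0_INR P P_pos). assert (m_pos := INR_S_pos m).
  assert (mC_nz := INR_S_neq_0_C m). assert (power_pos := pow_lt _ N INR_P_pos).
  assert (x_nz := slit_plane_neq_0 x slit_x).
  assert (log_shifted : Clog (INR (S m) / x + (INR P ^ N)%R) =
    (INR N * ln (INR P) + Clog (1 + (INR (S m) / INR P ^ N)%R / x))%C).
  { replace (INR (S m) / x + (INR P ^ N)%R)%C
      with ((INR P ^ N)%R * (1 + (INR (S m) / INR P ^ N)%R * / x))%C.
    - rewrite Clog_scal, ln_pow, RtoC_mult; auto.
      apply slit_plane_affine; auto using slit_plane_inv; try lra.
      + apply Rlt_le, Rdiv_lt_0_compat; assumption.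
      + assert (0 < INR (S m) / INR P ^ N) by (apply Rdiv_lt_0_compat; assumption). lra.
    - assert (powerC_nz : RtoC (INR P ^ N) <> RtoC 0) by (apply RtoC_neq_0; lra).
      rewrite RtoC_div by lra. field. auto. }
  assert (harmonic_sum : psum (fun l => shifted_harmonic (dual_pole N x (INR (S m)) l) P) N =
    (INR N * INR (S m) * psum (fun n => herglotz_kernel 1 N x (INR (S m)) (INR (S n))) P)%C :> C).
  { rewrite (psum_Cext _ (fun l => dual_weight 1 N l *
      shifted_harmonic (dual_pole N x (INR (S m)) l) P)%C)
      by (intros; rewrite dual_weight_1; ring).
    rewrite psum_dual_weight_shifted_harmonic by (auto; lia).
    replace ((INR N + INR 1 - 1) / INR N) with 1 by (simpl (INR 1); field; lra).
    rewrite Rpower_1 by exact m_pos. simpl (1 - 1)%nat. simpl (Cpow _ 0). field. }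
  unfold truncated_gap. rewrite !psum_Cminus, psum_Clog_dual_pole, harmonic_sum by (auto; lra).
  rewrite (psum_Cext (fun l => Clog (dual_pole N x _ l))
    (fun l => Clog (dual_pole N x (INR (S m)) l + 0)))
    by (intros; rewrite Cplus_0_r; reflexivity).
  rewrite psum_Clog_dual_pole, pow_i, Cplus_0_r, Clog_div, log_shifted by (auto; lra || lia).
  field. exact mC_nz.
Qed.

Lemma truncated_sums_eq (P : nat) : (0 < P)%nat ->
  (truncated_direct_sum P + / INR N * truncated_dual_sum P)%C =
  (log_riemann_sum N P x
    + (RtoC (- INR N * (ln_harmonic P - ln (INR P) ^ 2 / 2)
        - / INR N * (ln_harmonic (P ^ N) - ln (INR (P ^ N)) ^ 2 / 2)
        - (harmonic P - ln (INR P)) * (harmonic (P ^ N) - ln (INR (P ^ N))))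
      + Clog x * (/ INR N * (harmonic (P ^ N) - ln (INR (P ^ N)))
        - (harmonic P - ln (INR P)))%R))%C.
Proof.
  intros P_pos. unfold truncated_direct_sum, truncated_dual_sum, log_riemann_sum.
  rewrite (psum_Cext _ _ P (fun n _ => truncated_direct_term P n P_pos)).
  rewrite (psum_Cext _ _ (P ^ N) (fun m _ => truncated_dual_term P m P_pos)).
  repeat (rewrite psum_Cplus || rewrite psum_Cminus).
  rewrite !psum_Cscal, !psum_const_div_INR, !psum_ln_div_INR.
  rewrite (psum_switch (fun n m => herglotz_kernel 1 N x (INR (S m)) (INR (S n)))).
  rewrite pow_INR, ln_pow by apply lt_0_INR, P_pos.
  generalize (psum (fun i => / INR (S i) * Clog (1 + ((INR (S i) / INR P) ^ N)%R * x))%C P : C).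
  generalize (psum (fun i => / INR (S i) * Clog (1 + (INR (S i) / INR P ^ N)%R / x))%C (P ^ N) : C).
  generalize (psum (fun j => psum (fun i => herglotz_kernel 1 N x (INR (S j)) (INR (S i))) P)
    (P ^ N) : C).
  generalize (ln (INR P)) (harmonic P) (harmonic (P ^ N)) (ln_harmonic P) (ln_harmonic (P ^ N)).
  intros.
  repeat first [ rewrite RtoC_plus | rewrite RtoC_minus | rewrite RtoC_mult | rewrite RtoC_opp
    | rewrite RtoC_inv by lra | rewrite RtoC_div by lra | rewrite RtoC_pow ].
  field. auto.
Qed.

Lemma truncated_sums_lim :
  is_Clim_seq (fun p => truncated_direct_sum (S p) + / INR N * truncated_dual_sum (S p))%C
    (/ INR N * (PI ^ 2 / 6 + Clog x ^ 2 / 2)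
     + (RtoC (- INR N * stieltjes_gamma1 - / INR N * stieltjes_gamma1 - euler_gamma * euler_gamma)
        + Clog x * (/ INR N * euler_gamma - euler_gamma)%R))%C.
Proof.
  assert (gamma_P := euler_gamma_lim). assert (gamma1_P := stieltjes_gamma1_lim).
  assert (gamma_Q := is_lim_seq_S_pow (fun n => harmonic n - ln (INR n)) _ N N_pos gamma_P).
  assert (gamma1_Q :=
    is_lim_seq_S_pow (fun n => ln_harmonic n - ln (INR n) ^ 2 / 2) _ N N_pos gamma1_P).
  eapply filterlim_ext; [intros p; symmetry; apply truncated_sums_eq; lia|].
  apply is_Clim_seq_plus; [apply log_riemann_sum_lim; assumption|].
  apply is_Clim_seq_plus.
  - apply is_Clim_seq_RtoC. apply is_lim_seq_minus'; [apply is_lim_seq_minus'|].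
    + apply is_lim_seq_mult'; [apply is_lim_seq_const | exact gamma1_P].
    + apply is_lim_seq_mult'; [apply is_lim_seq_const | exact gamma1_Q].
    + apply is_lim_seq_mult'; [exact gamma_P | exact gamma_Q].
  - apply is_Clim_seq_scal, is_Clim_seq_RtoC, is_lim_seq_minus'; [|exact gamma_P].
    apply is_lim_seq_mult'; [apply is_lim_seq_const | exact gamma_Q].
Qed.

Definition Herglotz_partial_sums (P : nat) : C :=
  (psum (fun n => digamma_gap (INR (S n) ^ N * x) / INR (S n)) P
    + / INR N * psum (fun m => psum (fun l => digamma_gap (dual_pole N x (INR (S m)) l)) N
        / INR (S m)) (P ^ N))%C.

Lemma Herglotz_partial_sums_lim :
  is_Clim_seq (fun p => Herglotz_partial_sums (S p))
    (Herglotz 1 (INR N) x + Czeta (INR N + 1)%R / x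
      + / INR N * (dual_Herglotz_sum N x 1 - INR N * Bterm 1 N x))%C.
Proof.
  apply is_Clim_seq_plus; [|apply is_Clim_seq_scal].
  - apply (is_Clim_seq_incr_1 (psum _)), is_series_psum_C.
    assert (sum_direct := is_series_Herglotz_nat 1 N x ltac:(lia) slit_x).
    rewrite (Rplus_comm (INR 1)) in sum_direct.
    eapply is_series_Cext; [|exact sum_direct]. intros n. cbv beta. rewrite Cpow_1_r. reflexivity.
  - assert (sum_dual := is_series_dual_Herglotz N x N_pos slit_x 1 ltac:(lia)).
    apply is_series_psum_C in sum_dual.
    replace (dual_Herglotz_sum N x 1 - INR N * Bterm 1 N x)%C
      with (dual_Herglotz_sum N x 1 + (-1) ^ 1 * INR N * Bterm 1 N x)%C by (simpl; ring).
    eapply filterlim_ext;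
      [|exact (filterlim_comp _ _ _ _ _ _ _ _ (filterlim_S_pow N N_pos) sum_dual)].
    intros p. apply psum_Cext. intros m _.
    replace ((INR N + INR 1 - 1) / INR N) with 1 by (simpl (INR 1); field; lra).
    rewrite Rpower_1 by apply INR_S_pos. unfold Cdiv. f_equal. apply psum_Cext. intros l _.
    rewrite dual_weight_1. apply Cmult_1_l.
Qed.

Lemma Herglotz_transform_1 :
  (Herglotz 1 (INR N) x + 1 / INR N * dual_Herglotz_sum N x 1)%C =
  (1 / INR N *
      ((PI ^ 2 / 6)%R - (INR N - 1) * euler_gamma * Clog x + 1 / 2 * Clog x ^ 2
        - INR N * euler_gamma ^ 2 - (INR N ^ 2 + 1) * stieltjes_gamma1)
    - Czeta (INR N + 1)%R / x + Bterm 1 N x)%C.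
Proof.
  assert (value_lim := is_Clim_seq_plus _ _ _ _ truncated_sums_lim
    (is_Clim_seq_plus _ _ _ _ truncated_direct_sum_error_lim
      (is_Clim_seq_scal (/ INR N) _ _ truncated_dual_sum_error_lim))).
  apply (filterlim_ext _ (fun p => Herglotz_partial_sums (S p))) in value_lim.
  2:{ intros p. unfold Herglotz_partial_sums. ring. }
  assert (total := is_Clim_seq_unique _ _ _ Herglotz_partial_sums_lim value_lim).
  assert (x_nz := slit_plane_neq_0 x slit_x).
  replace (Herglotz 1 (INR N) x + 1 / INR N * dual_Herglotz_sum N x 1)%C with
    ((Herglotz 1 (INR N) x + Czeta (INR N + 1)%R / x
        + / INR N * (dual_Herglotz_sum N x 1 - INR N * Bterm 1 N x))
      - Czeta (INR N + 1)%R / x + Bterm 1 N x)%C by (field; auto).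
  rewrite total. do 2 f_equal.
  repeat first [ rewrite RtoC_plus | rewrite RtoC_minus | rewrite RtoC_mult | rewrite RtoC_opp
    | rewrite RtoC_inv by lra | rewrite RtoC_div by lra | rewrite RtoC_pow ].
  field. auto.
Qed.

End FirstHerglotz.

Lemma sum_step2_dual_Herglotz_sum (k N : nat) (x : C) : (0 < N)%nat ->
  sum_step2 N (fun j =>
    Cexp (Ci * PI * IZR j * (INR k - 1) / INR N) *
    Herglotz ((INR N + INR k - 1) / INR N)%R (1 / INR N)%R
      (Cexp (- (Ci * PI * IZR j / INR N)) / Cpower x (1 / INR N)%R))%C =
  dual_Herglotz_sum N x k.
Proof.
  intros N_pos. assert (INR_N_nz : INR N <> 0) by (apply not_0_INR; lia).
  assert (NC_nz := RtoC_neq_0 _ INR_N_nz).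
  rewrite sum_step2_psum by exact N_pos. apply psum_Cext. intros l _.
  unfold dual_weight, dual_point, Nth_root. rewrite IZR_sym_index, !cis_Cexp. f_equal.
  - f_equal. rewrite RtoC_mult, RtoC_div, RtoC_mult, RtoC_minus by exact INR_N_nz.
    field. exact NC_nz.
  - do 3 f_equal. rewrite RtoC_opp, RtoC_mult, RtoC_div by exact INR_N_nz. field. exact NC_nz.
Qed.

Lemma sum_step2_dual_Herglotz_sum_1 (N : nat) (x : C) : (0 < N)%nat ->
  sum_step2 N (fun j => Herglotz 1 (1 / INR N)%R
    (Cexp (- (Ci * PI * IZR j / INR N)) / Cpower x (1 / INR N)%R)) =
  dual_Herglotz_sum N x 1.
Proof.
  intros N_pos. assert (INR_N_nz : INR N <> 0) by (apply not_0_INR; lia).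
  rewrite <- (sum_step2_dual_Herglotz_sum 1) by exact N_pos.
  unfold sum_step2. apply sum_n_ext. intros l.
  replace ((INR N + INR 1 - 1) / INR N) with 1 by (simpl (INR 1); field; exact INR_N_nz).
  replace (Ci * PI * IZR (2 * Z.of_nat l - (Z.of_nat N - 1)) * (INR 1 - 1) / INR N)%C
    with (RtoC 0) by (simpl (INR 1); unfold Cdiv; ring).
  rewrite Cexp_0. symmetry. apply Cmult_1_l.
Qed.

Theorem theorem2p1 (N : nat) (x : C) (hN : (1 <= N)%nat) (hx : slit_plane x) :
  (forall k : nat, (1 < k <= N)%nat ->
     (Cpower x ((1 - INR k) / INR N)%R * Herglotz (INR k) (INR N) x
      - (-1) ^ k / INR N *
        sum_step2 N (fun j =>
          Cexp (Ci * PI * IZR j * (INR k - 1) / INR N) *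
          Herglotz ((INR N + INR k - 1) / INR N)%R (1 / INR N)%R
            (Cexp (- (Ci * PI * IZR j / INR N)) / Cpower x (1 / INR N)%R))
      = PI / INR N *
          (Czeta (1 + (INR k - 1) / INR N)%R / sin (PI / INR N * (INR k - 1))%R)
        + Cpower x ((1 - INR k) / INR N)%R *
          (- ((euler_gamma + Clog x) * Czeta (INR k))
           + INR N * C_derive Czeta (INR k))
        - Czeta (INR k + INR N)%R / Cpower x ((INR N + INR k - 1) / INR N)%R
        + Bterm k N x)%C)
  /\
  (Herglotz 1 (INR N) x
   + 1 / INR N *
     sum_step2 N (fun j =>
       Herglotz 1 (1 / INR N)%R
         (Cexp (- (Ci * PI * IZR j / INR N)) / Cpower x (1 / INR N)%R))
   = 1 / INR N *
       ((PI ^ 2 / 6)%R - (INR N - 1) * euler_gamma * Clog x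
        + 1 / 2 * Clog x ^ 2 - INR N * euler_gamma ^ 2
        - (INR N ^ 2 + 1) * stieltjes_gamma1)
     - Czeta (INR N + 1)%R / x
     + Bterm 1 N x)%C.
Proof.
  assert (INR_N_nz : INR N <> 0) by (apply not_0_INR; lia).
  split.
  - intros k k_in. rewrite sum_step2_dual_Herglotz_sum by exact hN.
    replace ((1 - INR k) / INR N)%R with (- (INR (k - 1) / INR N))%R
      by (rewrite minus_INR by lia; simpl (INR 1); field; exact INR_N_nz).
    replace ((INR N + INR k - 1) / INR N)%R with (INR (N + (k - 1)) / INR N)%R
      by (rewrite plus_INR, minus_INR by lia; simpl (INR 1); field; exact INR_N_nz).
    rewrite Cpower_opp, !Cpower_INR_div, Cpow_add_r, Nth_root_pow_N by assumption.
    rewrite !(Cmult_comm (/ _)). exact (Herglotz_transform k N x k_in hx).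
  - rewrite sum_step2_dual_Herglotz_sum_1 by exact hN. apply Herglotz_transform_1; assumption.
Qed.
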